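(* Assume that $b=b_0\chi_{(b_1,b_2)}$, $c=c_0\chi_{(c_1,c_2)}$, $d=d_0\chi_{(d_1,d_2)}$ with $0<b_1<b_2<c_1<c_2<d_1<d_2<L$, and that $|c_0|<\min\left(\frac{\sqrt a}{c_2-c_1},\frac{1}{c_2-c_1}\right)$. Then there exists a constant $C>0$ such that for all $U_0\in D(\mathcal{A})$ ($C$ being independent of $U_0$), the energy of the solution $U(t)=(u,u_t,y,y_t)^\top=e^{t\mathcal{A}}U_0$ satisfies $$E(t)\le\frac{C}{t^4}\|U_0\|^2_{D(\mathcal{A})},\qquad t>0.$$
   Context: All functions are complex valued. $L>0$, $a>0$, $b_0,d_0>0$ and $c_0\in\mathbb{R}\setminus\{0\}$ are constants; $\chi_{(\alpha,\beta)}$ is the indicator function of $(\alpha,\beta)$. The energy space is $\mathcal{H}=(H_0^1(0,L)\times L^2(0,L))^2$ with inner product $(U,U_1)_{\mathcal{H}}=\int_0^L v\overline{v_1}\,dx+a\int_0^L u_x\overline{(u_1)_x}\,dx+\int_0^L z\overline{z_1}\,dx+\int_0^L y_x\overline{(y_1)_x}\,dx$ for $U=(u,v,y,z)^\top$, $U_1=(u_1,v_1,y_1,z_1)^\top$. The operator $\mathcal{A}$ has domain $D(\mathcal{A})=\{(u,v,y,z)^\top\in\mathcal{H}: v,z\in H_0^1(0,L),\ (au_x+bv_x)_x\in L^2(0,L),\ (y_x+dz_x)_x\in L^2(0,L)\}$, endowed with the graph norm $\|\cdot\|_{D(\mathcal{A})}$, and is given by $\mathcal{A}(u,v,y,z)^\top=(v,\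 (au_x+bv_x)_x-cz,\ z,\ (y_x+dz_x)_x+cv)^\top$; it generates a $C_0$-semigroup of contractions $(e^{t\mathcal{A}})_{t\ge0}$ on $\mathcal{H}$. The equation $U_t=\mathcal{A}U$ is the first order form, with $U=(u,u_t,y,y_t)^\top$, of $u_{tt}-(au_x+bu_{tx})_x+cy_t=0$, $y_{tt}-(y_x+dy_{tx})_x-cu_t=0$ on $(0,L)\times(0,\infty)$ with $u=y=0$ at $x=0,L$. The energy is $E(t)=\frac12\int_0^L(|u_t|^2+a|u_x|^2+|y_t|^2+|y_x|^2)\,dx$. *)

(* Defs.v *)
From HB Require Import structures.
From mathcomp Require Import all_boot all_order all_algebra.
From mathcomp Require Import all_classical all_reals all_analysis.
From mathcomp Require Import complex.

Set Implicit Arguments.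
Unset Strict Implicit.
Unset Printing Implicit Defensive.

Import Order.TTheory GRing.Theory Num.Theory.
Import numFieldNormedType.Exports.

Local Open Scope classical_set_scope.
Local Open Scope complex_scope.
Local Open Scope ring_scope.

Local Notation Re := complex.Re.
Local Notation Im := complex.Im.

Definition local_coef (R : realType) (k alpha beta : R) : R -> R :=
  fun x => k * \1_(`]alpha, beta[) x.

Section FunctionSpaces.
Context {R : realType}.
Implicit Types (L : R) (f g phi : R -> R[i]).

Local Notation mu := (@lebesgue_measure R).

(* Functions on (0, L) are represented by total functions on R, whose values
   outside (0, L) are irrelevant; two functions that agree almost everywhere on
   (0, L) represent the same element of L^2(0, L). *)
Definition cintegral L f : R[i] :=
  (\int[mu]_(x in `]0, L[) Re (f x)) +i* (\int[mu]_(x in `]0, L[) Im (f x)).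

Definition sqmod (z : R[i]) : R := Re z ^+ 2 + Im z ^+ 2.

Definition L2 L f : Prop :=
  [/\ measurable_fun `]0, L[ (fun x => Re (f x)),
      measurable_fun `]0, L[ (fun x => Im (f x)) &
      (\int[mu]_(x in `]0%R, L[) (sqmod (f x))%:E < +oo)%E].

Definition L2sqnorm L f : R := \int[mu]_(x in `]0, L[) sqmod (f x).

Definition cderive phi : R -> R[i] := fun x =>
  derive1 (fun t => Re (phi t)) x +i* derive1 (fun t => Im (phi t)) x.

(* C^1_c((0, L); C) *)
Definition test_function L phi : Prop :=
  [/\ forall x, derivable (fun t => Re (phi t)) x 1 /\
                derivable (fun t => Im (phi t)) x 1,
      continuous (derive1 (fun t => Re (phi t))),
      continuous (derive1 (fun t => Im (phi t))) &
      exists alpha beta : R, [/\ 0 < alpha, beta < L &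
        forall x, x \notin `[alpha, beta] -> phi x = 0]].

Definition weak_derivative L f g : Prop :=
  forall phi, test_function L phi ->
    cintegral L (fun x => f x * cderive phi x) =
    - cintegral L (fun x => g x * phi x).

Definition has_L2_wderiv L f : Prop :=
  exists g, L2 L g /\ weak_derivative L f g.

(* The weak derivative, as a function chosen in its a.e. class; it is the zero
   function when there is no weak derivative in L^2(0, L). *)
Definition wderiv L f : R -> R[i] :=
  xget (fun=> 0) [set g | L2 L g /\ weak_derivative L f g].

Definition H1 L f : Prop := L2 L f /\ has_L2_wderiv L f.

Definition H1norm L f : R :=
  Num.sqrt (L2sqnorm L f + L2sqnorm L (wderiv L f)).

(* closure of C^1_c((0, L); C) in H^1(0, L) *)
Definition H10 L f : Prop :=
  H1 L f /\ forall eps : R, 0 < eps ->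
    exists2 phi, test_function L phi & H1norm L (f - phi) < eps.

End FunctionSpaces.

(* ((u, v), (y, z)) stands for (u, v, y, z)^T; this type is an lmodType over
   R[i] for the pointwise operations. *)
Definition state (R : realType) : lmodType R[i] :=
  (((R -> R[i]) * (R -> R[i])) * ((R -> R[i]) * (R -> R[i])))%type.

Section EnergySpace.
Context {R : realType}.
Variables (L a : R).
Implicit Types U V : state R.

Definition inH U : Prop :=
  [/\ H10 L U.1.1, L2 L U.1.2, H10 L U.2.1 & L2 L U.2.2].

Definition innerH U V : R[i] :=
  let: ((u, v), (y, z)) := U in let: ((u1, v1), (y1, z1)) := V in
  cintegral L (fun x => v x * conjc (v1 x))
  + a%:C * cintegral L (fun x => wderiv L u x * conjc (wderiv L u1 x))
  + cintegral L (fun x => z x * conjc (z1 x))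
  + cintegral L (fun x => wderiv L y x * conjc (wderiv L y1 x)).

Definition normH U : R := Num.sqrt (Re (innerH U U)).

(* equality of the classes of U and V in H *)
Definition eqH U V : Prop := normH (U - V) = 0.

Definition energy U : R :=
  let: ((u, v), (y, z)) := U in
  2^-1 * \int[@lebesgue_measure R]_(x in `]0, L[)
    (sqmod (v x) + a * sqmod (wderiv L u x)
     + sqmod (z x) + sqmod (wderiv L y x)).

Section Operator.
Variables b c d : R -> R.

Definition flux1 U : R -> R[i] := fun x =>
  a%:C * wderiv L U.1.1 x + (b x)%:C * wderiv L U.1.2 x.

Definition flux2 U : R -> R[i] := fun x =>
  wderiv L U.2.1 x + (d x)%:C * wderiv L U.2.2 x.

Definition domA U : Prop :=
  [/\ inH U, H10 L U.1.2, H10 L U.2.2,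
      has_L2_wderiv L (flux1 U) & has_L2_wderiv L (flux2 U)].

Definition opA U : state R :=
  ((U.1.2, fun x => wderiv L (flux1 U) x - (c x)%:C * U.2.2 x),
   (U.2.2, fun x => wderiv L (flux2 U) x + (c x)%:C * U.1.2 x)).

Definition normDA U : R := Num.sqrt (normH U ^+ 2 + normH (opA U) ^+ 2).

End Operator.

(* T represents a C_0-semigroup of contractions on H; only times t >= 0 and
   states in H matter. *)
Definition contraction_C0_semigroup (T : R -> state R -> state R) : Prop :=
  [/\ forall t U, 0 <= t -> inH U -> inH (T t U) /\ normH (T t U) <= normH U,
      forall t (k : R[i]) U V, 0 <= t -> inH U -> inH V ->
        eqH (T t (k *: U + V)) (k *: T t U + T t V),
      forall U, inH U -> eqH (T 0 U) U,
      forall s t U, 0 <= s -> 0 <= t -> inH U ->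
        eqH (T (s + t) U) (T s (T t U)) &
      forall U, inH U -> normH (T t U - U) @[t --> 0^'+] --> (0 : R)].

Definition is_generator (T : R -> state R -> state R)
    (D : state R -> Prop) (A : state R -> state R) : Prop :=
  forall U V, inH U -> inH V ->
    (normH ((h^-1)%:C *: (T h U - U) - V) @[h --> 0^'+] --> (0 : R))
    <-> (D U /\ eqH (A U) V).

End EnergySpace.

(* Main.v *)
(** The resolvent satisfies |(i la - A)^-1|^2 <= K (1 + |la|) on the whole
imaginary axis.  The dissipation identity bounds the velocity gradients on the
two damped intervals by the source.  Comparing there the sup norms of velocity
and stress with the L^2 norm of the velocity bounds the energy density by
sqrt |la| times the source plus dissipation; it then propagates through the
undamped intervals, and through the coupling interval because |c0| (c2 - c1) is
small.  For bounded la the equation is tested with the displacement instead.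

Such a bound gives |T(t) x|^2 <= C t^-4 (|x|^2 + |A x|^2) for any contraction
semigroup.  Cut an orbit off in time with a quadratic B-spline of width tau and
sample it at N = 2^m times.  In the discrete Fourier transform in time a central
difference is multiplication by i la with la real, so the resolvent bound
applies at every frequency; by Parseval |T(8 tau) x|^2 is at most
K' tau^-2 ((2 + s) |x|^2 + s^-1 (|x| + |A x|)^2) for every s > 0.
Applying this to T(tau) x with s proportional to tau^2 propagates the decay rate
from the time scale tau to 9 tau.

Weak derivatives are linked to the resolvent equation by the du Bois-Reymond
lemma: a function with a weak derivative in L^2 has an absolutely continuous
representative, which vanishes at 0 and L when the function lies in H^1_0. *)

Require Import Defs.
From mathcomp Require Import all_boot all_order all_algebra.
From mathcomp Require Import all_classical all_reals all_analysis.
From mathcomp Require Import measurable_realfun complex ring lra.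

Import Order.TTheory GRing.Theory Num.Theory.
Import numFieldNormedType.Exports.

Local Open Scope classical_set_scope.
Local Open Scope ring_scope.

Set Implicit Arguments.
Unset Strict Implicit.
Unset Printing Implicit Defensive.

(** * Integrals over bounded intervals and absolutely continuous functions *)

Section IntervalIntegrals.
Context {R : realType}.
Implicit Types (al be ga x y k : R) (f g F G : R -> R).
Local Notation mu := (@lebesgue_measure R).

(** The damping coefficients jump, so strain and velocity gradient have no values at the interfaces.
    Velocity and stress are continuous there, and information passes from interval to interval only
    through them.

    The rate is a count of powers of [m = sqrt |la|]. Let [E] and [N] be the squared norms of state
    and source, and [X] the sum of [N] and the dissipation. The damped intervals lead to
    [E <= K m X]. The dissipation is itself of order [sqrt (E N)], so [E] is of order
    [m^2 N = |la| N]. A resolvent of size [|la|^(1/2)] corresponds to [t^-2] for orbits starting in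
    the domain, hence to [t^-4] for the energy.

    In the time domain the resolvent bound serves as an a priori estimate on the domain, and
    sampling keeps all sums finite. The setting is a subspace with a semidefinite form: states are
    functions rather than classes, so null vectors occur and operators are linear only modulo them.
    The unbounded factor [|la|] is split by [2 |la| <= s + la^2 / s]; the second term is charged to
    the time derivative of the source, and the free [s] is what makes the decay rate improve from
    one time scale to the next. *)

Definition itg al be f := mu.-integrable `]al, be[ (EFin \o f).
Definition I al be f : R := \int[mu]_(x in `]al, be[) f x.
(** Measurability of [f ^+ 2] does not imply that of [f], hence the separate conjunct. *)
Definition sq al be f :=
  measurable_fun `]al, be[ f /\ itg al be (fun x => f x ^+ 2).

Lemma aeS (P Q : R -> Prop) : {ae mu, forall x, P x} ->
  (forall x, P x -> Q x) -> {ae mu, forall x, Q x}.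
Proof.
by move=> hP PQ; apply: filterS hP => //; exact: (ae_filter_ringOfSetsType mu).
Qed.

Lemma aeI (P Q : R -> Prop) : {ae mu, forall x, P x} ->
  {ae mu, forall x, Q x} -> {ae mu, forall x, P x /\ Q x}.
Proof.
by move=> hP hQ; apply: filterI hP hQ; exact: (ae_filter_ringOfSetsType mu).
Qed.

Lemma itg_meas al be f : itg al be f -> measurable_fun `]al, be[ f.
Proof. by move=> /integrableP[/measurable_EFinP]. Qed.

Lemma itgS al be al' be' f :
  al <= al' -> be' <= be -> itg al be f -> itg al' be' f.
Proof.
move=> h1 h2; apply: integrableS => //; apply: subset_itv; by rewrite bnd_simp.
Qed.

Lemma itgD al be f g :
  itg al be f -> itg al be g -> itg al be (fun x => f x + g x).
Proof. by move=> hf hg; exact: (integrableD _ hf hg). Qed.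

Lemma itgZ al be k f : itg al be f -> itg al be (fun x => k * f x).
Proof. by move=> hf; exact: (integrableZl _ k hf). Qed.

Lemma itgZr al be k f : itg al be f -> itg al be (fun x => f x * k).
Proof. by move=> /(itgZ k); under eq_fun do rewrite mulrC. Qed.

Lemma itgN al be f : itg al be f -> itg al be (fun x => - f x).
Proof. by move=> /(itgZ (-1)); under eq_fun do rewrite mulN1r. Qed.

Lemma itgB al be f g :
  itg al be f -> itg al be g -> itg al be (fun x => f x - g x).
Proof. by move=> hf /itgN hg; exact: itgD. Qed.

Lemma mu_itv al be : (mu `]al, be[ < +oo)%E.
Proof. by rewrite lebesgue_measure_itv/=; case: ifP => _ //; rewrite -EFinB ltry. Qed.

Lemma itg_cst al be k : itg al be (fun=> k).
Proof.
apply: measurable_bounded_integrable => //; first exact: mu_itv.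
exists `|k|; split; first exact: num_real.
by move=> M kM x _; exact: ltW.
Qed.

Lemma itg_le al be f g : measurable_fun `]al, be[ f -> itg al be g ->
  (forall x, x \in `]al, be[ -> `|f x| <= g x) -> itg al be f.
Proof.
move=> mf hg fg; apply: le_integrable hg => //.
  exact/measurable_EFinP.
by move=> x hx /=; rewrite lee_fin (le_trans (fg _ hx))// ler_norm.
Qed.

Lemma itg_eq al be f g :
  (forall x, x \in `]al, be[ -> f x = g x) -> itg al be f -> itg al be g.
Proof. by move=> fg; apply: eq_integrable => // x /set_mem xi /=; rewrite fg. Qed.

Lemma itgM al be f g :
  sq al be f -> sq al be g -> itg al be (fun x => f x * g x).
Proof.
move=> [mf hf] [mg hg].
apply: (itg_le _ (itgD hf hg)); first exact: measurable_funM.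
move=> x _; rewrite ler_norml; nra.
Qed.

Lemma sq_cst al be k : sq al be (fun=> k).
Proof. by split => //; exact: itg_cst. Qed.

Lemma sq_itg al be f : sq al be f -> itg al be f.
Proof.
by move=> hf; have := itgM hf (sq_cst al be 1); under eq_fun do rewrite mulr1.
Qed.

Lemma sq_sqr al be f : sq al be f -> itg al be (fun x => f x ^+ 2).
Proof. by case. Qed.

Lemma sqS al be al' be' f :
  al <= al' -> be' <= be -> sq al be f -> sq al' be' f.
Proof.
move=> h1 h2 [mf hf]; split; last exact: itgS hf.
by apply: measurable_funS mf => //; apply: subset_itv; rewrite bnd_simp.
Qed.

Lemma sqD al be f g :
  sq al be f -> sq al be g -> sq al be (fun x => f x + g x).
Proof.
move=> hf hg; split; first exact: measurable_funD hf.1 hg.1.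
have := itgD (itgD hf.2 (itgZ 2 (itgM hf hg))) hg.2.
by apply: itg_eq => x _; ring.
Qed.

Lemma sqZ al be k f : sq al be f -> sq al be (fun x => k * f x).
Proof.
move=> [mf hf]; split; first exact: measurable_funM.
by apply: itg_eq (itgZ (k ^+ 2) hf) => x _; ring.
Qed.

Lemma sqZr al be k f : sq al be f -> sq al be (fun x => f x * k).
Proof. by move=> /(sqZ k); under eq_fun do rewrite mulrC. Qed.

Lemma sqN al be f : sq al be f -> sq al be (fun x => - f x).
Proof. by move=> /(sqZ (-1)); under eq_fun do rewrite mulN1r. Qed.

Lemma sqB al be f g :
  sq al be f -> sq al be g -> sq al be (fun x => f x - g x).
Proof. by move=> hf /sqN hg; exact: sqD. Qed.

Lemma sqM_bnd al be k f g : measurable_fun `]al, be[ f ->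
  (forall x, x \in `]al, be[ -> `|f x| <= k) ->
  sq al be g -> sq al be (fun x => f x * g x).
Proof.
move=> mf fk [mg hg]; split; first exact: measurable_funM.
apply: (itg_le _ (itgZ (k ^+ 2) hg)).
  by apply: measurable_funX; exact: measurable_funM.
move=> x /fk h; rewrite exprMn normrM !ger0_norm ?sqr_ge0//.
by rewrite ler_wpM2r ?sqr_ge0// -real_normK ?num_real// lerXn2r ?nnegrE// (le_trans _ h).
Qed.

Lemma sq_bnd al be k f : measurable_fun `]al, be[ f ->
  (forall x, x \in `]al, be[ -> `|f x| <= k) -> sq al be f.
Proof.
move=> mf fk; have := sqM_bnd mf fk (sq_cst al be 1).
by under eq_fun do rewrite mulr1.
Qed.

Lemma ID al be f g : itg al be f -> itg al be g ->
  I al be (fun x => f x + g x) = I al be f + I al be g.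
Proof. exact: RintegralD. Qed.

Lemma IB al be f g : itg al be f -> itg al be g ->
  I al be (fun x => f x - g x) = I al be f - I al be g.
Proof. exact: RintegralB. Qed.

Lemma IZ al be k f : itg al be f -> I al be (fun x => k * f x) = k * I al be f.
Proof. exact: RintegralZl. Qed.

Lemma IN al be f : itg al be f -> I al be (fun x => - f x) = - I al be f.
Proof.
by move=> /(IZ (-1)); rewrite mulN1r => <-; under eq_fun do rewrite -mulN1r.
Qed.

Lemma Icst al be k : al <= be -> I al be (fun=> k) = k * (be - al).
Proof.
move=> ab; rewrite /I Rintegral_cst//; congr (_ * _).
have E : lebesgue_measure `]al, be[%classic = (be - al)%:E.
  rewrite lebesgue_measure_itv/= lte_fin.
  case: ltP => //= h; have -> : al = be by apply/le_anti/andP.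
  by rewrite subrr.
exact: (congr1 fine E).
Qed.

Lemma I_eq al be f g :
  (forall x, x \in `]al, be[ -> f x = g x) -> I al be f = I al be g.
Proof. by move=> fg; apply: eq_Rintegral => x /set_mem /fg. Qed.

Lemma I_le al be f g : itg al be f -> itg al be g ->
  (forall x, x \in `]al, be[ -> f x <= g x) -> I al be f <= I al be g.
Proof. by move=> hf hg fg; apply: le_Rintegral => // x; exact: fg. Qed.

Lemma I_ge0 al be f : (forall x, x \in `]al, be[ -> 0 <= f x) -> 0 <= I al be f.
Proof. by move=> h; apply: Rintegral_ge0 => x; exact: h. Qed.

Lemma I_ae_eq al be f g : measurable_fun `]al, be[ f -> measurable_fun `]al, be[ g ->
  {ae mu, forall x, x \in `]al, be[ -> f x = g x} -> I al be f = I al be g.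
Proof.
move=> mf mg fg; rewrite /I /Rintegral; congr fine; apply: ae_eq_integral => //.
- exact/measurable_EFinP.
- exact/measurable_EFinP.
- by apply: (aeS fg) => x h xi /=; rewrite h.
Qed.

Lemma itg_ae_eq al be f g : measurable_fun `]al, be[ g ->
  {ae mu, forall x, x \in `]al, be[ -> f x = g x} -> itg al be f -> itg al be g.
Proof.
move=> mg fg hf; have mf := itg_meas hf.
apply/integrableP; split; first exact/measurable_EFinP.
case/integrableP: hf => _; congr (_ < _)%E; apply: ae_eq_integral => //.
- by apply: measurableT_comp => //; exact/measurable_EFinP.
- by apply: measurableT_comp => //; exact/measurable_EFinP.
- by apply: (aeS fg) => x h xi /=; rewrite h.
Qed.

(** Replacing [g] by [max f g], which equals it almost everywhere, makes the inequality hold at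
    every point. *)
Lemma I_le_ae al be f g : itg al be f -> itg al be g ->
  {ae mu, forall x, x \in `]al, be[ -> f x <= g x} -> I al be f <= I al be g.
Proof.
move=> hf hg fg; have mf := itg_meas hf; have mg := itg_meas hg.
have mm : measurable_fun `]al, be[ (fun x => Num.max (f x) (g x)).
  exact: measurable_maxr.
have ae : {ae mu, forall x, x \in `]al, be[ -> g x = Num.max (f x) (g x)}.
  by apply: (aeS fg) => x h xi; rewrite max_r// h.
rewrite (I_ae_eq mg mm ae); apply: I_le => //; first exact: itg_ae_eq ae hg.
by move=> x _; rewrite le_max lexx.
Qed.

Lemma I_ge al be f : be <= al -> I al be f = 0.
Proof. by move=> ba; rewrite /I set_itv_ge ?Rintegral_set0// bnd_simp -leNgt. Qed.

Lemma I_split al ga be f : al <= ga -> ga <= be -> itg al be f ->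
  I al be f = I al ga f + I ga be f.
Proof.
rewrite le_eqVlt => /predU1P[->|ag]; first by rewrite (@I_ge ga ga)// add0r.
rewrite le_eqVlt => /predU1P[<-|gb] hf; first by rewrite (@I_ge ga ga)// addr0.
rewrite /I -(@Rintegral_itvB _ _ (BRight al) (BLeft be) ga)//; last first.
  by rewrite leBSide/= ltW.
rewrite [RHS]addrC (@Rintegral_itv_bndo_bndc _ (BRight al) ga) ?subrK//.
exact: (itgS (lexx _) (ltW gb) hf).
Qed.

Lemma I_le_abs al be f : itg al be f -> `|I al be f| <= I al be (fun x => `|f x|).
Proof. exact: le_normr_Rintegral. Qed.

Lemma itg_abs al be f : itg al be f -> itg al be (fun x => `|f x|).
Proof. exact: integrable_norm. Qed.

Lemma I_mono al be al' be' f : al <= al' -> al' <= be' -> be' <= be ->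
  itg al be f -> (forall x, x \in `]al, be[ -> 0 <= f x) ->
  I al' be' f <= I al be f.
Proof.
move=> h1 h2 h3 hf f0.
rewrite (I_split h1 (le_trans h2 h3) hf).
rewrite (I_split h2 h3 (itgS h1 (lexx _) hf)).
have hA : 0 <= I al al' f.
  apply: I_ge0 => x; rewrite in_itv/= => /andP[xl xr]; apply: f0.
  by rewrite in_itv/= xl/= (lt_le_trans xr)// (le_trans h2).
have hB : 0 <= I be' be f.
  apply: I_ge0 => x; rewrite in_itv/= => /andP[xl xr]; apply: f0.
  by rewrite in_itv/= xr andbT (le_lt_trans _ xl)// (le_trans h1).
lra.
Qed.

(** Cauchy-Schwarz against the constant 1, read off from the variance: the integral of [(f - m)^2]
    is nonnegative when [m] is the mean of [f]. *)
Lemma I_sqr_le al be f : al <= be -> sq al be f ->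
  (I al be f) ^+ 2 <= (be - al) * I al be (fun x => f x ^+ 2).
Proof.
move=> ab hf; have h1 := sq_itg hf; have h2 := sq_sqr hf.
have [->|ab'] := eqVneq al be; first by rewrite !I_ge// subrr mul0r expr0n.
have d0 : 0 < be - al by rewrite subr_gt0 lt_neqAle ab' ab.
set m := I al be f / (be - al).
have : 0 <= I al be (fun x => (f x ^+ 2 + (- 2 * m) * f x) + m ^+ 2).
  by apply: I_ge0 => x _; rewrite [X in 0 <= X](_ : _ = (f x - m) ^+ 2); [exact: sqr_ge0|ring].
rewrite ID//; [|by apply: itgD => //; exact: itgZ|exact: itg_cst].
rewrite ID//; last exact: itgZ.
rewrite IZ// Icst//.
have -> : I al be f = m * (be - al) by rewrite /m divfK// gt_eqF.
nra.
Qed.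

(* F is absolutely continuous on [al, be] with derivative f in L^2. *)
Definition ac al be F f :=
  sq al be f /\ forall x, al <= x <= be -> F x = F al + I al x f.

Lemma ac_incr al be F f x y : ac al be F f -> al <= x -> x <= y -> y <= be ->
  F y = F x + I x y f.
Proof.
move=> [hf hF] ax xy yb.
rewrite (hF y) ?(le_trans ax xy)// (hF x) ?ax ?(le_trans xy yb)//.
by rewrite (I_split ax xy) ?addrA//; apply: itgS (sq_itg hf).
Qed.

Lemma acS al be al' be' F f : al <= al' -> be' <= be ->
  ac al be F f -> ac al' be' F f.
Proof.
move=> h1 h2 h; split; first exact: sqS h.1.
by move=> x /andP[h3 h4]; apply: (ac_incr h) => //; exact: le_trans h2.
Qed.

Lemma ac_sqr_incr al be F f x y : ac al be F f ->
  al <= x -> x <= y -> y <= be ->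
  (F y - F x) ^+ 2 <= (y - x) * I al be (fun t => f t ^+ 2).
Proof.
move=> h ax xy yb; rewrite (ac_incr h ax xy yb) addrC addKr.
apply: (le_trans (I_sqr_le xy (sqS ax yb h.1))).
apply: ler_wpM2l; first by rewrite subr_ge0.
by apply: I_mono => //; [exact: sq_sqr h.1 |move=> t _; exact: sqr_ge0].
Qed.

(** Nothing is known about [F] outside [[al, be]]. Composing it with the projection onto that
    interval gives a function continuous on the whole line, from which extrema and measurability
    follow. *)
Lemma ac_clamp_continuous al be F f : al <= be -> ac al be F f ->
  continuous (fun x => F (Num.max al (Num.min x be))).
Proof.
move=> ab h; set M := I al be (fun t => f t ^+ 2).
have M0 : 0 <= M by apply: I_ge0 => t _; exact: sqr_ge0.
pose cl x := Num.max al (Num.min x be).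
(* A Hoelder bound of exponent 1/2; the [+ 1] keeps the constant positive even when [f] vanishes. *)
have key x y : (F (cl x) - F (cl y)) ^+ 2 <= `|x - y| * (M + 1).
  wlog xy : x y / x <= y.
    move=> W; have [/W//|/ltW/W] := leP x y; by rewrite distrC -sqrrN opprB.
  have c1 : al <= cl x by rewrite /cl le_max lexx.
  have c2 : cl y <= be by rewrite /cl ge_max ab ge_min lexx orbT.
  have c3 : cl x <= cl y /\ cl y - cl x <= y - x.
    by rewrite /cl; case: (leP x be) => ?; case: (leP y be) => ?;
      case: (leP al x) => ?; case: (leP al y) => ?; case: (leP al be) => ?; lra.
  have := ac_sqr_incr h c1 c3.1 c2; rewrite -/M -sqrrN opprB distrC ger0_norm; nra.
move=> x; apply/cvgrPdist_lt => e e0.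
have M1 : 0 < M + 1 by lra.
have d0 : 0 < e ^+ 2 / (M + 1) by rewrite divr_gt0 ?exprn_gt0.
near=> y.
have hy : `|x - y| < e ^+ 2 / (M + 1).
  by near: y; exact: (@nbhsx_ballx R R^o x _ d0).
have : `|F (cl x) - F (cl y)| ^+ 2 < e ^+ 2.
  rewrite real_normK ?num_real//; apply: (le_lt_trans (key x y)).
  by rewrite -ltr_pdivlMr.
by rewrite ltr_pXn2r ?nnegrE// ltW.
Unshelve. all: by end_near. Qed.

Lemma ac_max al be F f : al <= be -> ac al be F f ->
  exists x0, al <= x0 <= be /\ forall x, al <= x <= be -> F x <= F x0.
Proof.
move=> ab h.
have [c hc hm] := EVT_max ab (continuous_subspaceT (ac_clamp_continuous ab h)).
have cl x : al <= x <= be -> Num.max al (Num.min x be) = x.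
  by move=> /andP[ax xb]; rewrite min_l// max_r.
move: hc; rewrite in_itv/= => hc; exists c; split => // x hx.
by have := hm x; rewrite in_itv/= hx !cl//; apply.
Qed.

Lemma ac_measurable al be F f : al <= be -> ac al be F f ->
  measurable_fun `]al, be[ F.
Proof.
move=> ab h.
apply: (@eq_measurable_fun _ _ _ _ _ (fun x => F (Num.max al (Num.min x be)))).
  move=> x /set_mem; rewrite /= in_itv/= => /andP[ax xb].
  by rewrite min_l ?max_r// ltW.
apply: measurable_funTS; apply: continuous_measurable_fun.
exact: ac_clamp_continuous ab h.
Qed.

Lemma acN al be F f : ac al be F f -> ac al be (fun x => - F x) (fun x => - f x).
Proof.
move=> h; split; first exact: sqN h.1.
move=> x /andP[ax xb]; rewrite (ac_incr h (lexx _) ax xb) opprD IN//.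
by apply: itgS (sq_itg h.1).
Qed.

Lemma ac_bnd al be F f : al <= be -> ac al be F f ->
  exists k, forall x, al <= x <= be -> `|F x| <= k.
Proof.
move=> ab h; have [x1 [_ h1]] := ac_max ab h.
have [x2 [_ h2]] := ac_max ab (acN h).
exists (Num.max (F x1) (- F x2)) => x hx.
by rewrite ler_norml lerNl !le_max h1// h2// orbT.
Qed.

Lemma ac_sq al be F f : al <= be -> ac al be F f -> sq al be F.
Proof.
move=> ab h; have [k hk] := ac_bnd ab h.
apply: (@sq_bnd _ _ k); first exact: ac_measurable h.
by move=> x; rewrite in_itv/= => /andP[/ltW ax /ltW xb]; apply: hk; rewrite ax.
Qed.

Lemma ac_sqM al be F f g : al <= be -> ac al be F f -> sq al be g ->
  sq al be (fun x => F x * g x).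
Proof.
move=> ab h hg; have [k hk] := ac_bnd ab h.
apply: (@sqM_bnd _ _ k) => //; first exact: ac_measurable h.
by move=> x; rewrite in_itv/= => /andP[/ltW ax /ltW xb]; apply: hk; rewrite ax.
Qed.

Lemma ac_sqMr al be F f g : al <= be -> ac al be F f -> sq al be g ->
  sq al be (fun x => g x * F x).
Proof.
by move=> ab h /(ac_sqM ab h); under eq_fun do rewrite mulrC.
Qed.

Lemma acD al be F G f g : ac al be F f -> ac al be G g ->
  ac al be (fun x => F x + G x) (fun x => f x + g x).
Proof.
move=> hf hg; split; first exact: sqD hf.1 hg.1.
move=> x /andP[ax xb].
rewrite (ac_incr hf (lexx _) ax xb) (ac_incr hg (lexx _) ax xb) ID; first ring.
- by apply: itgS (sq_itg hf.1).
- by apply: itgS (sq_itg hg.1).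
Qed.

Lemma acB al be F G f g : ac al be F f -> ac al be G g ->
  ac al be (fun x => F x - G x) (fun x => f x - g x).
Proof. by move=> hf /acN hg; exact: acD. Qed.

Lemma acZ al be k F f : ac al be F f ->
  ac al be (fun x => k * F x) (fun x => k * f x).
Proof.
move=> h; split; first exact: sqZ h.1.
move=> x /andP[ax xb]; rewrite (ac_incr h (lexx _) ax xb) mulrDr IZ//.
by apply: itgS (sq_itg h.1).
Qed.

Lemma ac_cst al be k : ac al be (fun=> k) (fun=> 0).
Proof.
by split; [exact: sq_cst|move=> x /andP[ax _]; rewrite Icst// mul0r addr0].
Qed.

Lemma ac_id al be : ac al be id (fun=> 1).
Proof.
split; first exact: sq_cst.
by move=> x /andP[ax _]; rewrite Icst// mul1r addrC subrK.
Qed.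

Lemma ac_eq al be F f g : (forall x, x \in `]al, be[ -> f x = g x) ->
  ac al be F f -> ac al be F g.
Proof.
move=> fg [[mf hf] hF]; split; [split|].
- by apply: eq_measurable_fun mf => x /set_mem /fg.
- by apply: itg_eq hf => x /fg ->.
- move=> x hx; rewrite hF//; congr (_ + _); apply: I_eq => t.
  rewrite in_itv/= => /andP[h1 h2]; apply: fg.
  by case/andP: hx => ax xb; rewrite in_itv/= h1 (lt_le_trans h2).
Qed.

(* An interval function bounded by (y - x) (M y - M x) halves under bisection. *)
Lemma cst_of_bisection al be (P M : R -> R) :
  (forall x y, al <= x -> x <= y -> y <= be ->
    `|P y - P x| <= (y - x) * (M y - M x)) ->
  forall x y, al <= x -> x <= y -> y <= be -> P y = P x.
Proof.
move=> h.
have H n : forall x y, al <= x -> x <= y -> y <= be ->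
    `|P y - P x| <= (y - x) * (M y - M x) / 2 ^+ n.
  elim: n => [|n IH] x y ax xy yb; first by rewrite expr0 divr1; exact: h.
  pose m := (x + y) / 2.
  have xm : x <= m by rewrite /m; lra.
  have my : m <= y by rewrite /m; lra.
  have h1 := IH x m ax xm (le_trans my yb).
  have h2 := IH m y (le_trans ax xm) my yb.
  have -> : P y - P x = (P y - P m) + (P m - P x) by ring.
  apply: le_trans (ler_normD _ _) _; apply: le_trans (lerD h2 h1) _.
  rewrite exprS invfM /m le_eqVlt; apply/orP; left; apply/eqP; field.
  by rewrite expf_neq0// pnatr_eq0.
move=> x y ax xy yb; apply/eqP; rewrite -subr_eq0 -normr_le0.
apply/ler_addgt0Pr => e e0; rewrite add0r.
set K := (y - x) * (M y - M x).
have K0 : 0 <= K by apply: le_trans (h x y ax xy yb).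
have [n hn] : exists n : nat, K / e < n%:R.
  by exists (Num.bound (K / e)); apply: archi_boundP; rewrite divr_ge0// ltW.
apply: le_trans (H n _ _ ax xy yb) _.
rewrite ler_pdivrMr ?exprn_gt0// [e * _]mulrC -ler_pdivrMr//.
apply: le_trans (ltW hn) _; rewrite -natrX ler_nat; exact/ltnW/ltn_expl.
Qed.

(** The defect of the product rule over [[x, y]] is the integral of
    [(G y - G t) f t + (F x - F t) g t]. It is at most [2 A B], with [A] and [B] the integrals of
    [|f|] and [|g|] over [[x, y]], hence at most [A^2 + B^2]. By Cauchy-Schwarz this is [y - x]
    times an additive interval function, and bisection forces the defect to vanish. *)
Lemma acM al be F G f g : al <= be -> ac al be F f -> ac al be G g ->
  ac al be (fun x => F x * G x) (fun x => f x * G x + F x * g x).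
Proof.
move=> ab hf hg.
have s1 := ac_sqMr ab hg hf.1; have s2 := ac_sqM ab hf hg.1.
have s3 := sqD s1 s2.
split=> // x /andP[ax xb].
pose q t := f t ^+ 2 + g t ^+ 2.
have iq : itg al be q by apply: itgD; [exact: hf.1.2|exact: hg.1.2].
pose P y := F y * G y - I al y (fun x => f x * G x + F x * g x).
suff : P x = P al by rewrite /P (@I_ge al al)// => hP; lra.
apply: (@cst_of_bisection al be P (fun y => I al y q)) => // {ax xb}x y ax xy yb.
have iS u : itg al be u -> itg x y u by exact: itgS.
have ff := iS _ (sq_itg hf.1); have gg := iS _ (sq_itg hg.1).
rewrite (I_split ax xy (itgS (lexx _) yb iq)) [_ + I x y q]addrC addrK.
have -> : P y - P x = F y * G y - F x * G x - I x y (fun x => f x * G x + F x * g x).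
  rewrite /P (I_split ax xy (itgS (lexx _) yb (sq_itg s3))); ring.
set A := I x y (fun t => `|f t|); set B := I x y (fun t => `|g t|).
have -> : F y * G y - F x * G x - I x y (fun x => f x * G x + F x * g x) =
   I x y (fun t => (G y * f t + F x * g t) - (f t * G t + F t * g t)).
  rewrite IB; last 2 first.
  - by apply: itgD; exact: itgZ.
  - exact: iS (sq_itg s3).
  rewrite [I x y (fun t => G y * f t + _)]ID ?IZ//; try exact: itgZ.
  rewrite (ac_incr hf ax xy yb) (ac_incr hg ax xy yb); ring.
have iX : itg x y (fun t => (G y * f t + F x * g t) - (f t * G t + F t * g t)).
  by apply: itgB; [apply: itgD; exact: itgZ|exact: iS (sq_itg s3)].
apply: le_trans (I_le_abs iX) _.
have hA t : x <= t <= y -> `|F x - F t| <= A.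
  move=> /andP[xt ty]; rewrite (ac_incr hf ax xt (le_trans ty yb)) opprD addNKr normrN.
  apply: le_trans (I_le_abs _) _; first exact: itgS ff.
  by apply: I_mono => //; exact: itg_abs.
have hB t : x <= t <= y -> `|G y - G t| <= B.
  move=> /andP[xt ty]; rewrite (ac_incr hg (le_trans ax xt) ty yb) addrC addKr.
  apply: le_trans (I_le_abs _) _; first exact: itgS gg.
  by apply: I_mono => //; exact: itg_abs.
have af := itg_abs ff; have ag := itg_abs gg.
apply: (@le_trans _ _ (I x y (fun t => B * `|f t| + A * `|g t|))).
  apply: I_le; [exact: itg_abs|by apply: itgD; exact: itgZ|].
  move=> t; rewrite in_itv/= => /andP[/ltW xt /ltW ty].
  have -> : G y * f t + F x * g t - (f t * G t + F t * g t) =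
    (G y - G t) * f t + (F x - F t) * g t by ring.
  apply: le_trans (ler_normD _ _) _; rewrite !normrM.
  by apply: lerD; apply: ler_wpM2r => //; [apply: hB|apply: hA]; rewrite xt.
rewrite ID ?IZ//; try exact: itgZ.
rewrite -/A -/B.
have sA : A ^+ 2 <= (y - x) * I x y (fun t => f t ^+ 2).
  have := I_sqr_le xy (_ : sq x y (fun t => `|f t|)).
  under [X in _ * X]I_eq do rewrite real_normK ?num_real//.
  apply; split; first exact: itg_meas.
  under eq_fun do rewrite real_normK ?num_real//.
  exact: iS hf.1.2.
have sB : B ^+ 2 <= (y - x) * I x y (fun t => g t ^+ 2).
  have := I_sqr_le xy (_ : sq x y (fun t => `|g t|)).
  under [X in _ * X]I_eq do rewrite real_normK ?num_real//.
  apply; split; first exact: itg_meas.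
  under eq_fun do rewrite real_normK ?num_real//.
  exact: iS hg.1.2.
rewrite /q ID; [|exact: iS hf.1.2|exact: iS hg.1.2].
rewrite mulrDr; apply: le_trans (lerD sA sB); rewrite mulrC -subr_ge0.
have -> : A ^+ 2 + B ^+ 2 - (A * B + A * B) = (A - B) ^+ 2 by ring.
exact: sqr_ge0.
Qed.

End IntervalIntegrals.

Ltac itg_tac := repeat first
  [ assumption | exact: itg_cst | exact: sq_cst | apply: sq_sqr | apply: itgD
  | apply: itgB | apply: itgN | apply: itgZ | apply: itgZr | apply: itgM
  | apply: sqD | apply: sqB | apply: sqN | apply: sqZ | apply: sqZr
  | apply: sq_itg ].

Ltac pos := lazymatch goal with
  | H : ?P |- ?P => exact: H
  | H : is_true (0 < ?x) |- is_true (0 <= ?x) => exact: (ltW H)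
  | |- is_true (0 <= _ + _) => apply: addr_ge0; pos
  | |- is_true (0 <= _ * _) => apply: mulr_ge0; pos
  | |- is_true (0 <= _ ^+ 2) => exact: sqr_ge0
  | |- is_true (0 <= _ ^+ _) => apply: exprn_ge0; pos
  | |- is_true (0 <= _ ^-1) => rewrite invr_ge0; pos
  | |- is_true (0 < _ + _) => apply: addr_gt0; pos
  | |- is_true (0 < _ * _) => apply: mulr_gt0; pos
  | |- is_true (0 < _ ^+ _) => apply: exprn_gt0; pos
  | |- is_true (0 < _ ^-1) => rewrite invr_gt0; pos
  | |- is_true (0 <= _%:R) => exact: ler0n
  | |- is_true (0 < _%:R) => by rewrite ltr0n
  | |- is_true (0 <= `|_|) => exact: normr_ge0
  | |- is_true (0 <= 1) => exact: ler01
  | |- is_true (0 < 1) => exact: ltr01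
  | |- _ => first [assumption | apply: ltW; assumption]
  end.

(** * Pointwise bounds for absolutely continuous functions *)

Section MoreAC.
Context {R : realType}.
Implicit Types (al be ga x y k : R) (f g F G : R -> R).
Local Notation mu := (@lebesgue_measure R).

Lemma ac_ae al be F f g : sq al be g ->
  {ae mu, forall x, x \in `]al, be[ -> f x = g x} -> ac al be F f -> ac al be F g.
Proof.
move=> sg fg h; split => // x /andP[ax xb].
rewrite (ac_incr h (lexx _) ax xb); congr (_ + _); apply: I_ae_eq.
- by apply: itg_meas; apply: itgS (sq_itg h.1).
- by apply: itg_meas; apply: itgS (sq_itg sg).
- apply: (aeS fg) => t ht; rewrite in_itv/= => /andP[t1 t2]; apply: ht.
  by rewrite in_itv/= t1 (lt_le_trans t2).
Qed.

Lemma ac_dist al be F f g : ac al be F f -> itg al be g ->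
  (forall x, x \in `]al, be[ -> `|f x| <= g x) ->
  forall x y, al <= x <= be -> al <= y <= be -> F x <= F y + I al be g.
Proof.
move=> h ig fg.
have H x y : al <= x -> x <= y -> y <= be -> `|F y - F x| <= I al be g.
  move=> ax xy yb; rewrite (ac_incr h ax xy yb) addrC addKr.
  have sf : itg x y f by apply: itgS (sq_itg h.1).
  apply: (le_trans (I_le_abs sf)).
  apply: (@le_trans _ _ (I x y g)).
    apply: I_le; [exact: itg_abs|exact: itgS ig|].
    move=> t; rewrite in_itv/= => /andP[t1 t2]; apply: fg.
    by rewrite in_itv/= (le_lt_trans ax)// (lt_le_trans t2).
  by apply: I_mono => // t /fg; apply: le_trans.
move=> x y /andP[ax xb] /andP[ay yb]; rewrite -lerBlDl.
have [xy|/ltW yx] := leP x y.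
  by apply: le_trans (H _ _ ax xy yb); rewrite distrC ler_norm.
by apply: le_trans (H _ _ ay yx xb); rewrite ler_norm.
Qed.

(** At its minimum [F ^+ 2] is at most its mean; elsewhere it grows by at most the integral of
    [2 |F f|], which Young's inequality splits with weight [r]. The weight stays free because the
    damped estimate takes it proportional to [sqrt |la|]. *)
Lemma ac_interp al be F f r : al < be -> 0 < r -> ac al be F f ->
  forall x, al <= x <= be -> F x ^+ 2 <=
    ((be - al)^-1 + r) * I al be (fun x => F x ^+ 2)
    + r^-1 * I al be (fun x => f x ^+ 2).
Proof.
move=> ab r0 h x hx; have ab' := ltW ab.
have sF := ac_sq ab' h; have sf := h.1.
have h2 : ac al be (fun x => F x ^+ 2) (fun x => 2 * F x * f x).
  apply: ac_eq (acM ab' h h) => t _; ring.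
(* The minimum of [F ^+ 2], found as the maximum of its opposite. *)
have [y [hy hmin]] := ac_max ab' (acN h2).
have l0 : 0 < be - al by rewrite subr_gt0.
have hm : F y ^+ 2 <= (be - al)^-1 * I al be (fun x => F x ^+ 2).
  rewrite mulrC ler_pdivlMr// -Icst//; apply: I_le; itg_tac.
  move=> t; rewrite in_itv/= => /andP[/ltW t1 /ltW t2].
  by rewrite -lerN2; apply: hmin; rewrite t1.
have := @ac_dist al be _ _ (fun t => r * F t ^+ 2 + r^-1 * f t ^+ 2) h2 _ _ x y hx hy.
rewrite ID ?IZ; itg_tac => H.
suff : F x ^+ 2 <= F y ^+ 2 + (r * I al be (fun x => F x ^+ 2) + r^-1 * I al be (fun x => f x ^+ 2)).
  by rewrite mulrDl; lra.
apply: H; first itg_tac.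
move=> t _; have q0 : 0 < r^-1 by rewrite invr_gt0.
have rq : r * r^-1 = 1 by rewrite divff// gt_eqF.
have e1 : r * F t ^+ 2 + r^-1 * f t ^+ 2 - 2 * F t * f t = r * (F t - r^-1 * f t) ^+ 2.
  rewrite sqrrB !mulrDr; field; exact: lt0r_neq0.
have e2 : r * F t ^+ 2 + r^-1 * f t ^+ 2 + 2 * F t * f t = r * (F t + r^-1 * f t) ^+ 2.
  field; exact: lt0r_neq0.
have := mulr_ge0 (ltW r0) (sqr_ge0 (F t - r^-1 * f t)).
have := mulr_ge0 (ltW r0) (sqr_ge0 (F t + r^-1 * f t)).
by rewrite -e1 -e2 ler_norml; lra.
Qed.
End MoreAC.

(** * Energy estimates for the resolvent equation on an interval *)

Section Waves.
Context {R : realType}.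
Implicit Types (al be x y : R).
Local Notation mu := (@lebesgue_measure R).

(* Real and imaginary parts of a velocity v, a stress S, a strain p and two
   sources f, h in
     i la p = v' + f,   S' = i la v - h + k o,   S = a p + ka v',
   where o is the velocity of the other wave. *)
Record wdata := WD {
  v1 : R -> R; v2 : R -> R; S1 : R -> R; S2 : R -> R; p1 : R -> R; p2 : R -> R;
  f1 : R -> R; f2 : R -> R; h1 : R -> R; h2 : R -> R }.

(** Real part of the velocity gradient, eliminated through [v' = i la p - f]; [dv2] is the imaginary
    part. *)
Definition dv1 (la : R) w x := - la * p2 w x - f1 w x.
Definition dv2 (la : R) w x := la * p1 w x - f2 w x.

(** [v] and [S] are absolutely continuous representatives, whereas [p] is only in L^2 and may jump
    with [ka]. The constitutive law can therefore be required only almost everywhere. *)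
Record wave al be (a la : R) (ka k o1 o2 : R -> R) (w : wdata) : Prop := Wave {
  w_p1 : sq al be (p1 w); w_p2 : sq al be (p2 w);
  w_f1 : sq al be (f1 w); w_f2 : sq al be (f2 w);
  w_h1 : sq al be (h1 w); w_h2 : sq al be (h2 w);
  w_v1 : ac al be (v1 w) (dv1 la w);
  w_v2 : ac al be (v2 w) (dv2 la w);
  w_S1 : ac al be (S1 w) (fun x => - la * v2 w x - h1 w x + k x * o1 x);
  w_S2 : ac al be (S2 w) (fun x => la * v1 w x - h2 w x + k x * o2 x);
  w_S : {ae mu, forall x, x \in `]al, be[ ->
    S1 w x = a * p1 w x + ka x * dv1 la w x /\
    S2 w x = a * p2 w x + ka x * dv2 la w x} }.

(** Energy density written with the stress instead of the strain: it has values at every point and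
    is continuous across interfaces. Where [ka = 0] one has [S = a p], so [S^2 / a] is the usual
    [a p^2]. *)
Definition en (a : R) w x :=
  v1 w x ^+ 2 + v2 w x ^+ 2 + (S1 w x ^+ 2 + S2 w x ^+ 2) / a.
Definition src (a : R) w x :=
  f1 w x ^+ 2 + f2 w x ^+ 2 + (h1 w x ^+ 2 + h2 w x ^+ 2) / a.

Lemma waveS al be al' be' a la ka k ka' k' o1 o2 w :
  al <= al' -> be' <= be ->
  (forall x, x \in `]al', be'[ -> ka x = ka' x) ->
  (forall x, x \in `]al', be'[ -> k x = k' x) ->
  wave al be a la ka k o1 o2 w -> wave al' be' a la ka' k' o1 o2 w.
Proof.
move=> l1 l2 hka hk [hp1 hp2 hf1 hf2 hh1 hh2 hv1 hv2 hS1 hS2 hS].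
split; try exact: (sqS l1 l2); try exact: (acS l1 l2).
- by apply: ac_eq (acS l1 l2 hS1) => x /hk ->.
- by apply: ac_eq (acS l1 l2 hS2) => x /hk ->.
- apply: (aeS hS) => x hx xi; rewrite -hka//; apply: hx; move: xi.
  rewrite !in_itv/= => /andP[x1 x2].
  by rewrite (le_lt_trans l1)// (lt_le_trans x2).
Qed.

(* With ka = 0 the terms carrying la cancel. *)
Lemma free_energy al be a la k0 o1 o2 w : al <= be -> 0 < a ->
  wave al be a la (fun=> 0) (fun=> k0) o1 o2 w ->
  sq al be o1 -> sq al be o2 ->
  ac al be (en a w) (fun x => - 2 * (v1 w x * f1 w x + v2 w x * f2 w x
    + (S1 w x * (h1 w x - k0 * o1 x) + S2 w x * (h2 w x - k0 * o2 x)) / a)).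
Proof.
move=> ab a0 [hp1 hp2 hf1 hf2 hh1 hh2 hv1 hv2 hS1 hS2 hS] ho1 ho2.
have sv1 := ac_sq ab hv1; have sv2 := ac_sq ab hv2.
have sS1 := ac_sq ab hS1; have sS2 := ac_sq ab hS2.
have H := acD (acD (acM ab hv1 hv1) (acM ab hv2 hv2))
  (acZ a^-1 (acD (acM ab hS1 hS1) (acM ab hS2 hS2))).
have E : (fun x => v1 w x * v1 w x + v2 w x * v2 w x +
    a^-1 * (S1 w x * S1 w x + S2 w x * S2 w x)) = en a w.
  by apply/funext => x; rewrite /en -!expr2 [_ / a]mulrC.
move: H; rewrite E; apply: ac_ae.
  apply: sqZ; apply: sqD; first apply: sqD.
  - exact: (ac_sqM ab hv1).
  - exact: (ac_sqM ab hv2).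
  - apply: sqZr; apply: sqD; [apply: (ac_sqM ab hS1)|apply: (ac_sqM ab hS2)]; itg_tac.
apply: (aeS hS) => x hx /hx[e1 e2]; rewrite e1 e2 !mul0r !addr0 /dv1 /dv2.
field; exact: lt0r_neq0.
Qed.

(** The source density when the coupling term [k0 o] is counted as part of the source [h]. *)
Definition srck (a k0 : R) o1 o2 w x := f1 w x ^+ 2 + f2 w x ^+ 2
  + ((h1 w x - k0 * o1 x) ^+ 2 + (h2 w x - k0 * o2 x) ^+ 2) / a.

(** Completing the squares once for each sign [s = 1] and [s = -1] bounds the absolute value. *)
Lemma young_sum (a r x1 x2 x3 x4 y1 y2 y3 y4 : R) : 0 < a -> 0 < r ->
  `|- 2 * (x1 * y1 + x2 * y2 + (x3 * y3 + x4 * y4) / a)| <=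
  r * (x1 ^+ 2 + x2 ^+ 2 + (x3 ^+ 2 + x4 ^+ 2) / a)
  + r^-1 * (y1 ^+ 2 + y2 ^+ 2 + (y3 ^+ 2 + y4 ^+ 2) / a).
Proof.
move=> a0 r0.
have H (s : R) : s ^+ 2 = 1 -> 0 <=
  r * (x1 ^+ 2 + x2 ^+ 2 + (x3 ^+ 2 + x4 ^+ 2) / a)
  + r^-1 * (y1 ^+ 2 + y2 ^+ 2 + (y3 ^+ 2 + y4 ^+ 2) / a)
  + s * (2 * (x1 * y1 + x2 * y2 + (x3 * y3 + x4 * y4) / a)).
  move=> s1; have -> : r * (x1 ^+ 2 + x2 ^+ 2 + (x3 ^+ 2 + x4 ^+ 2) / a)
    + r^-1 * (y1 ^+ 2 + y2 ^+ 2 + (y3 ^+ 2 + y4 ^+ 2) / a)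
    + s * (2 * (x1 * y1 + x2 * y2 + (x3 * y3 + x4 * y4) / a)) =
    r * ((x1 + s * y1 / r) ^+ 2 + (x2 + s * y2 / r) ^+ 2
      + ((x3 + s * y3 / r) ^+ 2 + (x4 + s * y4 / r) ^+ 2) / a).
    rewrite !sqrrD !exprMn !s1; field; by rewrite !lt0r_neq0.
  by pos.
have := H 1 (expr1n _ _); have := H (-1) (sqrr_sign _ 1).
by rewrite ler_norml; lra.
Qed.

Lemma srck_itg al be a k0 o1 o2 w :
  sq al be (f1 w) -> sq al be (f2 w) -> sq al be (h1 w) -> sq al be (h2 w) ->
  sq al be o1 -> sq al be o2 -> itg al be (srck a k0 o1 o2 w).
Proof. by move=> *; rewrite /srck; itg_tac. Qed.

(** Replaces a Gronwall argument. At the maximum [m] of [en], integrating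
    [|en'| <= r en + r^-1 srck] with [r = 1 / (2 (be - al))] costs [en m / 2], which is absorbed.
    The constants are independent of [la] because [la] is absent from [en']. *)
Lemma free_sup al be a la k0 o1 o2 w : al < be -> 0 < a ->
  wave al be a la (fun=> 0) (fun=> k0) o1 o2 w ->
  sq al be o1 -> sq al be o2 ->
  forall x y, al <= x <= be -> al <= y <= be ->
  en a w x <= 2 * en a w y + 4 * (be - al) * I al be (srck a k0 o1 o2 w).
Proof.
move=> ab a0 W so1 so2; have he := free_energy (ltW ab) a0 W so1 so2.
have [m [hm Hm]] := ac_max (ltW ab) he.
move=> x y hx hy; apply: (le_trans (Hm x hx)).
have iN : itg al be (srck a k0 o1 o2 w) by case: W => *; exact: srck_itg.
have l0 : 0 < be - al by rewrite subr_gt0.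
pose r := (2 * (be - al))^-1.
have r0 : 0 < r by rewrite /r; pos.
pose g t := r * en a w m + r^-1 * srck a k0 o1 o2 w t.
have ig : itg al be g by rewrite /g; itg_tac.
have H : en a w m <= en a w y + I al be g.
  apply: (ac_dist he ig) => // t; rewrite in_itv/= => /andP[/ltW t1 /ltW t2].
  apply: (le_trans (young_sum _ _ _ _ _ _ _ _ a0 r0)).
  rewrite /g lerD2r; apply: ler_wpM2l; first exact: ltW.
  by apply: Hm; rewrite t1.
move: H; rewrite /g ID; itg_tac; rewrite Icst ?IZ ?(ltW ab)// => H.
have e1 : r * en a w m * (be - al) = en a w m / 2.
  by rewrite /r; field; exact: lt0r_neq0.
move: H; rewrite e1 /r invrK; lra.
Qed.

(** The algebra of the damped interval: [mu] is [sqrt |la|], [A] and [B] bound [|v|^2] and [|S|^2]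
    pointwise, [V] and [W] are their integrals, [X] is source plus dissipation. Inserting the bounds
    for [A] and [B] into the last hypothesis leaves multiples of [mu^2 V] that can be absorbed, so
    [V] is of order [X / mu^2]. The term [mu^3 V] in the bound for [B] is then of order [mu X],
    which is where the factor [mu] of the conclusion comes from. *)
Lemma damped_bound (l mu0 Kw : R) : 0 < l -> 0 < mu0 -> 0 < Kw ->
  exists2 K : R, 0 < K & forall mu X V W A B : R, mu0 <= mu -> 0 <= X ->
  0 <= V -> 0 <= W -> W <= Kw * X ->
  A <= (l^-1 + mu) * V + mu^-1 * X ->
  (forall t, 0 < t ->
    B <= (l^-1 + t * mu) * W + (t * mu)^-1 * (2 * mu ^+ 4 * V + 2 * X)) ->
  (forall s, 0 < s -> mu ^+ 2 * V <= s * mu * A + (s * mu)^-1 * B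
    + mu ^+ 2 / 4 * V + mu^-1 ^+ 2 * X + W + X) ->
  A <= K * mu * X /\ B <= K * mu * X.
Proof.
move=> l0 m0 K0.
(* As [mu >= mu0], surplus powers of [mu^-1] are bounded by powers of [q]. *)
pose q := mu0^-1.
have q0 : 0 < q by rewrite invr_gt0.
pose K1 := 1 + l^-1 * q.
have il0 : 0 < l^-1 by rewrite invr_gt0.
have K10 : 0 < K1 by rewrite /K1; pos.
(* [s K1 = 1/8] and, below, [s t = 16]: the terms with [A] and with [B] then contribute [mu^2 V / 8]
   each. Together with the [mu^2 V / 4] of the hypothesis, one half of [mu^2 V] is absorbed. *)
pose s := (8 * K1)^-1.
have s0 : 0 < s by rewrite /s; pos.
pose t := 16 / s.
have t0 : 0 < t by rewrite /t; pos.
pose Kb := (l^-1 * q + t) * Kw + 2 * t^-1 * q ^+ 2.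
have it0 : 0 < t^-1 by rewrite invr_gt0.
have is0 : 0 < s^-1 by rewrite invr_gt0.
have Kb0 : 0 < Kb by rewrite /Kb; pos.
pose Kv := s + s^-1 * Kb + q ^+ 2 + Kw + 1.
have Kv0 : 0 < Kv by rewrite /Kv; pos.
exists (2 * K1 * Kv * q ^+ 2 + q ^+ 2 + Kb + 4 * t^-1 * Kv).
  by pos.
move=> mu X V W A B hmu X0 V0 W0 hW hA hB hV.
have mu_gt0 : 0 < mu by exact: lt_le_trans hmu.
pose p := mu^-1.
have p0 : 0 < p by rewrite invr_gt0.
have pm : p * mu = 1 by rewrite mulVf// lt0r_neq0.
have pq : p <= q by rewrite lef_pV2.
have st : s * t = 16 by rewrite /t mulrCA divff ?mulr1// lt0r_neq0.
have st' : s^-1 * t^-1 = 16^-1 by rewrite -invfM st.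
have sK : s * K1 = 8^-1.
  by rewrite /s; field; rewrite lt0r_neq0.
have qm : 1 <= q * mu by rewrite -pm ler_wpM2r// ltW.
have hA1 : A <= K1 * mu * V + p * X.
  apply: (le_trans hA); rewrite -/p lerD2r; apply: ler_wpM2r => //.
  rewrite /K1; nra.
have hB1 : B <= Kb * mu * X + 2 * t^-1 * mu ^+ 3 * V.
  apply: (le_trans (hB t t0)); rewrite invfM -/p.
  have -> : t^-1 * p * (2 * mu ^+ 4 * V + 2 * X) =
    2 * t^-1 * mu ^+ 3 * V * (p * mu) + 2 * t^-1 * p * X by ring.
  rewrite pm mulr1.
  have e1 : (l^-1 + t * mu) * W <= (l^-1 * q + t) * mu * (Kw * X).
    apply: ler_pM => //; first by pos.
    by rewrite mulrDl lerD2r -mulrA ler_peMr// ltW.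
  have e2 : 2 * t^-1 * p * X <= 2 * t^-1 * q ^+ 2 * mu * X.
    have hp : p <= q ^+ 2 * mu.
      by apply: (le_trans pq); rewrite expr2 -mulrA ler_peMr// ltW.
    have c0 : 0 <= 2 * t^-1 * X by pos.
    have := ler_wpM2l c0 hp; lra.
  rewrite /Kb; lra.
have hVb : mu ^+ 2 * V <= 2 * Kv * X.
  have := hV s s0; rewrite invfM -/p.
  have e1 : s * mu * A <= mu ^+ 2 * V / 8 + s * X.
    have : s * mu * A <= s * mu * (K1 * mu * V + p * X).
      by apply: ler_wpM2l => //; pos.
    have -> : s * mu * (K1 * mu * V + p * X) = (s * K1) * mu ^+ 2 * V + (p * mu) * s * X by ring.
    rewrite sK pm; lra.
  have e2 : s^-1 * p * B <= s^-1 * Kb * X + mu ^+ 2 * V / 8.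
    have : s^-1 * p * B <= s^-1 * p * (Kb * mu * X + 2 * t^-1 * mu ^+ 3 * V).
      by apply: ler_wpM2l => //; pos.
    have -> : s^-1 * p * (Kb * mu * X + 2 * t^-1 * mu ^+ 3 * V) =
      (p * mu) * (s^-1 * Kb * X + 2 * (s^-1 * t^-1) * mu ^+ 2 * V) by ring.
    rewrite pm mul1r st'; lra.
  have e3 : p ^+ 2 * X <= q ^+ 2 * X.
    apply: ler_wpM2r => //; apply: lerXn2r => //; rewrite nnegrE; pos.
  move: e1 e2 e3; rewrite /Kv; set a1 := _ * A; set b1 := _ * B; nra.
have hVb' : mu * V <= 2 * Kv * q * X.
  have : p * (mu ^+ 2 * V) <= p * (2 * Kv * X) by apply: ler_wpM2l => //; pos.
  have -> : p * (mu ^+ 2 * V) = (p * mu) * (mu * V) by ring.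
  rewrite pm mul1r => h; apply: (le_trans h).
  have -> : 2 * Kv * q * X = q * (2 * Kv * X) by ring.
  by apply: ler_wpM2r => //; pos.
have mX : X <= q * mu * X by rewrite ler_peMl.
split.
- apply: (le_trans hA1).
  have e1 : K1 * mu * V <= 2 * K1 * Kv * q ^+ 2 * mu * X.
    have : K1 * (mu * V) <= K1 * (2 * Kv * q * X) by apply: ler_wpM2l => //; pos.
    have : K1 * (2 * Kv * q) * X <= K1 * (2 * Kv * q) * (q * mu * X).
      by apply: ler_wpM2l => //; pos.
    lra.
  have e2 : p * X <= q ^+ 2 * mu * X.
    have : p * X <= q * (q * mu * X) by apply: ler_pM => //; pos.
    lra.
  have e3 : 0 <= (Kb + 4 * t^-1 * Kv) * mu * X by pos.
  lra.
- apply: (le_trans hB1).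
  have e1 : 2 * t^-1 * mu ^+ 3 * V <= 4 * t^-1 * Kv * mu * X.
    have : (2 * t^-1 * mu) * (mu ^+ 2 * V) <= (2 * t^-1 * mu) * (2 * Kv * X).
      by apply: ler_wpM2l => //; pos.
    lra.
  have e3 : 0 <= (2 * K1 * Kv * q ^+ 2 + q ^+ 2) * mu * X.
    by pos.
  lra.
Qed.

End Waves.

(** * Waves on a damped interval *)

Section Damped.
Context {R : realType}.
Implicit Types (al be x y : R).
Local Notation mu := (@lebesgue_measure R).

(** The derivative of the imaginary part [S2 v1 - S1 v2] of [S] times the conjugate of [v] is
    [la |v|^2] plus the terms [E], which pair sources and velocity gradients with [v] and [S].
    Integrating it controls [|la|] times the L^2 norm of [v]; the boundary values cost the pointwise
    bounds [A] and [B]. *)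
Lemma damped_bulk al be (a la m : R) ka o1 o2 w (A B s : R) : al <= be -> 0 < m ->
  `|la| = m ^+ 2 -> 0 < s -> wave al be a la ka (fun=> 0) o1 o2 w ->
  (forall x, al <= x <= be -> v1 w x ^+ 2 + v2 w x ^+ 2 <= A) ->
  (forall x, al <= x <= be -> S1 w x ^+ 2 + S2 w x ^+ 2 <= B) ->
  m ^+ 2 * I al be (fun x => v1 w x ^+ 2 + v2 w x ^+ 2) <= s * A + s^-1 * B
    + m ^+ 2 / 4 * I al be (fun x => v1 w x ^+ 2 + v2 w x ^+ 2)
    + m^-1 ^+ 2 * I al be (fun x => h1 w x ^+ 2 + h2 w x ^+ 2)
    + 2^-1 * I al be (fun x => S1 w x ^+ 2 + S2 w x ^+ 2)
    + 2^-1 * I al be (fun x => dv1 la w x ^+ 2 + dv2 la w x ^+ 2).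
Proof.
move=> ab m0 hla s0 [sp1 sp2 sf1 sf2 sh1 sh2 av1 av2 aS1 aS2 _] HA HB.
have sv1 := ac_sq ab av1; have sv2 := ac_sq ab av2.
have sS1 := ac_sq ab aS1; have sS2 := ac_sq ab aS2.
have sd1 : sq al be (dv1 la w) := av1.1.
have sd2 : sq al be (dv2 la w) := av2.1.
pose E x := - (h2 w x * v1 w x) + h1 w x * v2 w x + S2 w x * dv1 la w x - S1 w x * dv2 la w x.
have iE : itg al be E by rewrite /E; itg_tac.
have aH := acB (acM ab aS2 av1) (acM ab aS1 av2).
set V := I al be (fun x => v1 w x ^+ 2 + v2 w x ^+ 2).
have V0 : 0 <= V by apply: I_ge0 => x _; pos.
have hH x : al <= x <= be ->
    `|S2 w x * v1 w x - S1 w x * v2 w x| <= (s * A + s^-1 * B) / 2.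
  move=> hx; have := young_sum (v1 w x) (v2 w x) 0 0 (- S2 w x) (S1 w x) 0 0 ltr01 s0.
  have -> : - 2 * (v1 w x * - S2 w x + v2 w x * S1 w x + (0 * 0 + 0 * 0) / 1) =
     2 * (S2 w x * v1 w x - S1 w x * v2 w x) by ring.
  have := ler_wpM2l (ltW s0) (HA x hx).
  have is0 : 0 <= s^-1 by pos.
  have := ler_wpM2l is0 (HB x hx).
  rewrite sqrrN !expr0n /= !(addr0, mul0r) normrM (@ger0_norm _ 2)//.
  clear; lra.
have eD : I al be (fun x => la * (v1 w x ^+ 2 + v2 w x ^+ 2) + E x) =
   S2 w be * v1 w be - S1 w be * v2 w be - (S2 w al * v1 w al - S1 w al * v2 w al).
  rewrite (ac_incr aH (lexx _) ab (lexx _)) addrC addKr.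
  by apply: I_eq => x _; rewrite /E; ring.
rewrite ID in eD; [|itg_tac|by []]; rewrite IZ in eD; last by itg_tac.
rewrite -/V in eD.
have eV : m ^+ 2 * V <= s * A + s^-1 * B + I al be (fun x => `|E x|).
  rewrite -hla -(ger0_norm V0) -normrM.
  have -> : la * V = S2 w be * v1 w be - S1 w be * v2 w be
    - (S2 w al * v1 w al - S1 w al * v2 w al) - I al be E by rewrite -eD addrK.
  apply: (le_trans (ler_normB _ _)); apply: lerD; last exact: I_le_abs.
  apply: (le_trans (ler_normB _ _)).
  have := hH be; rewrite ab lexx => /(_ isT).
  have := hH al; rewrite ab lexx => /(_ isT).
  clear; lra.
apply: (le_trans eV); rewrite -!addrA !lerD2l {eV eD hH aH}.
have aE : itg al be (fun x => `|E x|) by exact: itg_abs.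
rewrite /V -!IZ; itg_tac; rewrite -!ID; itg_tac; apply: I_le; itg_tac.
move=> x _; have mp0 : 0 < m ^+ 2 / 2 by pos.
have y1 := young_sum (v1 w x) (v2 w x) 0 0 (h2 w x) (- h1 w x) 0 0 ltr01 mp0.
have y2 := young_sum (S2 w x) (S1 w x) 0 0 (dv1 la w x) (- dv2 la w x) 0 0 ltr01 ltr01.
have ep : (m ^+ 2 / 2)^-1 = 2 * m^-1 ^+ 2 by field; rewrite lt0r_neq0.
move: y1 y2; rewrite ep invr1 !sqrrN !expr0n /= !(addr0, mul0r).
set E1 := - 2 * _; set E2 := - 2 * _.
have -> : E x = E1 / 2 - E2 / 2 by rewrite /E /E1 /E2; field.
move=> y1 y2; apply: (le_trans (ler_normB _ _)).
have nh (z : R) : `|z / 2| = `|z| / 2 by rewrite normrM [`|2^-1|]ger0_norm.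
by rewrite !nh; move: y1 y2; clear; lra.
Qed.

(** Supplies the hypotheses of [damped_bound]: interpolation of [v] with weight [mu] and of [S] with
    weight [t mu], and [damped_bulk] with [s mu]. The strain is bounded separately, since on a
    damped interval [S] mixes [p] with [v'] and [en] does not dominate it. *)
Lemma damped_sup al be a ka0 mu0 : al < be -> 0 < a -> 0 < ka0 -> 0 < mu0 ->
  exists2 K : R, 0 < K & forall la mu X o1 o2 w, mu0 <= mu ->
  `|la| = mu ^+ 2 -> 0 <= X ->
  wave al be a la (fun=> ka0) (fun=> 0) o1 o2 w ->
  I al be (fun x => dv1 la w x ^+ 2 + dv2 la w x ^+ 2) <= X ->
  I al be (fun x => f1 w x ^+ 2 + f2 w x ^+ 2) <= X ->
  I al be (fun x => h1 w x ^+ 2 + h2 w x ^+ 2) <= X ->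
  (forall x, al <= x <= be -> en a w x <= K * mu * X) /\
  I al be (fun x => p1 w x ^+ 2 + p2 w x ^+ 2) <= K * X.
Proof.
move=> ab a0 k0 m0; have ab' := ltW ab.
have l0 : 0 < be - al by rewrite subr_gt0.
pose q := mu0^-1; have q0 : 0 < q by rewrite invr_gt0.
pose Kw := 8 * a ^+ 2 * q ^+ 4 + 2 * ka0 ^+ 2.
have Kw0 : 0 < Kw by rewrite /Kw; pos.
have [K1 K10 HK] := damped_bound l0 m0 Kw0.
have ia0 : 0 < a^-1 by rewrite invr_gt0.
exists (K1 + K1 / a + 4 * q ^+ 4); first by pos.
move=> la mu X o1 o2 w hmu hla X0 W hdv hf hh.
have mu_gt0 : 0 < mu by exact: lt_le_trans hmu.
have la2 : la ^+ 2 = mu ^+ 4 by rewrite -real_normK ?num_real// hla -exprM.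
case: (W) => sp1 sp2 sf1 sf2 sh1 sh2 av1 av2 aS1 aS2 hS.
have sv1 := ac_sq ab' av1; have sv2 := ac_sq ab' av2.
have sS1 := ac_sq ab' aS1; have sS2 := ac_sq ab' aS2.
have sd1 : sq al be (dv1 la w) := av1.1.
have sd2 : sq al be (dv2 la w) := av2.1.
pose p := mu^-1; have p0 : 0 < p by rewrite invr_gt0.
have pm : p * mu = 1 by rewrite mulVf// lt0r_neq0.
have pq : p <= q by rewrite lef_pV2.
(* The equation [i la p = v' + f] yields the strain from the dissipation, with a gain of [la^-2]. *)
have hp : I al be (fun x => p1 w x ^+ 2 + p2 w x ^+ 2) <= 4 * q ^+ 4 * X.
  have : mu ^+ 4 * I al be (fun x => p1 w x ^+ 2 + p2 w x ^+ 2) <=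
      2 * I al be (fun x => dv1 la w x ^+ 2 + dv2 la w x ^+ 2) +
      2 * I al be (fun x => f1 w x ^+ 2 + f2 w x ^+ 2).
    rewrite -!IZ -?ID; itg_tac; apply: I_le; itg_tac.
    move=> x _; rewrite -la2 /dv1 /dv2.
    have := sqr_ge0 (- la * p2 w x - 2 * f1 w x).
    have := sqr_ge0 (la * p1 w x - 2 * f2 w x).
    lra.
  move=> hI; have {}hI : mu ^+ 4 * I al be (fun x => p1 w x ^+ 2 + p2 w x ^+ 2) <= 4 * X by lra.
  have p40 : 0 <= p ^+ 4 by pos.
  have := ler_wpM2l p40 hI; rewrite mulrA -exprMn pm expr1n mul1r => h1.
  apply: (le_trans h1); rewrite -mulrA mulrCA ler_wpM2l//.
  apply: ler_wpM2r => //; apply: lerXn2r => //; rewrite nnegrE; pos.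
pose V := I al be (fun x => v1 w x ^+ 2 + v2 w x ^+ 2).
pose Wt := I al be (fun x => S1 w x ^+ 2 + S2 w x ^+ 2).
have V0 : 0 <= V by apply: I_ge0 => x _; pos.
have W0 : 0 <= Wt by apply: I_ge0 => x _; pos.
have hW : Wt <= Kw * X.
  have : Wt <= 2 * a ^+ 2 * I al be (fun x => p1 w x ^+ 2 + p2 w x ^+ 2)
      + 2 * ka0 ^+ 2 * I al be (fun x => dv1 la w x ^+ 2 + dv2 la w x ^+ 2).
    rewrite -!IZ -?ID; itg_tac; apply: I_le_ae; itg_tac.
    apply: (aeS hS) => x hx /hx[-> ->].
    have := sqr_ge0 (a * p1 w x - ka0 * dv1 la w x).
    have := sqr_ge0 (a * p2 w x - ka0 * dv2 la w x).
    lra.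
  have a20 : 0 <= 2 * a ^+ 2 by pos.
  have k20 : 0 <= 2 * ka0 ^+ 2 by pos.
  have := ler_wpM2l a20 hp; have := ler_wpM2l k20 hdv; rewrite /Kw; lra.
have av := acD (acM ab' av1 av1) (acM ab' av2 av2).
have aS := acD (acM ab' aS1 aS1) (acM ab' aS2 aS2).
have [mA [hmA HA]] := ac_max ab' av; have [mB [hmB HB]] := ac_max ab' aS.
rewrite -!expr2 in HA HB.
pose A := v1 w mA ^+ 2 + v2 w mA ^+ 2.
pose B := S1 w mB ^+ 2 + S2 w mB ^+ 2.
have hA : A <= ((be - al)^-1 + mu) * V + mu^-1 * X.
  have := ac_interp ab mu_gt0 av1 hmA; have := ac_interp ab mu_gt0 av2 hmA.
  have := ler_wpM2l (ltW p0) hdv.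
  rewrite /A /V !ID; itg_tac; rewrite -/p; lra.
have hB t : 0 < t -> B <= ((be - al)^-1 + t * mu) * Wt + (t * mu)^-1 * (2 * mu ^+ 4 * V + 2 * X).
  move=> t0; have tm0 : 0 < t * mu by pos.
  have := ac_interp ab tm0 aS1 hmB; have := ac_interp ab tm0 aS2 hmB.
  have itm : 0 <= (t * mu)^-1 by pos.
  have : I al be (fun x => (- la * v2 w x - h1 w x + 0 * o1 x) ^+ 2) +
    I al be (fun x => (la * v1 w x - h2 w x + 0 * o2 x) ^+ 2) <= 2 * mu ^+ 4 * V + 2 * X.
    have e : 2 * mu ^+ 4 * V + 2 * I al be (fun x => h1 w x ^+ 2 + h2 w x ^+ 2) <= 2 * mu ^+ 4 * V + 2 * X by lra.
    apply: le_trans e; rewrite /V -!IZ; itg_tac.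
    have i1 := sq_sqr aS1.1; have i2 := sq_sqr aS2.1.
    rewrite -!ID; itg_tac; apply: I_le; itg_tac.
    move=> x _; rewrite -la2.
    have := sqr_ge0 (- la * v2 w x + h1 w x).
    have := sqr_ge0 (la * v1 w x + h2 w x).
    lra.
  move/(ler_wpM2l itm); rewrite /B /Wt ID; itg_tac; lra.
have hV s : 0 < s -> mu ^+ 2 * V <= s * mu * A + (s * mu)^-1 * B + mu ^+ 2 / 4 * V + mu^-1 ^+ 2 * X + Wt + X.
  move=> s0; have sm0 : 0 < s * mu by pos.
  have HA' x : al <= x <= be -> v1 w x ^+ 2 + v2 w x ^+ 2 <= A.
    by rewrite /A !expr2; exact: HA.
  have HB' x : al <= x <= be -> S1 w x ^+ 2 + S2 w x ^+ 2 <= B.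
    by rewrite /B !expr2; exact: HB.
  have := damped_bulk ab' mu_gt0 hla sm0 W HA' HB'.
  have p20 : 0 <= p ^+ 2 by pos.
  have := ler_wpM2l p20 hh; rewrite -/V -/Wt -/p.
  by move: W0 X0 hdv; clear; lra.
have [cA cB] := HK mu X V Wt A B hmu X0 V0 W0 hW hA hB hV.
split; last first.
    apply: (le_trans hp); rewrite -subr_ge0 -mulrBl addrK; pos.
  move=> x hx; rewrite /en.
  have e1 : v1 w x ^+ 2 + v2 w x ^+ 2 <= K1 * mu * X.
    by apply: le_trans cA; exact: HA.
  have e2 : S1 w x ^+ 2 + S2 w x ^+ 2 <= K1 * mu * X.
    by apply: le_trans cB; exact: HB.
  have e3 := ler_wpM2r (ltW ia0) e2.
  have e4 : 0 <= 4 * q ^+ 4 * mu * X by pos.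
  lra.
Qed.

End Damped.

(** * Waves on the coupling interval *)

Section Coupled.
Context {R : realType}.
Implicit Types (al be x y : R).
Local Notation mu := (@lebesgue_measure R).

Lemma src_itg al be (a : R) w : sq al be (f1 w) -> sq al be (f2 w) ->
  sq al be (h1 w) -> sq al be (h2 w) -> itg al be (src a w).
Proof. by move=> *; rewrite /src; itg_tac. Qed.

Lemma en_itg al be (a la : R) ka k o1 o2 w : al <= be ->
  wave al be a la ka k o1 o2 w -> itg al be (en a w).
Proof.
move=> ab [_ _ _ _ _ _ av1 av2 aS1 aS2 _].
have sv1 := ac_sq ab av1; have sv2 := ac_sq ab av2.
have sS1 := ac_sq ab aS1; have sS2 := ac_sq ab aS2.
by rewrite /en; itg_tac.
Qed.

(* 2 |c0| |S . z| / a <= |c0| / sqrt a * (|S|^2 / a + |z|^2) is what the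
   smallness of c0 controls. *)
Lemma coupling_young (s c0 t l x1 x2 z1 z2 : R) : 0 < s -> 0 <= t -> t <= l ->
  t * `|2 * c0 * (x1 * z1 + x2 * z2) / s ^+ 2| <=
  l * `|c0| / s * ((x1 ^+ 2 + x2 ^+ 2) / s ^+ 2 + (z1 ^+ 2 + z2 ^+ 2)).
Proof.
move=> s0 t0 tl; have l0 : 0 <= l := le_trans t0 tl.
have is0 : 0 < s^-1 by pos.
have i2 : s^-1 ^+ 2 = (s ^+ 2)^-1 by rewrite exprVn.
have h : `|2 * (x1 * z1 + x2 * z2) / s| <= (x1 ^+ 2 + x2 ^+ 2) / s ^+ 2 + (z1 ^+ 2 + z2 ^+ 2).
  have q1 := sqr_ge0 (x1 / s - z1); have q2 := sqr_ge0 (x2 / s - z2).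
  have q3 := sqr_ge0 (x1 / s + z1); have q4 := sqr_ge0 (x2 / s + z2).
  move: q1 q2 q3 q4; rewrite -i2 ler_norml; clear; lra.
have -> : 2 * c0 * (x1 * z1 + x2 * z2) / s ^+ 2 = c0 / s * (2 * (x1 * z1 + x2 * z2) / s).
  by field; rewrite lt0r_neq0.
rewrite normrM normrM (gtr0_norm is0) mulrA -[l * _ / s]mulrA.
apply: ler_pM => //; first by rewrite mulr_ge0// mulr_ge0// ltW.
by apply: ler_wpM2r => //; rewrite mulr_ge0// ltW.
Qed.

(** Used with [sg = 1], [t = be - x] for the first wave and [sg = -1], [t = x - al] for the second.
    The genuine source is split with the free weight [r], the coupling term with the fixed weight of
    [coupling_young]. *)
Lemma coupled_step (s c0 t l r sg v1 v2 S1 S2 f1 f2 h1 h2 z1 z2 : R) :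
  0 < s -> 0 < r -> 0 <= t -> t <= l -> `|sg| = 1 ->
  sg * t * (- 2 * (v1 * f1 + v2 * f2
    + (S1 * (h1 - c0 * z1) + S2 * (h2 - c0 * z2)) / s ^+ 2)) <=
  l * r * (v1 ^+ 2 + v2 ^+ 2 + (S1 ^+ 2 + S2 ^+ 2) / s ^+ 2)
  + l * r^-1 * (f1 ^+ 2 + f2 ^+ 2 + (h1 ^+ 2 + h2 ^+ 2) / s ^+ 2)
  + l * `|c0| / s * ((S1 ^+ 2 + S2 ^+ 2) / s ^+ 2 + (z1 ^+ 2 + z2 ^+ 2)).
Proof.
move=> s0 r0 t0 tl hsg.
have s20 : 0 < s ^+ 2 by pos.
have e1 := young_sum v1 v2 S1 S2 f1 f2 h1 h2 s20 r0.
have e2 := coupling_young c0 S1 S2 z1 z2 s0 t0 tl.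
have -> : - 2 * (v1 * f1 + v2 * f2 + (S1 * (h1 - c0 * z1) + S2 * (h2 - c0 * z2)) / s ^+ 2)
 = - 2 * (v1 * f1 + v2 * f2 + (S1 * h1 + S2 * h2) / s ^+ 2) + 2 * c0 * (S1 * z1 + S2 * z2) / s ^+ 2.
  by field; rewrite lt0r_neq0.
set A := - 2 * _ in e1 *; set B := 2 * c0 * _ / _ in e2 *.
apply: le_trans (ler_norm _) _; rewrite 2!normrM hsg mul1r (ger0_norm t0).
apply: (@le_trans _ _ (t * `|A| + t * `|B|)).
  by rewrite -mulrDr ler_wpM2l// ler_normD.
apply: lerD => //; rewrite -!mulrA -mulrDr; apply: ler_pM => //.
Qed.

(** The first wave is known at the left end, coming from its damping, and the second one at the
    right end. The multipliers [be - x] and [x - al] vanish at the opposite ends, so only the known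
    boundary values survive. What the coupling costs is at most [k] times the integral of the two
    energies, and [k < 1] by the smallness of [c0]. *)
Lemma coupled al be a c0 : al < be -> 0 < a ->
  `|c0| * (be - al) < Num.sqrt a -> `|c0| * (be - al) < 1 ->
  exists2 K : R, 0 < K & forall la wu wy,
  wave al be a la (fun=> 0) (fun=> c0) (v1 wy) (v2 wy) wu ->
  wave al be 1 la (fun=> 0) (fun=> - c0) (v1 wu) (v2 wu) wy ->
  I al be (fun x => en a wu x + en 1 wy x) <=
  K * (en a wu al + en 1 wy be + I al be (fun x => src a wu x + src 1 wy x)).
Proof.
move=> ab a0 hc1 hc2; have ab' := ltW ab.
pose s := Num.sqrt a; have s0 : 0 < s by rewrite sqrtr_gt0.
have sa : s ^+ 2 = a by rewrite sqr_sqrtr// ltW.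
pose l := be - al; have l0 : 0 < l by rewrite subr_gt0.
pose k := Num.max (l * `|c0| / s) (l * `|c0| / 1).
have k1 : k < 1.
  rewrite gt_max divr1 ltr_pdivrMr// mul1r [l * _]mulrC; exact/andP.
have k0 : 0 <= k by rewrite /k le_max; apply/orP; right; rewrite divr1; pos.
(* [l r = (1 - k) / 2] spends half of the gap [1 - k] on the sources and leaves the other half on
   the left. *)
pose r := (1 - k) / (2 * l).
have k10 : 0 < 1 - k by rewrite subr_gt0.
have r0 : 0 < r by rewrite /r; pos.
exists (2 / (1 - k) * (l + l / r)); first by pos.
move=> la wu wy Wu Wy.
case: (Wu) => up1 up2 uf1 uf2 uh1 uh2 uv1 uv2 uS1 uS2 _.
case: (Wy) => yp1 yp2 yf1 yf2 yh1 yh2 yv1 yv2 yS1 yS2 _.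
have suv1 := ac_sq ab' uv1; have suv2 := ac_sq ab' uv2.
have syv1 := ac_sq ab' yv1; have syv2 := ac_sq ab' yv2.
have au := free_energy ab' a0 Wu syv1 syv2.
have ay := free_energy ab' ltr01 Wy suv1 suv2.
have iu := en_itg ab' Wu; have iy := en_itg ab' Wy.
have isu := src_itg a uf1 uf2 uh1 uh2.
have isy := src_itg 1 yf1 yf2 yh1 yh2.
have idb : ac al be (fun x => be - x) (fun=> - 1).
  have := acB (ac_cst al be be) (ac_id al be).
  by apply: ac_eq => x _; rewrite add0r.
have ida : ac al be (fun x => x - al) (fun=> 1).
  have := acB (ac_id al be) (ac_cst al be al).
  by apply: ac_eq => x _; rewrite subr0.
have mu_ := acM ab' idb au; have my_ := acM ab' ida ay.
have Eu := ac_incr mu_ (lexx _) ab' (lexx _).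
have Ey := ac_incr my_ (lexx _) ab' (lexx _).
have iDu := sq_itg mu_.1; have iDy := sq_itg my_.1.
set Du := (fun x : R => - 1 * en a wu x + _) in Eu iDu.
set Dy := (fun x : R => 1 * en 1 wy x + _) in Ey iDy.
set E := I al be (fun x => en a wu x + en 1 wy x).
set N := I al be (fun x => src a wu x + src 1 wy x).
have main : E <= l * en a wu al + l * en 1 wy be + (l * r + k) * E + l / r * N.
  have E1 : E = (I al be (fun x => (en a wu x + Du x) + (en 1 wy x - Dy x)))
     + l * en a wu al + l * en 1 wy be.
    have e1 : I al be (fun x => (en a wu x + Du x) + (en 1 wy x - Dy x)) =
        E + I al be Du - I al be Dy.
      rewrite ID; [|exact: itgD|exact: itgB].
      by rewrite (ID iu iDu) (IB iy iDy) /E (ID iu iy); ring.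
    rewrite e1; move: Eu Ey; rewrite !subrr !mul0r -/l; clear; lra.
  have e2 : I al be (fun x => (en a wu x + Du x) + (en 1 wy x - Dy x)) <=
      (l * r + k) * E + l / r * N.
    have iE := itgD iu iy; have iN := itgD isu isy.
    rewrite -!IZ// -ID; [|exact: itgZ|exact: itgZ].
    apply: I_le; [apply: itgD; [exact: itgD|exact: itgB]
                 |apply: itgD; exact: itgZ|].
    move=> x; rewrite in_itv/= => /andP[/ltW x1 /ltW x2].
    have t1 : 0 <= be - x by rewrite subr_ge0.
    have t1' : be - x <= l by rewrite /l lerD2l lerN2.
    have t2 : 0 <= x - al by rewrite subr_ge0.
    have t2' : x - al <= l by rewrite /l lerD2r.
    have := coupled_step c0 (v1 wu x) (v2 wu x) (S1 wu x) (S2 wu x) (f1 wu x)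
      (f2 wu x) (h1 wu x) (h2 wu x) (v1 wy x) (v2 wy x) s0 r0 t1 t1' (normr1 R).
    have := coupled_step (- c0) (v1 wy x) (v2 wy x) (S1 wy x) (S2 wy x) (f1 wy x)
      (f2 wy x) (h1 wy x) (h2 wy x) (v1 wu x) (v2 wu x) ltr01 r0 t2 t2' (normrN1 R).
    rewrite normrN sa expr1n /Du /Dy.
    have ku : l * `|c0| / s <= k by rewrite le_max lexx.
    have ky : l * `|c0| / 1 <= k by rewrite le_max lexx orbT.
    have n1 : 0 <= (S1 wu x ^+ 2 + S2 wu x ^+ 2) / a + (v1 wy x ^+ 2 + v2 wy x ^+ 2) by pos.
    have n2 : 0 <= (S1 wy x ^+ 2 + S2 wy x ^+ 2) / 1 + (v1 wu x ^+ 2 + v2 wu x ^+ 2) by pos.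
    have := ler_wpM2r n1 ku; have := ler_wpM2r n2 ky.
    rewrite /en /src; clear; lra.
  rewrite [X in X <= _]E1; move: e2; clear; lra.
have lr : l * r = (1 - k) / 2.
  by rewrite /r; field; rewrite lt0r_neq0.
have h : (1 - k) / 2 * E <= l * (en a wu al + en 1 wy be) + l / r * N.
  move: main; rewrite lr; clear; lra.
have c1 : 0 <= 2 / (1 - k) by pos.
have := ler_wpM2l c1 h.
have -> : 2 / (1 - k) * ((1 - k) / 2 * E) = E by field; rewrite lt0r_neq0.
move=> H; apply: (le_trans H); rewrite -[X in _ <= X]mulrA; apply: ler_wpM2l => //.
have N0 : 0 <= N by apply: I_ge0 => x _; rewrite /src; pos.
have n3 : 0 <= l / r * (en a wu al + en 1 wy be).
  by apply: mulr_ge0; [pos|rewrite /en; pos].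
have n4 : 0 <= l * N by pos.
move: n3 n4; clear; lra.
Qed.

End Coupled.

(** * The resolvent estimate at high frequency *)

Section HighFrequency.
Context {R : realType}.
Implicit Types (al be x y : R).
Local Notation mu := (@lebesgue_measure R).

Lemma local_coef_in (k al be x : R) : x \in `]al, be[ -> local_coef k al be x = k.
Proof. by move=> h; rewrite /local_coef indicE mem_set// mulr1. Qed.

Lemma local_coef_out (k al be x : R) : (x <= al) || (be <= x) ->
  local_coef k al be x = 0.
Proof.
move=> h; rewrite /local_coef indicE memNset ?mulr0//= in_itv/= => /andP[h1 h2].
by case/orP: h; rewrite leNgt ?h1 ?h2.
Qed.

(** The energy density of the state itself; it agrees almost everywhere with [en] where there is no
    damping. *)
Definition ent (a : R) (w : wdata) x :=
  v1 w x ^+ 2 + v2 w x ^+ 2 + a * (p1 w x ^+ 2 + p2 w x ^+ 2).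

Lemma ent_itg al be (a la : R) ka k o1 o2 w : al <= be ->
  wave al be a la ka k o1 o2 w -> itg al be (ent a w).
Proof.
move=> ab [? ? _ _ _ _ av1 av2 _ _ _].
have sv1 := ac_sq ab av1; have sv2 := ac_sq ab av2.
by rewrite /ent; itg_tac.
Qed.

Lemma src_sub (L : R) al be (a : R) w : 0 < a -> 0 <= al -> al <= be -> be <= L ->
  itg 0 L (src a w) -> I al be (src a w) <= I 0 L (src a w).
Proof. by move=> a0 h1 h2 h3 hi; apply: I_mono => // x _; rewrite /src; pos. Qed.

Lemma free_sub (L : R) al be (a la : R) ka k o1 o2 w : 0 < a ->
  wave 0 L a la ka k o1 o2 w -> sq 0 L o1 -> sq 0 L o2 ->
  0 <= al -> al < be -> be <= L ->
  (forall x, x \in `]al, be[ -> ka x = 0) ->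
  (forall x, x \in `]al, be[ -> k x = 0) ->
  forall x y, al <= x <= be -> al <= y <= be ->
  en a w x <= 2 * en a w y + 4 * L * I 0 L (src a w).
Proof.
move=> a0 W so1 so2 h1 h2 h3 hka hk x y hx hy.
have W' := waveS h1 h3 hka hk W.
have := free_sup h2 a0 W' (sqS h1 h3 so1) (sqS h1 h3 so2) hx hy.
have -> : I al be (srck a 0 o1 o2 w) = I al be (src a w).
  by apply: I_eq => t _; rewrite /srck /src !mul0r !subr0.
have isrc : itg 0 L (src a w) by case: W => *; exact: src_itg.
have s1 := src_sub a0 h1 (ltW h2) h3 isrc.
have s0 : 0 <= I al be (src a w) by apply: I_ge0 => t _; rewrite /src; pos.
move=> H; apply: (le_trans H); rewrite lerD2l -!mulrA ler_wpM2l//.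
by apply: ler_pM => //; lra.
Qed.

(** Off the damped interval [ent] is [en] almost everywhere, hence at most [M]. On it only the
    velocity part is taken from [en], and the strain from [P]. *)
Lemma ent_bound (L : R) e1 e2 (a la M P : R) ka k o1 o2 w : 0 < a -> 
  wave 0 L a la ka k o1 o2 w -> 0 < e1 -> e1 < e2 -> e2 < L ->
  (forall x, x <= e1 -> ka x = 0) -> (forall x, e2 <= x -> ka x = 0) ->
  (forall x, 0 <= x <= L -> en a w x <= M) ->
  I e1 e2 (fun x => p1 w x ^+ 2 + p2 w x ^+ 2) <= P ->
  I 0 L (ent a w) <= L * M + a * P.
Proof.
move=> a0 W h1 h2 h3 ka1 ka2 HM HP.
have L0 : 0 <= L by lra.
have ie := ent_itg L0 W.
have F al be : 0 <= al -> al < be -> be <= L ->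
    (forall x, x \in `]al, be[ -> ka x = 0) -> I al be (ent a w) <= M * (be - al).
  move=> k1 k2 k3 hka; rewrite -Icst ?(ltW k2)//.
  apply: I_le_ae; [exact: itgS ie|exact: itg_cst|].
  case: (waveS k1 k3 (fun _ _ => erefl) (fun _ _ => erefl) W) => _ _ _ _ _ _ _ _ _ _ hS.
  apply: (aeS hS) => x hx hi; have [e1' e2'] := hx hi.
  have := HM x; move: hi; rewrite in_itv/= => /andP[x1 x2].
  rewrite (ltW (le_lt_trans k1 x1)) (ltW (lt_le_trans x2 k3)) => /(_ isT).
  rewrite /en e1' e2' hka; last by rewrite in_itv/= x1.
  rewrite !mul0r !addr0 /ent.
  by have -> : ((a * p1 w x) ^+ 2 + (a * p2 w x) ^+ 2) / a = a * (p1 w x ^+ 2 + p2 w x ^+ 2)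
    by field; rewrite lt0r_neq0.
rewrite (I_split (ltW h1) (ltW (lt_trans h2 h3)) ie).
rewrite (I_split (ltW h2) (ltW h3)); last exact: itgS (ltW h1) _ ie.
have F1 := F 0 e1 (lexx _) h1 (ltW (lt_trans h2 h3)).
have F2 := F e2 L (ltW (lt_trans h1 h2)) h3 (lexx _).
have {}F1 : I 0 e1 (ent a w) <= M * (e1 - 0).
  by apply: F1 => x; rewrite in_itv/= => /andP[_ /ltW]; exact: ka1.
have {}F2 : I e2 L (ent a w) <= M * (L - e2).
  by apply: F2 => x; rewrite in_itv/= => /andP[/ltW + _]; exact: ka2.
have F3 : I e1 e2 (ent a w) <= M * (e2 - e1) + a * P.
  have [sp1 sp2 _ _ _ _ av1 av2 _ _ _] := W.
  have sv1 := ac_sq L0 av1; have sv2 := ac_sq L0 av2.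
  have iv : itg 0 L (fun x => v1 w x ^+ 2 + v2 w x ^+ 2) by itg_tac.
  have ip : itg 0 L (fun x => p1 w x ^+ 2 + p2 w x ^+ 2) by itg_tac.
  have {}iv := itgS (ltW h1) (ltW h3) iv; have {}ip := itgS (ltW h1) (ltW h3) ip.
  rewrite /ent ID//; last exact: itgZ.
  rewrite IZ//; apply: lerD; last by rewrite ler_wpM2l// ltW.
  rewrite -Icst ?(ltW h2)//; apply: I_le => //; first exact: itg_cst.
  move=> x; rewrite in_itv/= => /andP[x1 x2].
  have := HM x; rewrite (ltW (lt_trans h1 x1)) (ltW (lt_trans x2 h3)) => /(_ isT).
  rewrite /en; have : 0 <= (S1 w x ^+ 2 + S2 w x ^+ 2) / a by pos.
  lra.
move: F1 F2 F3; clear; lra.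
Qed.

Record wsystem (L a : R) (b c d : R -> R) (la : R) (wu wy : wdata) : Prop := WSystem {
  ws_u : wave 0 L a la b c (v1 wy) (v2 wy) wu;
  ws_y : wave 0 L 1 la d (fun x => - c x) (v1 wu) (v2 wu) wy;
  ws_ubc : [/\ v1 wu 0 = 0, v2 wu 0 = 0, v1 wu L = 0 & v2 wu L = 0];
  ws_ybc : [/\ v1 wy 0 = 0, v2 wy 0 = 0, v1 wy L = 0 & v2 wy L = 0] }.

Definition Nsrc (L a : R) wu wy := I 0 L (fun x => src a wu x + src 1 wy x).
Definition Etot (L a : R) wu wy := I 0 L (fun x => ent a wu x + ent 1 wy x).

Lemma high_frequency (L a b0 b1 b2 c0 c1 c2 d0 d1 d2 mu0 : R) :
  0 < L -> 0 < a -> 0 < b0 -> 0 < d0 ->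
  [&& 0 < b1, b1 < b2, b2 < c1, c1 < c2, c2 < d1, d1 < d2 & d2 < L] ->
  `|c0| * (c2 - c1) < Num.sqrt a -> `|c0| * (c2 - c1) < 1 -> 0 < mu0 -> exists2 K : R, 0 < K &
  forall la m X wu wy, mu0 <= m -> `|la| = m ^+ 2 -> 
  wsystem L a (local_coef b0 b1 b2) (local_coef c0 c1 c2) (local_coef d0 d1 d2) la wu wy ->
  Nsrc L a wu wy <= X ->
  I b1 b2 (fun x => dv1 la wu x ^+ 2 + dv2 la wu x ^+ 2) <= X ->
  I d1 d2 (fun x => dv1 la wy x ^+ 2 + dv2 la wy x ^+ 2) <= X ->
  Etot L a wu wy <= K * m * X.
Proof.
move=> L0 a0 b00 d00 ord hc1 hc2 m0; case/and5P: ord => r1 r2 r3 r4 /and3P[r5 r6 r7].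
have [Ku Ku0 HKu] := damped_sup r2 a0 b00 m0.
have [Ky Ky0 HKy] := damped_sup r6 ltr01 d00 m0.
have [Kc Kc0 HKc] := coupled r4 a0 hc1 hc2.
pose q := mu0^-1; have q0 : 0 < q by rewrite /q; pos.
have ia0 : 0 < a^-1 by pos.
(* With [Y = m X], these are successive bounds in multiples of [Y]: [M1] for the first wave on its
   damped interval, [M2] for the second on its own, [M3] for the first at [c1] and the second at
   [c2], [M4] for the integral over the coupling interval, [M5] for the values there, [M6] on all of
   [[0, L]]. The factor [q] converts [X] into [Y]. *)
pose M1 := Ku * (1 + a). pose M2 := Ky * (1 + 1).
pose M3 := 2 * (M1 + M2) + 4 * L * q.
pose M4 := Kc * (M3 + M3 + q).
pose M5 := 2 * M3 + 4 * L * (2 * q + 2 * c0 ^+ 2 * (a^-1 + 1) * M4).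
pose M6 := 2 * M5 + 4 * L * q.
have M10 : 0 < M1 by rewrite /M1; pos.
have M20 : 0 < M2 by rewrite /M2; pos.
have M30 : 0 < M3 by rewrite /M3; pos.
have M40 : 0 < M4 by rewrite /M4; pos.
have c20 : 0 <= c0 ^+ 2 by pos.
have M53 : M3 <= M5.
  have : 0 <= 4 * L * (2 * q + 2 * c0 ^+ 2 * (a^-1 + 1) * M4) by pos.
  rewrite /M5; move: M30; clear; lra.
have M65 : M5 <= M6.
  have : 0 <= 4 * L * q by pos.
  rewrite /M6; move: M30 M53; clear; lra.
have M31 : M1 <= M3.
  have : 0 <= 4 * L * q by pos.
  rewrite /M3; move: M10 M20; clear; lra.
have M32 : M2 <= M3.
  have : 0 <= 4 * L * q by pos.
  rewrite /M3; move: M10 M20; clear; lra.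
have M60 : 0 < M6 by move: M30 M53 M65; clear; lra.
exists (2 * L * M6 + (a * M1 + M2) * q); first by pos.
move=> la m X wu wy hm hla [Wu Wy _ _] hN hDu hDy.
have m_gt0 : 0 < m by exact: lt_le_trans hm.
have [up1 up2 uf1 uf2 uh1 uh2 uv1 uv2 uS1 uS2 _] := Wu.
have [yp1 yp2 yf1 yf2 yh1 yh2 yv1 yv2 yS1 yS2 _] := Wy.
have suv1 := ac_sq (ltW L0) uv1; have suv2 := ac_sq (ltW L0) uv2.
have syv1 := ac_sq (ltW L0) yv1; have syv2 := ac_sq (ltW L0) yv2.
have isu := src_itg a uf1 uf2 uh1 uh2.
have isy := src_itg 1 yf1 yf2 yh1 yh2.
have Nu0 : 0 <= I 0 L (src a wu) by apply: I_ge0 => t _; rewrite /src; pos.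
have Ny0 : 0 <= I 0 L (src 1 wy) by apply: I_ge0 => t _; rewrite /src; pos.
rewrite /Nsrc ID// in hN.
have hNu : I 0 L (src a wu) <= X by move: hN Ny0; clear; lra.
have hNy : I 0 L (src 1 wy) <= X by move: hN Nu0; clear; lra.
have X0 : 0 <= X by exact: le_trans hNu.
pose Y := m * X; have Y0 : 0 <= Y by rewrite /Y; pos.
have XY : X <= q * Y.
  rewrite /Y mulrA ler_peMl//.
  have <- : q * mu0 = 1 by rewrite /q mulVf// lt0r_neq0.
  by rewrite ler_wpM2l// ltW.
have LX : 4 * L * X <= 4 * L * q * Y.
  by rewrite -[X in _ <= X]mulrA; apply: ler_wpM2l => //; pos.
have ordw : [/\ 0 <= b1, b1 <= L, 0 <= b2, b2 <= L & 0 <= c1] /\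
   [/\ c1 <= L, 0 <= c2, c2 <= L, 0 <= d1 & d1 <= L] /\ [/\ 0 <= d2, d2 <= L & 0 <= L].
  by move: L0 r1 r2 r3 r4 r5 r6 r7; clear => *; do !split; lra.
case: ordw => -[B1 B1' B2 B2' C1] [[C1' C2 C2' D1 D1'] [D2 D2' L0']].
have subs (a' : R) w al be : 0 < a' -> 0 <= al -> al <= be -> be <= L ->
    sq 0 L (f1 w) -> sq 0 L (f2 w) -> sq 0 L (h1 w) -> sq 0 L (h2 w) ->
    I 0 L (src a' w) <= X ->
    I al be (fun x => f1 w x ^+ 2 + f2 w x ^+ 2) <= (1 + a') * X /\
    I al be (fun x => h1 w x ^+ 2 + h2 w x ^+ 2) <= (1 + a') * X.
  move=> a'0 k1 k2 k3 s1 s2 s3 s4 hX.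
  have iw := src_itg a' s1 s2 s3 s4.
  have H g : itg 0 L g -> (forall x, g x <= (1 + a') * src a' w x) ->
      I al be g <= (1 + a') * X.
    move=> ig gs; apply: (@le_trans _ _ ((1 + a') * I al be (src a' w))).
      rewrite -IZ; last exact: itgS iw.
      by apply: I_le; [exact: itgS ig|apply: itgZ; exact: itgS iw|].
    apply: ler_wpM2l; first by pos.
    exact: le_trans (src_sub a'0 k1 k2 k3 iw) hX.
  have ia' : 0 < a'^-1 by pos.
  have aa : a' * a'^-1 = 1 by rewrite divff// lt0r_neq0.
  split; apply: H; itg_tac; move=> x; rewrite /src.
    have n1 : 0 <= a' * (f1 w x ^+ 2 + f2 w x ^+ 2) by pos.
    have n2 : 0 <= (1 + a') * ((h1 w x ^+ 2 + h2 w x ^+ 2) / a') by pos.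
    move: n1 n2; clear; lra.
  have -> : (1 + a') * (f1 w x ^+ 2 + f2 w x ^+ 2 + (h1 w x ^+ 2 + h2 w x ^+ 2) / a') =
    (1 + a') * (f1 w x ^+ 2 + f2 w x ^+ 2) + (h1 w x ^+ 2 + h2 w x ^+ 2) / a'
     + (h1 w x ^+ 2 + h2 w x ^+ 2) by field; rewrite lt0r_neq0.
  have n1 : 0 <= (1 + a') * (f1 w x ^+ 2 + f2 w x ^+ 2) by pos.
  have n2 : 0 <= (h1 w x ^+ 2 + h2 w x ^+ 2) / a' by pos.
  move: n1 n2; clear; lra.
have bX (a' : R) : 0 < a' -> X <= (1 + a') * X by move=> ?; rewrite ler_peMl// lerDl ltW.
have Wub : wave b1 b2 a la (fun=> b0) (fun=> 0) (v1 wy) (v2 wy) wu.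
  apply: (waveS B1 B2' _ _ Wu) => x hx; first exact: local_coef_in.
  apply: local_coef_out; move: hx r3; rewrite in_itv/=; clear => /andP[_ /ltW h] h'.
  by rewrite (le_trans h (ltW h')).
have Wyd : wave d1 d2 1 la (fun=> d0) (fun=> 0) (v1 wu) (v2 wu) wy.
  apply: (waveS D1 D2' _ _ Wy) => x hx; first exact: local_coef_in.
  rewrite local_coef_out ?oppr0//.
  move: hx r5; rewrite in_itv/=; clear => /andP[/ltW h _] h'.
  by rewrite (le_trans (ltW h') h) orbT.
have [Hub Hup] : (forall x, b1 <= x <= b2 -> en a wu x <= M1 * Y) /\
    I b1 b2 (fun x => p1 wu x ^+ 2 + p2 wu x ^+ 2) <= M1 * X.
  have [s1 s2] := subs a wu b1 b2 a0 B1 (ltW r2) B2' uf1 uf2 uh1 uh2 hNu.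
  have X'0 : 0 <= (1 + a) * X by pos.
  have [] := HKu la m ((1 + a) * X) _ _ wu hm hla X'0 Wub (le_trans hDu (bX _ a0)) s1 s2.
  rewrite !mulrA => H1 H2; split => // x /H1.
  by rewrite /M1 /Y; clear; lra.
have [Hyd Hyp] : (forall x, d1 <= x <= d2 -> en 1 wy x <= M2 * Y) /\
    I d1 d2 (fun x => p1 wy x ^+ 2 + p2 wy x ^+ 2) <= M2 * X.
  have [s1 s2] := subs 1 wy d1 d2 ltr01 D1 (ltW r6) D2' yf1 yf2 yh1 yh2 hNy.
  have X'0 : 0 <= (1 + 1) * X by pos.
  have [] := HKy la m ((1 + 1) * X) _ _ wy hm hla X'0 Wyd (le_trans hDy (bX _ ltr01)) s1 s2.
  rewrite !mulrA => H1 H2; split => // x /H1.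
  by rewrite /M2 /Y; clear; lra.
have out (al be t u v : R) : (be <= u) || (v <= al) -> al < t < be -> (t <= u) || (v <= t).
  by clear => /orP[] h /andP[/ltW h1 /ltW h2]; rewrite ?(le_trans h2 h)// (le_trans h h1) orbT.
have fu al be x y : 0 <= al -> al < be -> be <= L ->
    (be <= b1) || (b2 <= al) -> (be <= c1) || (c2 <= al) ->
    al <= x <= be -> al <= y <= be ->
    en a wu x <= 2 * en a wu y + 4 * L * q * Y.
  move=> k1 k2 k3 k4 k5 hx hy.
  have := free_sub a0 Wu syv1 syv2 k1 k2 k3 _ _ hx hy => H.
  apply: le_trans (H _ _) _.
  - move=> t; rewrite in_itv/= => ht; apply: local_coef_out.
    exact: out k4 ht.
  - move=> t; rewrite in_itv/= => ht; apply: local_coef_out.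
    exact: out k5 ht.
  - rewrite lerD2l; apply: le_trans LX; apply: ler_wpM2l => //; pos.
have fy al be x y : 0 <= al -> al < be -> be <= L ->
    (be <= d1) || (d2 <= al) -> (be <= c1) || (c2 <= al) ->
    al <= x <= be -> al <= y <= be ->
    en 1 wy x <= 2 * en 1 wy y + 4 * L * q * Y.
  move=> k1 k2 k3 k4 k5 hx hy.
  have := free_sub ltr01 Wy suv1 suv2 k1 k2 k3 _ _ hx hy => H.
  apply: le_trans (H _ _) _.
  - move=> t; rewrite in_itv/= => ht; apply: local_coef_out.
    exact: out k4 ht.
  - move=> t; rewrite in_itv/= => ht; rewrite local_coef_out ?oppr0//.
    exact: out k5 ht.
  - rewrite lerD2l; apply: le_trans LX; apply: ler_wpM2l => //; pos.
have uc1 : en a wu c1 <= M3 * Y.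
  have := fu b2 c1 c1 b2 B2 r3 C1'; rewrite !lexx (ltW r3) orbT => /(_ isT isT isT isT) H.
  apply: (le_trans H); have := Hub b2; rewrite (ltW r2) lexx => /(_ isT).
  have : 0 <= M2 * Y by pos.
  by rewrite /M3; clear; lra.
have yc2 : en 1 wy c2 <= M3 * Y.
  have := fy c2 d1 c2 d1 C2 r5 D1'; rewrite !lexx (ltW r5) orbT => /(_ isT isT isT isT) H.
  apply: (le_trans H); have := Hyd d1; rewrite (ltW r6) lexx => /(_ isT).
  have : 0 <= M1 * Y by pos.
  by rewrite /M3; clear; lra.
have Wuc : wave c1 c2 a la (fun=> 0) (fun=> c0) (v1 wy) (v2 wy) wu.
  apply: (waveS C1 C2' _ _ Wu) => x hx; last exact: local_coef_in.
  apply: local_coef_out; move: hx r3; rewrite in_itv/=; clear => /andP[/ltW h _] h'.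
  by rewrite (le_trans (ltW h') h) orbT.
have Wyc : wave c1 c2 1 la (fun=> 0) (fun=> - c0) (v1 wu) (v2 wu) wy.
  apply: (waveS C1 C2' _ _ Wy) => x hx; last by rewrite local_coef_in.
  apply: local_coef_out; move: hx r5; rewrite in_itv/=; clear => /andP[_ /ltW h] h'.
  by rewrite (le_trans h (ltW h')).
have iS g : itg 0 L g -> itg c1 c2 g by exact: itgS.
have Ns : I c1 c2 (fun x => src a wu x + src 1 wy x) <= q * Y.
  apply: le_trans XY; rewrite ID; [|exact: iS|exact: iS].
  apply: le_trans hN; apply: lerD; apply: src_sub => //; exact: ltW.
have ieu := en_itg (ltW r4) Wuc; have iey := en_itg (ltW r4) Wyc.
have Ec : I c1 c2 (fun x => en a wu x + en 1 wy x) <= M4 * Y.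
  apply: (le_trans (HKc _ _ _ Wuc Wyc)); rewrite /M4 -!mulrA; apply: ler_wpM2l; first by pos.
  by move: uc1 yc2 Ns; clear; lra.
have Eu0 : 0 <= I c1 c2 (en a wu) by apply: I_ge0 => t _; rewrite /en; pos.
have Ey0 : 0 <= I c1 c2 (en 1 wy) by apply: I_ge0 => t _; rewrite /en; pos.
rewrite ID// in Ec.
have lc : 0 < c2 - c1 <= L by move: r4 C1 C2'; clear => *; apply/andP; split; lra.
(* The integral bound on the coupling interval becomes pointwise: the velocity of the other wave,
   now bounded in L^2, is treated as a source in [free_sup]. *)
have cpl (a' k0 : R) w (g1 g2 : R -> R) : 0 < a' -> a'^-1 <= a^-1 + 1 -> k0 ^+ 2 = c0 ^+ 2 ->
    wave c1 c2 a' la (fun=> 0) (fun=> k0) g1 g2 w -> sq c1 c2 g1 -> sq c1 c2 g2 ->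
    I c1 c2 (src a' w) <= q * Y -> I c1 c2 (fun x => g1 x ^+ 2 + g2 x ^+ 2) <= M4 * Y ->
    forall x y, c1 <= x <= c2 -> c1 <= y <= c2 -> en a' w y <= M3 * Y ->
    en a' w x <= M5 * Y.
  move=> a'0 aa kk W sg1 sg2 hs hg x y hx hy hey.
  have := free_sup r4 a'0 W sg1 sg2 hx hy.
  have [_ _ sf1 sf2 sh1 sh2 _ _ _ _ _] := W.
  have ia' : 0 < a'^-1 by pos.
  have isw := src_itg a' sf1 sf2 sh1 sh2.
  have isk := srck_itg a' k0 sf1 sf2 sh1 sh2 sg1 sg2.
  have ig : itg c1 c2 (fun x => g1 x ^+ 2 + g2 x ^+ 2) by itg_tac.
  have K1 : I c1 c2 (srck a' k0 g1 g2 w) <= (2 * q + 2 * c0 ^+ 2 * (a^-1 + 1) * M4) * Y.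
    apply: (@le_trans _ _ (2 * I c1 c2 (src a' w) +
       2 * c0 ^+ 2 * (a^-1 + 1) * I c1 c2 (fun x => g1 x ^+ 2 + g2 x ^+ 2))).
      rewrite -!IZ// -ID; [|exact: itgZ|exact: itgZ].
      apply: I_le => //; first by apply: itgD; exact: itgZ.
      move=> t _; rewrite /srck /src -kk.
      have n1 : 0 <= f1 w t ^+ 2 + f2 w t ^+ 2 by pos.
      have n2 : 0 <= ((h1 w t + k0 * g1 t) ^+ 2 + (h2 w t + k0 * g2 t) ^+ 2) / a' by pos.
      have n3 : 0 <= 2 * k0 ^+ 2 * (g1 t ^+ 2 + g2 t ^+ 2) by pos.
      have := ler_wpM2l n3 aa; move: n1 n2; clear; lra.
    have n4 : 0 <= 2 * c0 ^+ 2 * (a^-1 + 1) by pos.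
    have := ler_wpM2l n4 hg; move: hs; clear; lra.
  move=> H; apply: (le_trans H); rewrite /M5.
  set Z := I _ _ _ in K1 *; set Q := 2 * q + _ in K1 *.
  have Z0 : 0 <= Z by apply: I_ge0 => t _; rewrite /srck; pos.
  have : (c2 - c1) * Z <= L * (Q * Y).
    by case/andP: lc => l1 l2; apply: ler_pM => //; exact: ltW.
  by move: hey; clear; lra.
have U5 x : c1 <= x <= c2 -> en a wu x <= M5 * Y.
  have hc : c1 <= c1 <= c2 by rewrite lexx ltW.
  move=> hx; apply: (cpl a c0 wu _ _ a0 _ _ Wuc _ _ _ _ x c1 hx hc uc1) => //.
  - by rewrite lerDl.
  - exact: (ac_sq (ltW r4) (w_v1 Wyc)).
  - exact: (ac_sq (ltW r4) (w_v2 Wyc)).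
  - by apply: le_trans XY; apply: le_trans hNu; apply: src_sub => //; exact: ltW.
  - apply: (@le_trans _ _ (I c1 c2 (en 1 wy))); last by move: Ec Eu0; clear; lra.
    apply: I_le => //.
      have s1 := ac_sq (ltW r4) (w_v1 Wyc); have s2 := ac_sq (ltW r4) (w_v2 Wyc).
      by itg_tac.
    by move=> t _; rewrite /en lerDl; pos.
have Y5 x : c1 <= x <= c2 -> en 1 wy x <= M5 * Y.
  have hc : c1 <= c2 <= c2 by rewrite lexx ltW.
  move=> hx; apply: (cpl 1 (- c0) wy _ _ ltr01 _ _ Wyc _ _ _ _ x c2 hx hc yc2) => //.
  - by rewrite invr1 lerDr ltW.
  - exact: sqrrN.
  - exact: (ac_sq (ltW r4) (w_v1 Wuc)).
  - exact: (ac_sq (ltW r4) (w_v2 Wuc)).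
  - by apply: le_trans XY; apply: le_trans hNy; apply: src_sub => //; exact: ltW.
  - apply: (@le_trans _ _ (I c1 c2 (en a wu))); last by move: Ec Ey0; clear; lra.
    apply: I_le => //.
      have s1 := ac_sq (ltW r4) (w_v1 Wuc); have s2 := ac_sq (ltW r4) (w_v2 Wuc).
      by itg_tac.
    by move=> t _; rewrite /en lerDl; pos.
have M16 : M1 <= M6 by move: M31 M53 M65; clear; lra.
have M26 : M2 <= M6 by move: M32 M53 M65; clear; lra.
have fin e z : e <= 2 * z + 4 * L * q * Y -> z <= M5 * Y -> e <= M6 * Y.
  by rewrite /M6; clear; lra.
have up (M : R) e : M <= M6 -> e <= M * Y -> e <= M6 * Y.
  by move=> h1 h2; apply: (le_trans h2); apply: ler_wpM2r.
(* The first wave is undamped and uncoupled on all of [(c2, L)], so the damped interval of the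
   second wave is crossed without a stop; symmetrically, the second wave crosses [(0, c1)] at
   once. *)
have Uall x : 0 <= x <= L -> en a wu x <= M6 * Y.
  move=> /andP[x0 xL].
  have [h|h] := leP x b1.
    apply: (fin _ (en a wu b1)); last first.
      apply: (@le_trans _ _ (M1 * Y)); first by apply: Hub; rewrite lexx ltW.
      by apply: ler_wpM2r => //; exact: le_trans M53.
    apply: (fu 0 b1) => //; rewrite ?lexx ?x0 ?h ?B1//.
    by rewrite (ltW (lt_trans r2 r3)).
  have [h'|h'] := leP x b2.
    by apply: (up M1) => //; apply: Hub; rewrite (ltW h).
  have [k|k] := leP x c1.
    apply: (fin _ (en a wu b2)); last first.
      apply: (@le_trans _ _ (M1 * Y)); first by apply: Hub; rewrite lexx ltW.
      by apply: ler_wpM2r => //; exact: le_trans M53.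
    by apply: (fu b2 c1) => //; rewrite ?lexx ?orbT ?k ?(ltW h') ?(ltW r3).
  have [k'|k'] := leP x c2.
    by apply: (up M5) => //; apply: U5; rewrite (ltW k).
  apply: (fin _ (en a wu c2)); last by apply: U5; rewrite lexx ltW.
  apply: (fu c2 L) => //; rewrite ?lexx ?orbT ?xL ?C2' ?(ltW k')//.
    by move: r5 r6 r7; clear => *; lra.
  by rewrite (ltW (lt_trans r3 r4)) orbT.
have Yall x : 0 <= x <= L -> en 1 wy x <= M6 * Y.
  move=> /andP[x0 xL].
  have [h|h] := leP d2 x.
    apply: (fin _ (en 1 wy d2)); last first.
      apply: (@le_trans _ _ (M2 * Y)); first by apply: Hyd; rewrite lexx ltW.
      by apply: ler_wpM2r => //; exact: le_trans M53.
    apply: (fy d2 L) => //; rewrite ?lexx ?orbT ?xL ?h ?D2'//.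
    by rewrite (ltW (lt_trans r5 r6)) orbT.
  have [h'|h'] := leP d1 x.
    by apply: (up M2) => //; apply: Hyd; rewrite h' ltW.
  have [k|k] := leP c2 x.
    apply: (fin _ (en 1 wy d1)); last first.
      apply: (@le_trans _ _ (M2 * Y)); first by apply: Hyd; rewrite lexx ltW.
      by apply: ler_wpM2r => //; exact: le_trans M53.
    by apply: (fy c2 d1) => //; rewrite ?lexx ?orbT ?k ?(ltW h') ?(ltW r5).
  have [k'|k'] := leP c1 x.
    by apply: (up M5) => //; apply: Y5; rewrite k' ltW.
  apply: (fin _ (en 1 wy c1)); last by apply: Y5; rewrite lexx ltW.
  apply: (fy 0 c1) => //; rewrite ?lexx ?x0 ?C1 ?(ltW k')//.
    by move: r1 r2 r3; clear => *; lra.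
  by rewrite (ltW (lt_trans r4 r5)).
have Tu := ent_bound a0 Wu r1 r2 (_ : b2 < L) _ _ Uall Hup.
have Ty := ent_bound ltr01 Wy (_ : 0 < d1) r6 r7 _ _ Yall Hyp.
rewrite /Etot ID; [|exact: ent_itg L0' Wu|exact: ent_itg L0' Wy].
have {}Tu : I 0 L (ent a wu) <= L * (M6 * Y) + a * (M1 * X).
  apply: Tu => [|x h|x h]; try by apply: local_coef_out; rewrite h ?orbT.
  by move: r3 r4 r5 r6 r7; clear => *; lra.
have {}Ty : I 0 L (ent 1 wy) <= L * (M6 * Y) + 1 * (M2 * X).
  apply: Ty => [|x h|x h]; try by apply: local_coef_out; rewrite h ?orbT.
  by move: r1 r2 r3 r4 r5; clear => *; lra.
have n5 : 0 <= a * M1 + M2 by pos.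
have := ler_wpM2l n5 XY; move: Tu Ty; rewrite -[_ * m * X]mulrA -/Y.
clear; lra.
Qed.
End HighFrequency.

(** * The resolvent estimate at all frequencies *)

Section Resolvent.
Context {R : realType}.
Implicit Types (al be x y : R).
Local Notation mu := (@lebesgue_measure R).

Lemma local_coef_meas (D : set R) (k al be : R) : measurable_fun D (local_coef k al be).
Proof.
apply: measurable_funTS; rewrite /local_coef.
apply: measurable_funM => //; apply: measurable_indic => //.
Qed.

Lemma local_coef_sqM (k al be l r : R) g : sq l r g ->
  sq l r (fun x => local_coef k al be x * g x).
Proof.
move=> sg; apply: (@sqM_bnd _ _ _ `|k|) => //; first exact: local_coef_meas.
move=> x _; rewrite /local_coef normrM indicE.
by case: (x \in _); rewrite ?normr1 ?mulr1// normr0 mulr0.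
Qed.

Lemma local_coef_I (L k al be : R) g : 0 <= al -> al <= be -> be <= L -> 0 <= k ->
  itg 0 L g -> itg 0 L (fun x => local_coef k al be x * g x) ->
  (forall x, 0 <= g x) ->
  k * I al be g <= I 0 L (fun x => local_coef k al be x * g x).
Proof.
move=> h1 h2 h3 k0 ig ikg g0; rewrite -IZ; last exact: itgS ig.
apply: (@le_trans _ _ (I al be (fun x => local_coef k al be x * g x))).
  by rewrite le_eqVlt; apply/orP; left; apply/eqP; apply: I_eq => x /local_coef_in ->.
apply: I_mono => // x _; apply: mulr_ge0 => //.
by rewrite /local_coef mulr_ge0// indicE ler0n.
Qed.

(** Integrates the derivative of [S1 v1 + S2 v2], which vanishes at both ends. The [la] terms cancel
    twice: [S'] pairs [v] with [i la v], and [p . v'] reduces to [- p . f]. *)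
Lemma dissipation_identity (L a la : R) ka k o1 o2 w : 0 <= L ->
  wave 0 L a la ka k o1 o2 w -> (forall g, sq 0 L g -> sq 0 L (fun x => ka x * g x)) ->
  (forall g, sq 0 L g -> sq 0 L (fun x => k x * g x)) -> sq 0 L o1 -> sq 0 L o2 ->
  v1 w 0 = 0 -> v2 w 0 = 0 -> v1 w L = 0 -> v2 w L = 0 ->
  I 0 L (fun x => ka x * (dv1 la w x ^+ 2 + dv2 la w x ^+ 2)) =
  I 0 L (fun x => h1 w x * v1 w x + h2 w x * v2 w x
    + a * (p1 w x * f1 w x + p2 w x * f2 w x)
    - k x * (o1 x * v1 w x + o2 x * v2 w x)).
Proof.
move=> L0 [sp1 sp2 sf1 sf2 sh1 sh2 av1 av2 aS1 aS2 hS] hka hk so1 so2 e1 e2 e3 e4.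
have sv1 := ac_sq L0 av1; have sv2 := ac_sq L0 av2.
have sS1 := ac_sq L0 aS1; have sS2 := ac_sq L0 aS2.
have sd1 : sq 0 L (dv1 la w) := av1.1.
have sd2 : sq 0 L (dv2 la w) := av2.1.
have ko1 := hk _ so1; have ko2 := hk _ so2.
have kd1 := hka _ sd1; have kd2 := hka _ sd2.
have Z := ac_incr (acD (acM L0 aS1 av1) (acM L0 aS2 av2)) (lexx _) L0 (lexx _).
rewrite e1 e2 e3 e4 !mulr0 !addr0 add0r in Z.
set G := fun x : R => _ in Z.
have iG : itg 0 L G by rewrite /G; itg_tac.
have iA : itg 0 L (fun x => ka x * (dv1 la w x ^+ 2 + dv2 la w x ^+ 2)).
  have : itg 0 L (fun x => ka x * dv1 la w x * dv1 la w x + ka x * dv2 la w x * dv2 la w x).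
    by itg_tac.
  by apply: itg_eq => x _; ring.
have iB : itg 0 L (fun x => h1 w x * v1 w x + h2 w x * v2 w x
    + a * (p1 w x * f1 w x + p2 w x * f2 w x)
    - k x * (o1 x * v1 w x + o2 x * v2 w x)).
  have : itg 0 L (fun x => h1 w x * v1 w x + h2 w x * v2 w x
    + a * (p1 w x * f1 w x + p2 w x * f2 w x)
    - (k x * o1 x * v1 w x + k x * o2 x * v2 w x)) by itg_tac.
  by apply: itg_eq => x _; ring.
apply/eqP; rewrite -subr_eq0 -IB//; apply/eqP; rewrite [RHS]Z; apply: I_ae_eq.
- exact: itg_meas (itgB iA iB).
- exact: itg_meas iG.
apply: (aeS hS) => x hx xi; have [E1 E2] := hx xi.
by rewrite /G E1 E2 /dv1 /dv2; ring.
Qed.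

(** The coupling enters the two equations with opposite signs and drops out of the sum. The source
    terms are split with a free weight [t], because the energy on the right has to be absorbed later
    at a frequency-dependent cost. *)
Lemma dissipation (L a b0 b1 b2 c0 c1 c2 d0 d1 d2 la t : R) wu wy :
  0 < L -> 0 < a -> 0 < b0 -> 0 < d0 -> 0 < t ->
  [&& 0 < b1, b1 < b2, b2 < c1, c1 < c2, c2 < d1, d1 < d2 & d2 < L] ->
  wsystem L a (local_coef b0 b1 b2) (local_coef c0 c1 c2) (local_coef d0 d1 d2) la wu wy ->
  b0 * I b1 b2 (fun x => dv1 la wu x ^+ 2 + dv2 la wu x ^+ 2) +
  d0 * I d1 d2 (fun x => dv1 la wy x ^+ 2 + dv2 la wy x ^+ 2) <=
  t * Etot L a wu wy + t^-1 * ((1 + a) * Nsrc L a wu wy).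
Proof.
move=> L0 a0 b00 d00 t0 /and5P[r1 r2 r3 r4 /and3P[r5 r6 r7]] [Wu Wy].
case=> u1 u2 u3 u4 [y1 y2 y3 y4]; have L0' := ltW L0.
have [up1 up2 uf1 uf2 uh1 uh2 uv1 uv2 _ _ _] := Wu.
have [yp1 yp2 yf1 yf2 yh1 yh2 yv1 yv2 _ _ _] := Wy.
have suv1 := ac_sq L0' uv1; have suv2 := ac_sq L0' uv2.
have syv1 := ac_sq L0' yv1; have syv2 := ac_sq L0' yv2.
have ud1 : sq 0 L (dv1 la wu) := uv1.1.
have ud2 : sq 0 L (dv2 la wu) := uv2.1.
have yd1 : sq 0 L (dv1 la wy) := yv1.1.
have yd2 : sq 0 L (dv2 la wy) := yv2.1.
have lc k al be g : sq 0 L g -> sq 0 L (fun x => local_coef k al be x * g x).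
  exact: local_coef_sqM.
have lcN k al be g : sq 0 L g -> sq 0 L (fun x => - local_coef k al be x * g x).
  by move=> /(lc k al be) /sqN; under eq_fun do rewrite -mulNr.
have Iu := dissipation_identity L0' Wu (lc _ _ _) (lc _ _ _) syv1 syv2 u1 u2 u3 u4.
have Iy := dissipation_identity L0' Wy (lc _ _ _) (lcN _ _ _) suv1 suv2 y1 y2 y3 y4.
have isd k al be g1 g2 : sq 0 L g1 -> sq 0 L g2 ->
    itg 0 L (fun x => local_coef k al be x * (g1 x ^+ 2 + g2 x ^+ 2)).
  move=> s1 s2; have l1 := lc k al be _ s1; have l2 := lc k al be _ s2.
  have : itg 0 L (fun x => local_coef k al be x * g1 x * g1 x + local_coef k al be x * g2 x * g2 x).
    by itg_tac.
  by apply: itg_eq => x _; ring.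
have B1 : 0 <= b1 /\ b2 <= L by move: r1 r2 r3 r4 r5 r6 r7; clear => *; split; lra.
have D1 : 0 <= d1 /\ d2 <= L by move: r1 r2 r3 r4 r5 r6 r7; clear => *; split; lra.
have Du : b0 * I b1 b2 (fun x => dv1 la wu x ^+ 2 + dv2 la wu x ^+ 2) <=
    I 0 L (fun x => local_coef b0 b1 b2 x * (dv1 la wu x ^+ 2 + dv2 la wu x ^+ 2)).
  apply: (local_coef_I B1.1 (ltW r2) B1.2 (ltW b00)); first by itg_tac.
    exact: isd.
  by move=> x; apply: addr_ge0; exact: sqr_ge0.
have Dy : d0 * I d1 d2 (fun x => dv1 la wy x ^+ 2 + dv2 la wy x ^+ 2) <=
    I 0 L (fun x => local_coef d0 d1 d2 x * (dv1 la wy x ^+ 2 + dv2 la wy x ^+ 2)).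
  apply: (local_coef_I D1.1 (ltW r6) D1.2 (ltW d00)); first by itg_tac.
    exact: isd.
  by move=> x; apply: addr_ge0; exact: sqr_ge0.
apply: (le_trans (lerD Du Dy)); rewrite Iu Iy.
have cv1 := lc c0 c1 c2 _ suv1; have cv2 := lc c0 c1 c2 _ suv2.
have cy1 := lc c0 c1 c2 _ syv1; have cy2 := lc c0 c1 c2 _ syv2.
rewrite -ID; last 2 first.
- have : itg 0 L (fun x => h1 wu x * v1 wu x + h2 wu x * v2 wu x
    + a * (p1 wu x * f1 wu x + p2 wu x * f2 wu x)
    - (local_coef c0 c1 c2 x * v1 wy x * v1 wu x + local_coef c0 c1 c2 x * v2 wy x * v2 wu x)) by itg_tac.
  by apply: itg_eq => x _; ring.
- have : itg 0 L (fun x => h1 wy x * v1 wy x + h2 wy x * v2 wy x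
    + 1 * (p1 wy x * f1 wy x + p2 wy x * f2 wy x)
    + (local_coef c0 c1 c2 x * v1 wu x * v1 wy x + local_coef c0 c1 c2 x * v2 wu x * v2 wy x)) by itg_tac.
  by apply: itg_eq => x _; ring.
have iEu := ent_itg L0' Wu; have iEy := ent_itg L0' Wy.
have iNu := src_itg a uf1 uf2 uh1 uh2; have iNy := src_itg 1 yf1 yf2 yh1 yh2.
have iE := itgD iEu iEy; have iN := itgD iNu iNy.
rewrite /Etot /Nsrc -!IZ//; [|exact: itgZ]; rewrite -ID; [|exact: itgZ|by apply: itgZ; exact: itgZ].
apply: I_le.
- have : itg 0 L (fun x => h1 wu x * v1 wu x + h2 wu x * v2 wu x
    + a * (p1 wu x * f1 wu x + p2 wu x * f2 wu x) +
    (h1 wy x * v1 wy x + h2 wy x * v2 wy x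
    + 1 * (p1 wy x * f1 wy x + p2 wy x * f2 wy x))) by itg_tac.
  by apply: itg_eq => x _; ring.
- by apply: itgD; [exact: itgZ|apply: itgZ; exact: itgZ].
move=> x _; rewrite /ent /src.
have it0 : 0 < t^-1 by pos.
have tt : t * t^-1 = 1 by rewrite divff// lt0r_neq0.
have yng z1 z2 : z1 * z2 <= t * z2 ^+ 2 + t^-1 * z1 ^+ 2.
  have -> : t * z2 ^+ 2 + t^-1 * z1 ^+ 2 = t * (z2 - t^-1 * z1 / 2) ^+ 2 + z1 * z2 * (t * t^-1) + 3 / 4 * t^-1 * z1 ^+ 2.
    by field; rewrite lt0r_neq0.
  rewrite tt mulr1.
  have n1 : 0 <= t * (z2 - t^-1 * z1 / 2) ^+ 2 by pos.
  have n2 : 0 <= 3 / 4 * t^-1 * z1 ^+ 2 by pos.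
  by move: n1 n2; clear; lra.
have E1 := yng (h1 wu x) (v1 wu x); have E2 := yng (h2 wu x) (v2 wu x).
have E3 := yng (h1 wy x) (v1 wy x); have E4 := yng (h2 wy x) (v2 wy x).
have E5 := ler_wpM2l (ltW a0) (yng (f1 wu x) (p1 wu x)).
have E6 := ler_wpM2l (ltW a0) (yng (f2 wu x) (p2 wu x)).
have E7 := yng (f1 wy x) (p1 wy x); have E8 := yng (f2 wy x) (p2 wy x).
have s1 : a * (f1 wu x ^+ 2 + f2 wu x ^+ 2) + (h1 wu x ^+ 2 + h2 wu x ^+ 2) <=
    (1 + a) * (f1 wu x ^+ 2 + f2 wu x ^+ 2 + (h1 wu x ^+ 2 + h2 wu x ^+ 2) / a).
  have -> : (1 + a) * (f1 wu x ^+ 2 + f2 wu x ^+ 2 + (h1 wu x ^+ 2 + h2 wu x ^+ 2) / a) =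
     a * (f1 wu x ^+ 2 + f2 wu x ^+ 2) + (h1 wu x ^+ 2 + h2 wu x ^+ 2)
     + ((f1 wu x ^+ 2 + f2 wu x ^+ 2) + (h1 wu x ^+ 2 + h2 wu x ^+ 2) / a).
    by field; rewrite lt0r_neq0.
  by rewrite lerDl; pos.
have s2 : (f1 wy x ^+ 2 + f2 wy x ^+ 2) + (h1 wy x ^+ 2 + h2 wy x ^+ 2) <=
    (1 + a) * (f1 wy x ^+ 2 + f2 wy x ^+ 2 + (h1 wy x ^+ 2 + h2 wy x ^+ 2) / 1).
  by rewrite divr1 mulrDl mul1r lerDl; pos.
have := ler_wpM2l (ltW it0) s1; have := ler_wpM2l (ltW it0) s2.
set T := (1 + a) * _; set T' := (1 + a) * _.
have -> : (1 + a) * (f1 wu x ^+ 2 + f2 wu x ^+ 2 + (h1 wu x ^+ 2 + h2 wu x ^+ 2) / a +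
    (f1 wy x ^+ 2 + f2 wy x ^+ 2 + (h1 wy x ^+ 2 + h2 wy x ^+ 2) / 1)) = T' + T.
  by rewrite /T /T' mulrDr.
move: E1 E2 E3 E4 E5 E6 E7 E8; clear; lra.
Qed.

Lemma poincare (L : R) F f : 0 < L -> ac 0 L F f -> F 0 = 0 ->
  I 0 L (fun x => F x ^+ 2) <= L ^+ 2 * I 0 L (fun x => f x ^+ 2).
Proof.
move=> L0 h F0; have sF := ac_sq (ltW L0) h; have sf := h.1.
set J := I 0 L (fun x => f x ^+ 2).
have J0 : 0 <= J by apply: I_ge0 => x _; pos.
have -> : L ^+ 2 * J = L * J * (L - 0) by ring.
rewrite -Icst ?(ltW L0)//; apply: I_le; itg_tac.
move=> x; rewrite in_itv/= => /andP[/ltW x0 /ltW xL].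
have := ac_sqr_incr h (lexx _) x0 xL; rewrite F0 !subr0 => H; apply: (le_trans H).
by apply: ler_wpM2r.
Qed.

(** [i la u - v] has derivative [f] and vanishes at 0, so Poincare's inequality makes [v] close to
    [i la u]. The factor [la ^+ 2] in front of the strain is the small parameter at low
    frequency. *)
Lemma velocity_bound (L a la : R) ka k o1 o2 w (u1 u2 : R -> R) : 0 < L ->
  wave 0 L a la ka k o1 o2 w -> ac 0 L u1 (p1 w) -> ac 0 L u2 (p2 w) ->
  u1 0 = 0 -> u2 0 = 0 -> v1 w 0 = 0 -> v2 w 0 = 0 ->
  I 0 L (fun x => v1 w x ^+ 2 + v2 w x ^+ 2) <=
  2 * L ^+ 2 * (la ^+ 2 * I 0 L (fun x => p1 w x ^+ 2 + p2 w x ^+ 2)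
     + I 0 L (fun x => f1 w x ^+ 2 + f2 w x ^+ 2)).
Proof.
move=> L0 [sp1 sp2 sf1 sf2 _ _ av1 av2 _ _ _] au1 au2 e1 e2 e3 e4.
have L0' := ltW L0.
have sv1 := ac_sq L0' av1; have sv2 := ac_sq L0' av2.
have su1 := ac_sq L0' au1; have su2 := ac_sq L0' au2.
have g1 : ac 0 L (fun x => - la * u2 x - v1 w x) (f1 w).
  by apply: ac_eq (acB (acZ (- la) au2) av1) => x _; rewrite /dv1; ring.
have g2 : ac 0 L (fun x => la * u1 x - v2 w x) (f2 w).
  by apply: ac_eq (acB (acZ la au1) av2) => x _; rewrite /dv2; ring.
have G1 : I 0 L (fun x => (- la * u2 x - v1 w x) ^+ 2) <= L ^+ 2 * I 0 L (fun x => f1 w x ^+ 2).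
  by apply: (poincare L0 g1); rewrite e2 e3 mulr0 subrr.
have G2 : I 0 L (fun x => (la * u1 x - v2 w x) ^+ 2) <= L ^+ 2 * I 0 L (fun x => f2 w x ^+ 2).
  by apply: (poincare L0 g2); rewrite e1 e4 mulr0 subrr.
have U1 := poincare L0 au1 e1; have U2 := poincare L0 au2 e2.
rewrite [X in la ^+ 2 * X]ID; itg_tac; rewrite [X in _ + X]ID; itg_tac.
have sg1 := ac_sq L0' g1; have sg2 := ac_sq L0' g2.
apply: (@le_trans _ _ (2 * la ^+ 2 * (I 0 L (fun x => u1 x ^+ 2) + I 0 L (fun x => u2 x ^+ 2))
  + 2 * (I 0 L (fun x => (- la * u2 x - v1 w x) ^+ 2) + I 0 L (fun x => (la * u1 x - v2 w x) ^+ 2)))).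
  rewrite -!ID; itg_tac; rewrite -!IZ; itg_tac; rewrite -!ID; itg_tac.
  apply: I_le; itg_tac.
  move=> x _; have := sqr_ge0 (v1 w x + 2 * la * u2 x).
  have := sqr_ge0 (v2 w x - 2 * la * u1 x).
  by clear; lra.
have l2 : 0 <= 2 * la ^+ 2 by pos.
have := ler_wpM2l l2 U1; have := ler_wpM2l l2 U2; move: G1 G2; clear; lra.
Qed.

(** Tests the equation with the displacement: the integral of [(S . u)'] is zero, which trades
    [a |p|^2] for [S' . u] and [ka v' . p]. The bound [ka ^+ 2 <= k0 * ka] lets the damping part be
    paid by the dissipation. *)
Lemma strain_bound (L a la k0 kc : R) ka k o1 o2 w (u1 u2 : R -> R) :
  0 < L -> 0 < a ->
  wave 0 L a la ka k o1 o2 w -> sq 0 L o1 -> sq 0 L o2 ->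
  (forall g, sq 0 L g -> sq 0 L (fun x => ka x * g x)) ->
  (forall g, sq 0 L g -> sq 0 L (fun x => k x * g x)) ->
  (forall x, k x ^+ 2 <= kc) ->
  (forall x, ka x ^+ 2 <= k0 * ka x) ->
  ac 0 L u1 (p1 w) -> ac 0 L u2 (p2 w) ->
  u1 0 = 0 -> u2 0 = 0 -> u1 L = 0 -> u2 L = 0 ->
  a / 2 * I 0 L (fun x => p1 w x ^+ 2 + p2 w x ^+ 2) <=
  k0 / a * I 0 L (fun x => ka x * (dv1 la w x ^+ 2 + dv2 la w x ^+ 2))
  + 12 * L ^+ 2 / a * (la ^+ 2 * I 0 L (fun x => v1 w x ^+ 2 + v2 w x ^+ 2)
     + I 0 L (fun x => h1 w x ^+ 2 + h2 w x ^+ 2)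
     + kc * I 0 L (fun x => o1 x ^+ 2 + o2 x ^+ 2)).
Proof.
move=> L0 a0 [sp1 sp2 sf1 sf2 sh1 sh2 av1 av2 aS1 aS2 hS] so1 so2 hka hk kkc kk0 au1 au2 e1 e2 e3 e4.
have L0' := ltW L0.
have sv1 := ac_sq L0' av1; have sv2 := ac_sq L0' av2.
have sS1 := ac_sq L0' aS1; have sS2 := ac_sq L0' aS2.
have su1 := ac_sq L0' au1; have su2 := ac_sq L0' au2.
have sd1 : sq 0 L (dv1 la w) := av1.1.
have sd2 : sq 0 L (dv2 la w) := av2.1.
have ko1 := hk _ so1; have ko2 := hk _ so2.
have kd1 := hka _ sd1; have kd2 := hka _ sd2.
have Z := ac_incr (acD (acM L0' aS1 au1) (acM L0' aS2 au2)) (lexx _) L0' (lexx _).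
rewrite e1 e2 e3 e4 !mulr0 !addr0 add0r in Z.
set G := fun x : R => _ in Z.
have iG : itg 0 L G by rewrite /G; itg_tac.
have iA : itg 0 L (fun x => ka x * (dv1 la w x ^+ 2 + dv2 la w x ^+ 2)).
  have : itg 0 L (fun x => ka x * dv1 la w x * dv1 la w x + ka x * dv2 la w x * dv2 la w x).
    by itg_tac.
  by apply: itg_eq => x _; ring.
have U1 := poincare L0 au1 e1; have U2 := poincare L0 au2 e2.
pose J := fun x => p1 w x ^+ 2 + p2 w x ^+ 2.
have iJ : itg 0 L J by rewrite /J; itg_tac.
(* By Poincare's inequality [s |u|^2] integrates to at most [a / 4] times the strain. The damping
   term takes another [a / 4], so [a / 2] remains; [12 L^2 / a] is [3 / s], the 3 coming from
   squaring the three terms of [S']. *)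
pose s := a / (4 * L ^+ 2).
have s0 : 0 < s by rewrite /s; pos.
have ia0 : 0 < a^-1 by pos.
have is0 : 0 < s^-1 by pos.
pose Q := fun x => la ^+ 2 * (v1 w x ^+ 2 + v2 w x ^+ 2) + (h1 w x ^+ 2 + h2 w x ^+ 2)
  + kc * (o1 x ^+ 2 + o2 x ^+ 2).
have iQ : itg 0 L Q by rewrite /Q; itg_tac.
have iU : itg 0 L (fun x => u1 x ^+ 2 + u2 x ^+ 2) by itg_tac.
have H : I 0 L (fun x => a * J x) <= I 0 L (fun x => (a / 4) * J x +
    k0 / a * (ka x * (dv1 la w x ^+ 2 + dv2 la w x ^+ 2)) +
    (s * (u1 x ^+ 2 + u2 x ^+ 2) + 3 * s^-1 * Q x) + G x).
  apply: I_le_ae; [exact: itgZ|by itg_tac|].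
  apply: (aeS hS) => x hx xi; have [E1 E2] := hx xi.
  rewrite /G E1 E2.
  set D1 := dv1 la w x; set D2 := dv2 la w x.
  set T1 := - la * _ - _ + _; set T2 := la * _ - _ + _.
  have n1 : 0 <= a^-1 * ((a * p1 w x / 2 + ka x * D1) ^+ 2 + (a * p2 w x / 2 + ka x * D2) ^+ 2).
    by pos.
  have n2 : 0 <= s^-1 * ((s * u1 x + T1 / 2) ^+ 2 + (s * u2 x + T2 / 2) ^+ 2) by pos.
  have E3 : s^-1 * ((s * u1 x + T1 / 2) ^+ 2 + (s * u2 x + T2 / 2) ^+ 2) =
    s * (u1 x ^+ 2 + u2 x ^+ 2) + (T1 * u1 x + T2 * u2 x) + s^-1 / 4 * (T1 ^+ 2 + T2 ^+ 2).
    by field; rewrite lt0r_neq0.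
  have E4 : a^-1 * ((a * p1 w x / 2 + ka x * D1) ^+ 2 + (a * p2 w x / 2 + ka x * D2) ^+ 2) =
    a / 4 * J x + ka x * (p1 w x * D1 + p2 w x * D2) + a^-1 * (ka x ^+ 2 * (D1 ^+ 2 + D2 ^+ 2)).
    by rewrite /J; field; rewrite lt0r_neq0.
  have dd : 0 <= D1 ^+ 2 + D2 ^+ 2 by pos.
  have E5 := ler_wpM2l (ltW ia0) (ler_wpM2r dd (kk0 x)).
  have TQ : T1 ^+ 2 + T2 ^+ 2 <= 3 * Q x.
    have oo : 0 <= o1 x ^+ 2 + o2 x ^+ 2 by pos.
    have := ler_wpM2r oo (kkc x).
    rewrite /T1 /T2 /Q.
    have := sqr_ge0 (la * v2 w x - h1 w x); have := sqr_ge0 (la * v2 w x + k x * o1 x).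
    have := sqr_ge0 (h1 w x + k x * o1 x).
    have := sqr_ge0 (la * v1 w x + h2 w x); have := sqr_ge0 (la * v1 w x - k x * o2 x).
    have := sqr_ge0 (h2 w x + k x * o2 x).
    by clear; lra.
  have T0 : 0 <= T1 ^+ 2 + T2 ^+ 2 by pos.
  have E6 := ler_wpM2l (ltW is0) TQ.
  have E7 : 0 <= s^-1 * (T1 ^+ 2 + T2 ^+ 2) by pos.
  move: n1 n2; rewrite E3 E4; move: E5 E6 E7; rewrite /J; clear; lra.
have SU : s * I 0 L (fun x => u1 x ^+ 2 + u2 x ^+ 2) <= a / 4 * I 0 L J.
  have : I 0 L (fun x => u1 x ^+ 2 + u2 x ^+ 2) <= L ^+ 2 * I 0 L J.
    by rewrite /J !ID; itg_tac; move: U1 U2; clear; lra.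
  move=> /(ler_wpM2l (ltW s0)) h; apply: (le_trans h); rewrite mulrA.
  have -> : s * L ^+ 2 = a / 4; last by [].
  by rewrite /s; field; rewrite lt0r_neq0.
have i1 := itgZ (a / 4) iJ; have i2 := itgZ (k0 / a) iA.
have i3 := itgZ s iU; have i4 := itgZ (3 * s^-1) iQ.
move: H; rewrite (ID (itgD (itgD i1 i2) (itgD i3 i4)) iG).
rewrite (ID (itgD i1 i2) (itgD i3 i4)) (ID i1 i2) (ID i3 i4).
rewrite (IZ _ iJ) (IZ _ iJ) (IZ _ iA) (IZ _ iU) (IZ _ iQ).
have -> : I 0 L G = 0 by exact: esym Z.
have -> : I 0 L Q = la ^+ 2 * I 0 L (fun x => v1 w x ^+ 2 + v2 w x ^+ 2)
     + I 0 L (fun x => h1 w x ^+ 2 + h2 w x ^+ 2)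
     + kc * I 0 L (fun x => o1 x ^+ 2 + o2 x ^+ 2).
  by rewrite /Q -!IZ; itg_tac; rewrite -!ID; itg_tac.
have -> : 3 * s^-1 = 12 * L ^+ 2 / a.
  by rewrite /s; field; rewrite !lt0r_neq0.
rewrite -/J; move: SU; set W := 12 * _ / _ * _; clear; lra.
Qed.

End Resolvent.

(** * Low frequencies, and the union of both frequency ranges *)

Section ResolventEstimate.
Context {R : realType}.
Implicit Types (al be x y : R).
Local Notation mu := (@lebesgue_measure R).

Lemma local_coef_IE (L k al be : R) g : 0 <= al -> al <= be -> be <= L ->
  itg 0 L (fun x => local_coef k al be x * g x) ->
  I 0 L (fun x => local_coef k al be x * g x) = k * I al be g.
Proof.
move=> h1 h2 h3 ikg.
have Z l r : l <= r -> (r <= al) || (be <= l) -> I l r (fun x => local_coef k al be x * g x) = 0.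
  move=> lr h; have := Icst (0 : R) lr; rewrite mul0r => <-; apply: I_eq => x.
  rewrite in_itv/= => /andP[x1 x2]; rewrite local_coef_out ?mul0r//.
  by case/orP: h => h; [rewrite (ltW (lt_le_trans x2 h))|rewrite (ltW (le_lt_trans h x1)) orbT].
rewrite (I_split h1 (le_trans h2 h3) ikg) (I_split h2 h3); last exact: itgS ikg.
rewrite (Z 0 al) ?lexx// (Z be L) ?lexx ?orbT// add0r addr0.
have [->|k0] := eqVneq k 0.
  rewrite mul0r -[RHS](mul0r (be - al)) -Icst//; apply: I_eq => x _.
  by rewrite /local_coef !mul0r.
rewrite -IZ; first by apply: I_eq => x /local_coef_in ->.
have := itgZ k^-1 (itgS h1 h3 ikg).
by apply: itg_eq => x /local_coef_in ->; rewrite mulKf.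
Qed.

Record displacement (L : R) (w : wdata) (u1 u2 : R -> R) : Prop := Displacement {
  dp_1 : ac 0 L u1 (p1 w); dp_2 : ac 0 L u2 (p2 w);
  dp_bc : [/\ u1 0 = 0, u2 0 = 0, u1 L = 0 & u2 L = 0] }.

Lemma local_coef_sqr (k al be x : R) :
  local_coef k al be x ^+ 2 = k * local_coef k al be x.
Proof.
rewrite /local_coef indicE; case: (x \in _); rewrite ?mulr1 ?expr2//.
by rewrite !mulr0.
Qed.

(** [velocity_bound] estimates the velocities by [la ^+ 2] times the strains, [strain_bound]
    estimates the strains by the velocities, each up to sources and dissipation. For small [la] the
    loop closes. Both waves are summed, because each strain bound contains the other velocity. *)
Lemma low_frequency (L a b0 b1 b2 c0 c1 c2 d0 d1 d2 : R) :
  0 < L -> 0 < a -> 0 < b0 -> 0 < d0 ->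
  [&& 0 < b1, b1 < b2, b2 < c1, c1 < c2, c2 < d1, d1 < d2 & d2 < L] ->
  exists la0 K : R, [/\ 0 < la0, 0 < K &
  forall la X wu wy (u1 u2 y1 y2 : R -> R), `|la| <= la0 ->
  wsystem L a (local_coef b0 b1 b2) (local_coef c0 c1 c2) (local_coef d0 d1 d2) la wu wy ->
  displacement L wu u1 u2 -> displacement L wy y1 y2 ->
  Nsrc L a wu wy <= X ->
  I b1 b2 (fun x => dv1 la wu x ^+ 2 + dv2 la wu x ^+ 2) <= X ->
  I d1 d2 (fun x => dv1 la wy x ^+ 2 + dv2 la wy x ^+ 2) <= X ->
  Etot L a wu wy <= K * X].
Proof.
move=> L0 a0 b00 d00 /and5P[r1 r2 r3 r4 /and3P[r5 r6 r7]].
have ia0 : 0 < a^-1 by pos.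
pose Au := 12 * L ^+ 2 / a; pose Ay := 12 * L ^+ 2 / 1.
have Au0 : 0 < Au by rewrite /Au; pos.
have Ay0 : 0 < Ay by rewrite /Ay; pos.
have c20 : 0 <= c0 ^+ 2 by pos.
(* [B] is the factor of [la ^+ 2] produced by one turn of the loop and [be] the coercivity of both
   strain bounds. The threshold [be / (2 B)] makes the loop cost at most [be / 2]; being also at
   most 1, it ensures [la ^+ 2 <= |la|]. *)
pose B := 2 * L ^+ 2 * (1 + c0 ^+ 2) * (Au + Ay).
have B0 : 0 < B by rewrite /B; apply: mulr_gt0; [apply: mulr_gt0; [pos|rewrite ltr_wpDr]|pos].
pose be := Num.min a 1 / 2.
have be0 : 0 < be by rewrite /be divr_gt0// lt_min a0 ltr01.
have bea : be <= a / 2 by rewrite /be ler_wpM2r ?invr_ge0// ge_min lexx.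
have be1 : be <= 1 / 2 by rewrite /be ler_wpM2r ?invr_ge0// ge_min lexx orbT.
pose K1 := b0 / a * b0 + d0 / 1 * d0 + B + Au * (1 + a) + Ay * (1 + 1).
have K10 : 0 < K1 by rewrite /K1; pos.
pose KP := 2 / be * K1; have KP0 : 0 < KP by rewrite /KP; pos.
exists (Num.min 1 (be / (2 * B))), (2 * L ^+ 2 * (KP + 2) + (a + 1) * KP); split.
- by rewrite lt_min ltr01/=; pos.
- by pos.
move=> la X wu wy u1 u2 y1 y2 hla [Wu Wy ubc ybc] [au1 au2 [ue1 ue2 ue3 ue4]].
move=> [ay1 ay2 [ye1 ye2 ye3 ye4]] hN hDu hDy.
have L0' := ltW L0.
have la1 : la ^+ 2 <= 1 /\ la ^+ 2 * B <= be / 2.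
  move: hla; rewrite le_min => /andP[h1 h2].
  have h3 : la ^+ 2 <= `|la|.
    by rewrite -real_normK ?num_real// expr2 ler_piMr.
  split; first exact: le_trans h1.
  have h4 := le_trans h3 h2.
  have := ler_wpM2r (ltW B0) h4.
  have -> : be / (2 * B) * B = be / 2 by field; rewrite lt0r_neq0.
  by [].
case: la1 => la1 laB.
have [up1 up2 uf1 uf2 uh1 uh2 uv1 uv2 uS1 uS2 _] := Wu.
have [yp1 yp2 yf1 yf2 yh1 yh2 yv1 yv2 yS1 yS2 _] := Wy.
have suv1 := ac_sq L0' uv1; have suv2 := ac_sq L0' uv2.
have syv1 := ac_sq L0' yv1; have syv2 := ac_sq L0' yv2.
have ud1 : sq 0 L (dv1 la wu) := uv1.1.
have ud2 : sq 0 L (dv2 la wu) := uv2.1.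
have yd1 : sq 0 L (dv1 la wy) := yv1.1.
have yd2 : sq 0 L (dv2 la wy) := yv2.1.
have lc k al be' g : sq 0 L g -> sq 0 L (fun x => local_coef k al be' x * g x).
  exact: local_coef_sqM.
have lcN k al be' g : sq 0 L g -> sq 0 L (fun x => - local_coef k al be' x * g x).
  by move=> /(lc k al be') /sqN; under eq_fun do rewrite -mulNr.
case: ubc => ub1 ub2 ub3 ub4; case: ybc => yb1 yb2 yb3 yb4.
have kcb x : local_coef c0 c1 c2 x ^+ 2 <= c0 ^+ 2.
  rewrite /local_coef indicE; case: (x \in _); rewrite ?mulr1// mulr0 expr0n//=.
have Vu := velocity_bound L0 Wu au1 au2 ue1 ue2 ub1 ub2.
have Vy := velocity_bound L0 Wy ay1 ay2 ye1 ye2 yb1 yb2.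
have Pu := @strain_bound _ L a la b0 (c0 ^+ 2) _ _ _ _ wu u1 u2 L0 a0 Wu syv1 syv2 (lc _ _ _) (lc _ _ _) kcb _ au1 au2 ue1 ue2 ue3 ue4.
have Py := @strain_bound _ L 1 la d0 (c0 ^+ 2) _ _ _ _ wy y1 y2 L0 ltr01 Wy suv1 suv2 (lc _ _ _) (lcN _ _ _) _ _ ay1 ay2 ye1 ye2 ye3 ye4.
have isd k al be' g1 g2 : sq 0 L g1 -> sq 0 L g2 ->
    itg 0 L (fun x => local_coef k al be' x * (g1 x ^+ 2 + g2 x ^+ 2)).
  move=> s1 s2; have l1 := lc k al be' _ s1; have l2 := lc k al be' _ s2.
  have : itg 0 L (fun x => local_coef k al be' x * g1 x * g1 x + local_coef k al be' x * g2 x * g2 x).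
    by itg_tac.
  by apply: itg_eq => x _; ring.
have B1 : 0 <= b1 /\ b2 <= L by move: r1 r2 r3 r4 r5 r6 r7; clear => *; split; lra.
have D1 : 0 <= d1 /\ d2 <= L by move: r1 r2 r3 r4 r5 r6 r7; clear => *; split; lra.
move: Pu; rewrite (local_coef_IE B1.1 (ltW r2) B1.2 (isd _ _ _ _ _ ud1 ud2)) => Pu.
move: Py; rewrite (local_coef_IE D1.1 (ltW r6) D1.2 (isd _ _ _ _ _ yd1 yd2)) => Py.
have {}Pu := Pu (fun x => eq_ind_r (fun z => z <= _) (lexx _) (local_coef_sqr b0 b1 b2 x)).
have {}Py := Py (fun x => eq_ind_r (fun z => z <= _) (kcb x) (sqrrN (local_coef c0 c1 c2 x)))
  (fun x => eq_ind_r (fun z => z <= _) (lexx _) (local_coef_sqr d0 d1 d2 x)).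
have iNu := src_itg a uf1 uf2 uh1 uh2; have iNy := src_itg 1 yf1 yf2 yh1 yh2.
have Nu0 : 0 <= I 0 L (src a wu) by apply: I_ge0 => t _; rewrite /src; pos.
have Ny0 : 0 <= I 0 L (src 1 wy) by apply: I_ge0 => t _; rewrite /src; pos.
rewrite /Nsrc ID// in hN.
have hNu : I 0 L (src a wu) <= X by move: hN Ny0; clear; lra.
have hNy : I 0 L (src 1 wy) <= X by move: hN Nu0; clear; lra.
have X0 : 0 <= X by exact: le_trans hNu.
have subs (a' : R) w : 0 < a' ->
    sq 0 L (f1 w) -> sq 0 L (f2 w) -> sq 0 L (h1 w) -> sq 0 L (h2 w) ->
    I 0 L (src a' w) <= X ->
    I 0 L (fun x => f1 w x ^+ 2 + f2 w x ^+ 2) <= X /\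
    I 0 L (fun x => h1 w x ^+ 2 + h2 w x ^+ 2) <= (1 + a') * X.
  move=> a'0 s1 s2 s3 s4 hX; have iw := src_itg a' s1 s2 s3 s4.
  have ia' : 0 < a'^-1 by pos.
  split.
    apply: le_trans hX; apply: I_le => //; first by itg_tac.
    by move=> x _; rewrite /src lerDl; pos.
  apply: (@le_trans _ _ ((1 + a') * I 0 L (src a' w))).
    rewrite -IZ//; apply: I_le; itg_tac.
    move=> x _; rewrite /src.
    have -> : (1 + a') * (f1 w x ^+ 2 + f2 w x ^+ 2 + (h1 w x ^+ 2 + h2 w x ^+ 2) / a') =
      (1 + a') * (f1 w x ^+ 2 + f2 w x ^+ 2) + (h1 w x ^+ 2 + h2 w x ^+ 2) / a'
      + (h1 w x ^+ 2 + h2 w x ^+ 2) by field; rewrite lt0r_neq0.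
    by rewrite lerDr; pos.
  by apply: ler_wpM2l => //; pos.
have [Fu Hu] := subs a wu a0 uf1 uf2 uh1 uh2 hNu.
have [Fy Hy] := subs 1 wy ltr01 yf1 yf2 yh1 yh2 hNy.
have iEu := ent_itg L0' Wu; have iEy := ent_itg L0' Wy.
have EE (a' : R) w : sq 0 L (v1 w) -> sq 0 L (v2 w) -> sq 0 L (p1 w) -> sq 0 L (p2 w) ->
    I 0 L (ent a' w) = I 0 L (fun x => v1 w x ^+ 2 + v2 w x ^+ 2)
     + a' * I 0 L (fun x => p1 w x ^+ 2 + p2 w x ^+ 2).
  by move=> s1 s2 s3 s4; rewrite /ent -IZ; itg_tac; rewrite -ID; itg_tac.
rewrite /Etot ID// (EE a wu)// (EE 1 wy)//.
move: Vu Vy Pu Py Fu Hu Fy Hy hDu hDy; rewrite -/Au -/Ay.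
set IVu := I 0 L (fun x => v1 wu x ^+ 2 + v2 wu x ^+ 2).
set IVy := I 0 L (fun x => v1 wy x ^+ 2 + v2 wy x ^+ 2).
set IPu := I 0 L (fun x => p1 wu x ^+ 2 + p2 wu x ^+ 2).
set IPy := I 0 L (fun x => p1 wy x ^+ 2 + p2 wy x ^+ 2).
set IFu := I 0 L (fun x => f1 wu x ^+ 2 + f2 wu x ^+ 2).
set IFy := I 0 L (fun x => f1 wy x ^+ 2 + f2 wy x ^+ 2).
set IHu := I 0 L (fun x => h1 wu x ^+ 2 + h2 wu x ^+ 2).
set IHy := I 0 L (fun x => h1 wy x ^+ 2 + h2 wy x ^+ 2).
set Du := I b1 b2 _; set Dy := I d1 d2 _.
have IVu0 : 0 <= IVu by apply: I_ge0 => t _; pos.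
have IVy0 : 0 <= IVy by apply: I_ge0 => t _; pos.
have IPu0 : 0 <= IPu by apply: I_ge0 => t _; pos.
have IPy0 : 0 <= IPy by apply: I_ge0 => t _; pos.
move=> Vu Vy Pu Py Fu Hu Fy Hy hDu hDy.
have L2 : 0 <= 2 * L ^+ 2 by pos.
have V1 : IVu <= 2 * L ^+ 2 * (la ^+ 2 * IPu + X).
  by apply: (le_trans Vu); apply: ler_wpM2l => //; rewrite lerD2l.
have V2 : IVy <= 2 * L ^+ 2 * (la ^+ 2 * IPy + X).
  by apply: (le_trans Vy); apply: ler_wpM2l => //; rewrite lerD2l.
have lV1 : la ^+ 2 * IVu <= IVu by rewrite ler_piMl.
have lV2 : la ^+ 2 * IVy <= IVy by rewrite ler_piMl.
have kb0 : 0 <= b0 / a * b0 by pos.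
have kd0 : 0 <= d0 / 1 * d0 by pos.
have P1 : a / 2 * IPu <= b0 / a * b0 * X + Au * (IVu + (1 + a) * X + c0 ^+ 2 * IVy).
  apply: (le_trans Pu); apply: lerD; first by rewrite mulrA ler_wpM2l.
  apply: ler_wpM2l; [exact: ltW|move: lV1 Hu; clear; lra].
have P2 : 1 / 2 * IPy <= d0 / 1 * d0 * X + Ay * (IVy + (1 + 1) * X + c0 ^+ 2 * IVu).
  apply: (le_trans Py); apply: lerD; first by rewrite mulrA ler_wpM2l.
  apply: ler_wpM2l; [exact: ltW|move: lV2 Hy; clear; lra].
have VV : IVu + c0 ^+ 2 * IVy <= 2 * L ^+ 2 * (1 + c0 ^+ 2) * (la ^+ 2 * (IPu + IPy) + X).
  have q1 : 0 <= 2 * L ^+ 2 * (la ^+ 2 * IPy) by pos.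
  have q2 : 0 <= c0 ^+ 2 * (2 * L ^+ 2) * (la ^+ 2 * IPu) by pos.
  have := ler_wpM2l c20 V2; move: V1 q1 q2; clear; lra.
have VV' : IVy + c0 ^+ 2 * IVu <= 2 * L ^+ 2 * (1 + c0 ^+ 2) * (la ^+ 2 * (IPu + IPy) + X).
  have q1 : 0 <= 2 * L ^+ 2 * (la ^+ 2 * IPu) by pos.
  have q2 : 0 <= c0 ^+ 2 * (2 * L ^+ 2) * (la ^+ 2 * IPy) by pos.
  have := ler_wpM2l c20 V1; move: V2 q1 q2; clear; lra.
have PP : be * (IPu + IPy) <= K1 * X + la ^+ 2 * B * (IPu + IPy).
  have := ler_wpM2l (ltW Au0) VV; have := ler_wpM2l (ltW Ay0) VV'.
  have := ler_wpM2r IPu0 bea; have := ler_wpM2r IPy0 be1.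
  rewrite /K1 /B; move: P1 P2; clear; lra.
have PS0 : 0 <= IPu + IPy by pos.
have PP2 : IPu + IPy <= KP * X.
  have : be / 2 * (IPu + IPy) <= K1 * X.
    by have := ler_wpM2r PS0 laB; move: PP; clear; lra.
  have ib : 0 <= 2 / be by pos.
  move=> /(ler_wpM2l ib).
  have -> : 2 / be * (be / 2 * (IPu + IPy)) = IPu + IPy by field; rewrite lt0r_neq0.
  by rewrite /KP mulrA.
have lP1 : la ^+ 2 * IPu <= IPu by rewrite ler_piMl.
have lP2 : la ^+ 2 * IPy <= IPy by rewrite ler_piMl.
have VT : IVu + IVy <= 2 * L ^+ 2 * (IPu + IPy + 2 * X).
  have s : la ^+ 2 * IPu + X + (la ^+ 2 * IPy + X) <= IPu + IPy + 2 * X.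
    by move: lP1 lP2; clear; lra.
  have := ler_wpM2l L2 s; move: V1 V2; clear; lra.
have AT : a * IPu + 1 * IPy <= (a + 1) * (IPu + IPy).
  have : 0 <= a * IPy by pos.
  by move: IPu0; clear; lra.
have e1 := ler_wpM2l L2 PP2.
have a10 : 0 <= a + 1 by pos.
have e2 := ler_wpM2l a10 PP2.
by move: VT AT e1 e2; clear; lra.
Qed.

(** The weight [t = 1 / (2 k be)] turns the energy hidden in the dissipation into [E / 2]. The price
    is the square of [k]: with [k] proportional to [sqrt |la|] the final factor is [|la|]. *)
Lemma absorb (k be g E N : R) : 0 < k -> 0 < be -> 0 <= N ->
  (forall t, 0 < t -> E <= k * (N + be * (t * E + t^-1 * (g * N)))) ->
  E <= (2 * k + 4 * k ^+ 2 * be ^+ 2 * g) * N.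
Proof.
move=> k0 b0 N0 h.
have t0 : 0 < (2 * k * be)^-1 by pos.
have := h _ t0; rewrite invrK.
have -> : k * (N + be * ((2 * k * be)^-1 * E + 2 * k * be * (g * N))) =
  k * N + E / 2 + 2 * k ^+ 2 * be ^+ 2 * g * N.
  by field; rewrite !lt0r_neq0.
by clear; lra.
Qed.

(** The threshold [la0] of the low-frequency bound is fixed first and the high-frequency bound is
    then taken with [mu0 = sqrt la0], so that the two ranges cover the whole axis. *)
Lemma wave_resolvent_estimate (L a b0 b1 b2 c0 c1 c2 d0 d1 d2 : R) :
  0 < L -> 0 < a -> 0 < b0 -> 0 < d0 ->
  [&& 0 < b1, b1 < b2, b2 < c1, c1 < c2, c2 < d1, d1 < d2 & d2 < L] ->
  `|c0| * (c2 - c1) < Num.sqrt a -> `|c0| * (c2 - c1) < 1 ->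
  exists2 K : R, 0 < K & forall la wu wy (u1 u2 y1 y2 : R -> R),
  wsystem L a (local_coef b0 b1 b2) (local_coef c0 c1 c2) (local_coef d0 d1 d2) la wu wy ->
  displacement L wu u1 u2 -> displacement L wy y1 y2 ->
  Etot L a wu wy <= K * (1 + `|la|) * Nsrc L a wu wy.
Proof.
move=> L0 a0 b00 d00 hord hc1 hc2.
have [la0 [Kl [la00 Kl0 HL]]] := low_frequency c0 L0 a0 b00 d00 hord.
pose m0 := Num.sqrt la0; have m00 : 0 < m0 by rewrite sqrtr_gt0.
have [Kh Kh0 HH] := high_frequency L0 a0 b00 d00 hord hc1 hc2 m00.
pose g := b0^-1 + d0^-1; have g0 : 0 < g by rewrite /g; pos.
pose Q k := 2 * k + 4 * k ^+ 2 * g ^+ 2 * (1 + a).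
have Q0 k : 0 < k -> 0 < Q k by move=> ?; rewrite /Q; pos.
have a10 : 0 < 1 + a by pos.
exists (Q Kl + Q Kh); first by have := Q0 _ Kl0; have := Q0 _ Kh0; clear; lra.
move=> la wu wy u1 u2 y1 y2 W Du Dy.
have [Wu Wy _ _] := W.
have [_ _ uf1 uf2 uh1 uh2 _ _ _ _ _] := Wu.
have [_ _ yf1 yf2 yh1 yh2 _ _ _ _ _] := Wy.
have N0 : 0 <= Nsrc L a wu wy by apply: I_ge0 => t _; rewrite /src; pos.
have E0 : 0 <= Etot L a wu wy by apply: I_ge0 => t _; rewrite /ent; pos.
set N := Nsrc L a wu wy in N0 *; set E := Etot L a wu wy in E0 *.
pose X t := N + g * (t * E + t^-1 * ((1 + a) * N)).
have HX t : 0 < t -> [/\ N <= X t,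
    I b1 b2 (fun x => dv1 la wu x ^+ 2 + dv2 la wu x ^+ 2) <= X t &
    I d1 d2 (fun x => dv1 la wy x ^+ 2 + dv2 la wy x ^+ 2) <= X t].
  move=> t0; have := dissipation L0 a0 b00 d00 t0 hord W; rewrite -/N -/E.
  set D1 := I b1 b2 _; set D2 := I d1 d2 _; set T := t * E + _ => H.
  have D10 : 0 <= D1 by apply: I_ge0 => x _; pos.
  have D20 : 0 <= D2 by apply: I_ge0 => x _; pos.
  have T0 : 0 <= T by rewrite /T; pos.
  have gb : 0 < b0^-1 by pos.
  have gd : 0 < d0^-1 by pos.
  have h1 : D1 <= g * T.
    have h : b0 * D1 <= T.
      have q : 0 <= d0 * D2 by pos.
      by move: H q; clear; lra.
    have := ler_wpM2l (ltW gb) h; rewrite mulKf ?lt0r_neq0// => h'.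
    have : 0 <= d0^-1 * T by pos.
    by move: h'; rewrite /g; clear; lra.
  have h2 : D2 <= g * T.
    have h : d0 * D2 <= T.
      have q : 0 <= b0 * D1 by pos.
      by move: H q; clear; lra.
    have := ler_wpM2l (ltW gd) h; rewrite mulKf ?lt0r_neq0// => h'.
    have : 0 <= b0^-1 * T by pos.
    by move: h'; rewrite /g; clear; lra.
  have gT : 0 <= g * T by pos.
  by rewrite /X -/T; move: N0 h1 h2 gT; clear => *; split; lra.
have [h|h] := leP `|la| la0.
  have H : E <= Q Kl * N.
    apply: absorb => // t /HX[x1 x2 x3]; exact: HL la (X t) wu wy _ _ _ _ h W Du Dy x1 x2 x3.
  apply: (le_trans H); apply: ler_wpM2r => //.
  have := Q0 _ Kl0; have := Q0 _ Kh0; have := normr_ge0 la; clear => l q1 q2.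
  have : 0 <= (Q Kl + Q Kh) * `|la| by apply: mulr_ge0 => //; lra.
  lra.
pose m := Num.sqrt `|la|.
have m2 : `|la| = m ^+ 2 by rewrite sqr_sqrtr.
have mm : m0 <= m by rewrite ler_wsqrtr// ltW.
have mp : 0 < m by exact: lt_le_trans mm.
have H : E <= Q (Kh * m) * N.
  apply: absorb => // [|t /HX[x1 x2 x3]]; first by pos.
  exact: HH la m (X t) wu wy mm m2 W x1 x2 x3.
apply: (le_trans H); apply: ler_wpM2r => //.
rewrite m2 /Q.
have mq : m <= 1 + m ^+ 2.
  by have := sqr_ge0 (m - 1); have := sqr_ge0 m; clear; lra.
have n1 := ler_wpM2l (ltW Kh0) mq.
have n2 : 0 <= 4 * Kh ^+ 2 * g ^+ 2 * (1 + a) by pos.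
have n3 := ltW (Q0 _ Kl0); rewrite /Q in n3.
have n4 : 0 <= (2 * Kl + 4 * Kl ^+ 2 * g ^+ 2 * (1 + a)) * m ^+ 2 by pos.
by move: n1 n2 n3 n4; clear; lra.
Qed.

End ResolventEstimate.

(** * Discrete Fourier transform *)

Section RootsOfUnity.
Local Open Scope complex_scope.
Context {R : realType}.

Lemma sqmodM (z w : R[i]) : sqmod (z * w) = sqmod z * sqmod w.
Proof. by case: z => a b; case: w => c d; rewrite /sqmod /=; ring. Qed.

Lemma sqmod_ge0 (z : R[i]) : 0 <= sqmod z.
Proof. by rewrite /sqmod; pos. Qed.

Lemma sqmodX (z : R[i]) n : sqmod (z ^+ n) = sqmod z ^+ n.
Proof.
elim: n => [|n IH]; last by rewrite !exprS sqmodM IH.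
by rewrite !expr0 /sqmod /= expr1n expr0n addr0.
Qed.

Lemma sqmod1_conj (z : R[i]) : sqmod z = 1 -> z * conjc z = 1.
Proof.
case: z => a b; rewrite /sqmod /= => h; apply/eqP; rewrite eq_complex /=.
by apply/andP; split; apply/eqP; [rewrite -h|]; ring.
Qed.

(** Iterated square roots of -1: an algebraic primitive root of unity of order [2 ^ m.+1]. *)
Definition root2 m : R[i] := iter m (@sqrtc R) (-1).

Lemma root2E m : root2 m ^+ (2 ^ m) = -1.
Proof.
elim: m => [|m IH]; first by rewrite expn0 expr1.
by rewrite expnS exprM /= sqr_sqrtc IH.
Qed.

Lemma root2_sqmod m : sqmod (root2 m) = 1.
Proof.
have := congr1 sqmod (root2E m); rewrite sqmodX.
have -> : sqmod (-1 : R[i]) = 1 by rewrite /sqmod /= oppr0 sqrrN expr1n expr0n addr0.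
move/eqP; rewrite pexpr_eq1 ?sqmod_ge0// ?expn_gt0// => /eqP //.
Qed.

(** If the power were 1, so would be the power with exponent the gcd of [k] and [2 ^ m.+1]. As
    [k < 2 ^ m.+1], this gcd is [2 ^ e] with [e <= m], contradicting that the power [2 ^ m] is
    -1. *)
Lemma root2_neq1 m k : (0 < k)%N -> (k < 2 ^ m.+1)%N -> root2 m ^+ k != 1.
Proof.
move=> k0 kN; apply/eqP => h.
have gN : root2 m ^+ (2 ^ m.+1) = 1 by rewrite expnS mulnC exprM root2E sqrrN expr1n.
have : root2 m ^+ gcdn k (2 ^ m.+1) = 1.
  case: (egcdnP (2 ^ m.+1) k0) => u v e _.
  have : root2 m ^+ (u * k) = root2 m ^+ (v * 2 ^ m.+1 + gcdn k (2 ^ m.+1)) by rewrite e.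
  by rewrite exprD ![(_ * k)%N]mulnC [(v * _)%N]mulnC !exprM h gN !expr1n mul1r => <-.
have /dvdn_pfactor : (gcdn k (2 ^ m.+1) %| 2 ^ m.+1)%N by exact: dvdn_gcdr.
case=> // e em ge.
have em' : (e <= m)%N.
  rewrite leqNgt; apply/negP => me.
  have eE : e = m.+1 by apply/eqP; rewrite eqn_leq em me.
  have := dvdn_leq k0 (dvdn_gcdl k (2 ^ m.+1)); rewrite ge eE.
  by rewrite leqNgt kN.
rewrite ge => g1; have := root2E m.
rewrite -(subnKC em') expnD exprM subnKC// g1 expr1n => /eqP.
by rewrite -subr_eq0 opprK -[1 + 1]/(2%:R) pnatr_eq0.
Qed.

Lemma geometric_orthogonality m (a b : nat) : (a < 2 ^ m.+1)%N -> (b < 2 ^ m.+1)%N ->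
  \sum_(j < 2 ^ m.+1) (root2 m ^+ j) ^+ a * conjc ((root2 m ^+ j) ^+ b) =
  if a == b then (2 ^ m.+1)%:R else 0.
Proof.
set z : R[i] := root2 m; set N := (2 ^ m.+1)%N => aN bN.
have zN : z ^+ N = 1 by rewrite /N expnS mulnC exprM root2E sqrrN expr1n.
have zc k : sqmod (z ^+ k) = 1 by rewrite sqmodX root2_sqmod expr1n.
have E (j : 'I_N) : (z ^+ j) ^+ a * conjc ((z ^+ j) ^+ b) = (z ^+ a * conjc (z ^+ b)) ^+ j.
  by rewrite exprMn -!exprM ![(_ * j)%N]mulnC !exprM -[conjc _ ^+ j]rmorphXn -!exprM [(b * j)%N]mulnC.
rewrite (eq_bigr _ (fun j _ => E j)); set w := z ^+ a * _.
have zz : z ^+ b * conjc (z ^+ b) = 1 by exact: sqmod1_conj.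
have inj c e : (c < e)%N -> (e < N)%N -> z ^+ c != z ^+ e.
  move=> ce eN; apply/eqP => h.
  have /negP[] := @root2_neq1 m (e - c)%N (etrans (subn_gt0 _ _) ce) (leq_ltn_trans (leq_subr _ _) eN).
  have z0 : z ^+ c != 0.
    apply/eqP => z0; have := zc c; rewrite z0 /sqmod /= expr0n addr0 => /eqP.
    by rewrite eq_sym oner_eq0.
  by apply/eqP; apply: (mulfI z0); rewrite mulr1 -exprD subnKC ?h// ltnW.
have [ab|ab] := eqVneq a b.
  have -> : w = 1 by rewrite /w ab.
  under eq_bigr do rewrite expr1n.
  by rewrite sumr_const card_ord.
have w1 : w - 1 != 0.
  rewrite subr_eq0; apply/eqP => w1.
  have h : z ^+ a = z ^+ b.
    by have := congr1 (fun t => t * z ^+ b) w1; rewrite /w mul1r -mulrA [conjc _ * _]mulrC zz mulr1.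
  by case: (ltngtP a b) ab => // [l|l] _; [have := inj _ _ l bN|have := inj _ _ l aN]; rewrite h eqxx.
apply: (mulfI w1); rewrite mulr0 -subrX1 /w exprMn -!exprM mulnC exprM zN expr1n mul1r.
by rewrite -rmorphXn -exprM mulnC exprM zN expr1n rmorph1 subrr.
Qed.

End RootsOfUnity.

(** * Semidefinite Hermitian forms and the Parseval identity *)

Section SemiInner.
Local Open Scope complex_scope.
Context {R : realType} {X : lmodType R[i]}.
Local Notation Re := (@complex.Re R).
Implicit Types (x y w : X).

(* H is a linear subspace of X on which ip is a positive semidefinite
   Hermitian form; null vectors are allowed. *)
Record semi_inner (H : X -> Prop) (ip : X -> X -> R[i]) : Prop := SemiInner {
  si_0 : H 0;
  si_lin : forall k x y, H x -> H y -> H (k *: x + y);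
  si_linl : forall k x y w, H x -> H y -> H w ->
    ip (k *: x + y) w = k * ip x w + ip y w;
  si_conj : forall x y, H x -> H y -> ip y x = conjc (ip x y);
  si_ge0 : forall x, H x -> 0 <= Re (ip x x) }.

Definition qf (ip : X -> X -> R[i]) x : R := Re (ip x x).
Definition nm ip x : R := Num.sqrt (qf ip x).

Context (H : X -> Prop) (ip : X -> X -> R[i]).
Hypothesis SI : semi_inner H ip.
Local Notation q := (qf ip).
Local Notation nrm := (nm ip).

Lemma si_D x y : H x -> H y -> H (x + y).
Proof. by move=> hx hy; rewrite -[x]scale1r; exact: (si_lin SI). Qed.

Lemma si_Z k x : H x -> H (k *: x).
Proof. by move=> hx; rewrite -[k *: x]addr0; apply: (si_lin SI) => //; exact: si_0 SI. Qed.

Lemma si_N x : H x -> H (- x).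
Proof. by move=> hx; rewrite -scaleN1r; exact: si_Z. Qed.

Lemma si_B x y : H x -> H y -> H (x - y).
Proof. by move=> hx /si_N; exact: si_D. Qed.

Lemma si_sum N (f : 'I_N -> X) : (forall i, H (f i)) -> H (\sum_i f i).
Proof. by move=> hf; apply: big_ind => //; [exact: si_0 SI|exact: si_D]. Qed.

Lemma ip_D x y w : H x -> H y -> H w -> ip (x + y) w = ip x w + ip y w.
Proof. by move=> hx hy hw; rewrite -[x in LHS]scale1r (si_linl SI)// mul1r. Qed.

Lemma ip_0 w : H w -> ip 0 w = 0.
Proof.
move=> hw; have h0 := si_0 SI; have := ip_D h0 h0 hw; rewrite addr0 => /eqP.
by rewrite -subr_eq0 opprD addNKr oppr_eq0 => /eqP.
Qed.

Lemma ip_Z k x w : H x -> H w -> ip (k *: x) w = k * ip x w.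
Proof.
move=> hx hw; rewrite -[k *: x]addr0 (si_linl SI)//; last exact: si_0 SI.
by rewrite ip_0// addr0.
Qed.

Lemma ip_Dr x y w : H x -> H y -> H w -> ip w (x + y) = ip w x + ip w y.
Proof.
move=> hx hy hw; rewrite (si_conj SI (si_D hx hy) hw) ip_D// rmorphD /=.
by rewrite -!(si_conj SI).
Qed.

Lemma ip_Zr k x w : H x -> H w -> ip w (k *: x) = conjc k * ip w x.
Proof.
move=> hx hw; rewrite (si_conj SI (si_Z k hx) hw) ip_Z// rmorphM /=.
by rewrite -!(si_conj SI).
Qed.

Lemma q_ge0 x : H x -> 0 <= q x.
Proof. exact: (si_ge0 SI). Qed.

Lemma qZ k x : H x -> q (k *: x) = sqmod k * q x.
Proof.
move=> hx; rewrite /qf ip_Z ?ip_Zr//; last exact: si_Z.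
by rewrite mulrA; case: k => a b; case: (ip x x) => c d; rewrite /sqmod /=; ring.
Qed.

Lemma qD x y : H x -> H y -> q (x + y) = q x + q y + 2 * Re (ip x y).
Proof.
move=> hx hy; rewrite /qf ip_D ?ip_Dr//; last exact: si_D.
rewrite (si_conj SI hx hy); case: (ip x y) => a b.
by case: (ip x x) => c d; case: (ip y y) => e f /=; ring.
Qed.

Lemma sqmodR (t : R) : sqmod (t%:C : R[i]) = t ^+ 2.
Proof. by rewrite /sqmod /= expr0n addr0. Qed.

(** Nonnegativity of [q (s x - y)], divided by [s]. *)
Lemma qD_young x y (s : R) : H x -> H y -> 0 < s -> 
  q (x + y) <= (1 + s) * q x + (1 + s^-1) * q y.
Proof.
move=> hx hy s0; have hsx : H (s%:C *: x) by exact: si_Z.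
have hny : H (-1 *: y) by exact: si_Z.
have := q_ge0 (si_D hsx hny); rewrite qD// !qZ// ip_Z// ip_Zr//.
rewrite sqmodR qD//.
have -> : sqmod (-1 : R[i]) = 1 by rewrite /sqmod /= oppr0 sqrrN expr1n expr0n addr0.
case: (ip x y) => a b /=; rewrite mul1r oppr0 => h.
have is0 : 0 <= s^-1 by rewrite invr_ge0 ltW.
have ss : s^-1 * s = 1 by rewrite mulVf// lt0r_neq0.
have := mulr_ge0 is0 h.
have -> : s^-1 * (s ^+ 2 * q x + q y + 2 * (s * (- 1 * a - - 0 * b) - 0 * (- 1 * b + - 0 * a))) =
  (s^-1 * s) * (s * q x - 2 * a) + s^-1 * q y by ring.
rewrite ss; lra.
Qed.

Lemma nrm_ge0 x : 0 <= nrm x. Proof. exact: sqrtr_ge0. Qed.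

Lemma nrm2 x : H x -> nrm x ^+ 2 = q x.
Proof. by move=> /q_ge0; exact: sqr_sqrtr. Qed.

Lemma nrmZ k x : H x -> nrm (k *: x) = Num.sqrt (sqmod k) * nrm x.
Proof. by move=> hx; rewrite /nm qZ// sqrtrM// sqmod_ge0. Qed.

Lemma nrmZR (t : R) x : H x -> nrm (t%:C *: x) = `|t| * nrm x.
Proof. by move=> hx; rewrite nrmZ// sqmodR sqrtr_sqr. Qed.

(** The best weight in [qD_young] is the quotient of the two seminorms, which may be 0/0 for null
    vectors. Both are shifted by [d], which costs [d (A + B)]. *)
Lemma nrmD x y : H x -> H y -> nrm (x + y) <= nrm x + nrm y.
Proof.
move=> hx hy; have a0 := nrm_ge0 x; have b0 := nrm_ge0 y.
have hxy := si_D hx hy.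
rewrite -(ler_pXn2r (n := 2)) ?nnegrE ?nrm_ge0 ?addr_ge0// nrm2//.
apply/ler_addgt0Pr => e e0.
pose A := nrm x; pose B := nrm y.
(* Small enough for [d (A + B) <= e]. *)
pose d := e / (2 * (A + B + 1) + e).
have A0 : 0 <= A by []. have B0 : 0 <= B by [].
have AB : 0 < A + B + 1 by rewrite /A /B; move: a0 b0; clear; lra.
have den : 0 < 2 * (A + B + 1) + e by pos.
have d0 : 0 < d by rewrite /d; pos.
have s0 : 0 < (B + d) / (A + d).
  by apply: divr_gt0; apply: ltr_wpDl.
apply: (le_trans (qD_young hx hy s0)).
rewrite -!nrm2// -/A -/B.
have Ad : 0 < A + d by exact: ltr_wpDl.
have Bd : 0 < B + d by exact: ltr_wpDl.
have h1 : (B + d) / (A + d) * A ^+ 2 <= (B + d) * A.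
  have -> : (B + d) / (A + d) * A ^+ 2 = (B + d) * A * (A / (A + d)).
    by field; rewrite lt0r_neq0.
  apply: ler_piMr; first by pos.
  by rewrite ler_pdivrMr// mul1r lerDl ltW.
have h2 : ((B + d) / (A + d))^-1 * B ^+ 2 <= (A + d) * B.
  have -> : ((B + d) / (A + d))^-1 * B ^+ 2 = (A + d) * B * (B / (B + d)).
    by field; rewrite !lt0r_neq0.
  apply: ler_piMr; first by pos.
  by rewrite ler_pdivrMr// mul1r lerDl ltW.
have h3 : d * (A + B) <= e.
  have : d * (2 * (A + B + 1) + e) = e by rewrite /d divfK// lt0r_neq0.
  have : 0 <= d * (A + B + 2 + e) by pos.
  by clear; lra.
by move: h1 h2 h3; clear; lra.
Qed.

Lemma nrmN x : H x -> nrm (- x) = nrm x.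
Proof.
move=> hx; rewrite -scaleN1r nrmZ//.
have -> : sqmod (-1 : R[i]) = 1 by rewrite /sqmod /= oppr0 sqrrN expr1n expr0n addr0.
by rewrite sqrtr1 mul1r.
Qed.

Lemma nrmB x y : H x -> H y -> nrm (x - y) <= nrm x + nrm y.
Proof. by move=> hx hy; rewrite -(nrmN hy); apply: nrmD => //; exact: si_N. Qed.

Lemma nrmBC x y : H x -> H y -> nrm (x - y) = nrm (y - x).
Proof. by move=> hx hy; rewrite -[RHS]nrmN ?opprB//; exact: si_B. Qed.

Lemma nrm0 : nrm 0 = 0.
Proof. by rewrite /nm /qf ip_0 ?sqrtr0//; exact: si_0 SI. Qed.

Definition eqv x y := nrm (x - y) = 0.

Lemma eqv_refl x : eqv x x. Proof. by rewrite /eqv subrr nrm0. Qed.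

Lemma eqv_sym x y : H x -> H y -> eqv x y -> eqv y x.
Proof. by move=> hx hy; rewrite /eqv nrmBC. Qed.

Lemma eqv_nrm_le x y : H x -> H y -> eqv x y -> nrm x <= nrm y.
Proof.
move=> hx hy e; rewrite -[x](subrK y); apply: le_trans (nrmD _ hy) _.
  exact: si_B.
by rewrite e add0r.
Qed.

Lemma eqv_nrm x y : H x -> H y -> eqv x y -> nrm x = nrm y.
Proof.
move=> hx hy e; apply/le_anti; rewrite !eqv_nrm_le//; exact: eqv_sym.
Qed.

Lemma nrm_le0 x : nrm x <= 0 -> nrm x = 0.
Proof. by move=> h; apply/le_anti; rewrite h nrm_ge0. Qed.

Lemma eqv_trans y x w : H x -> H y -> H w -> eqv x y -> eqv y w -> eqv x w.
Proof.
move=> hx hy hw e1 e2; apply: nrm_le0.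
have -> : x - w = (x - y) + (y - w) by rewrite addrA subrK.
by apply: le_trans (nrmD _ _) _; [exact: si_B|exact: si_B|rewrite e1 e2 addr0].
Qed.

Lemma eqvD x x' y y' : H x -> H x' -> H y -> H y' ->
  eqv x x' -> eqv y y' -> eqv (x + y) (x' + y').
Proof.
move=> h1 h2 h3 h4 e1 e2; apply: nrm_le0.
rewrite opprD addrACA; apply: le_trans (nrmD _ _) _; try exact: si_B.
by rewrite e1 e2 addr0.
Qed.

Lemma eqvZ k x x' : H x -> H x' -> eqv x x' -> eqv (k *: x) (k *: x').
Proof.
by move=> h1 h2 e; rewrite /eqv -scalerBr nrmZ ?e ?mulr0//; exact: si_B.
Qed.

Lemma eqvN x x' : H x -> H x' -> eqv x x' -> eqv (- x) (- x').
Proof. by move=> h1 h2; rewrite -[- x]scaleN1r -[- x']scaleN1r; exact: eqvZ. Qed.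

Lemma eqvB x x' y y' : H x -> H x' -> H y -> H y' ->
  eqv x x' -> eqv y y' -> eqv (x - y) (x' - y').
Proof.
by move=> h1 h2 h3 h4 e1 e2; apply: eqvD => //; [exact: si_N|exact: si_N|exact: eqvN].
Qed.

Lemma eqv_q x y : H x -> H y -> eqv x y -> q x = q y.
Proof. by move=> hx hy e; rewrite -!nrm2// (eqv_nrm hx hy e). Qed.

Lemma eqv_sum N (f g : 'I_N -> X) : (forall i, H (f i)) -> (forall i, H (g i)) ->
  (forall i, eqv (f i) (g i)) -> eqv (\sum_i f i) (\sum_i g i).
Proof.
move=> hf hg e.
have : H (\sum_i f i) /\ H (\sum_i g i) /\ eqv (\sum_i f i) (\sum_i g i); last by case=> _ [].
apply: (big_ind2 (fun a b => H a /\ H b /\ eqv a b)) => //.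
- by split; [|split; last exact: eqv_refl]; exact: si_0 SI.
- move=> x1 x2 y1 y2 [h1 [h2 h3]] [h4 [h5 h6]].
  by split; [exact: si_D|split; [exact: si_D|exact: eqvD]].
Qed.

Definition dft m (f : nat -> X) (j : 'I_(2 ^ m.+1)) : X :=
  \sum_(k < 2 ^ m.+1) (root2 m ^+ j) ^+ k *: f k.

Lemma dft_H m (f : nat -> X) j : (forall k : nat, H (f k)) -> H (@dft m f j).
Proof. by move=> hf; apply: si_sum => k; exact: si_Z. Qed.

Lemma ip_suml N (f : 'I_N -> X) w : (forall i, H (f i)) -> H w ->
  ip (\sum_i f i) w = \sum_i ip (f i) w.
Proof.
move=> hf hw.
have : H (\sum_i f i) /\ ip (\sum_i f i) w = \sum_i ip (f i) w; last by case.
apply: (big_ind2 (fun a b => H a /\ ip a w = b)) => //.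
- by split; [exact: si_0 SI|rewrite ip_0].
- by move=> x1 x2 y1 y2 [h1 <-] [h2 <-]; split; [exact: si_D|rewrite ip_D].
Qed.

Lemma ip_sumr N (f : 'I_N -> X) w : (forall i, H (f i)) -> H w ->
  ip w (\sum_i f i) = \sum_i ip w (f i).
Proof.
move=> hf hw; rewrite (si_conj SI (si_sum hf) hw) ip_suml// rmorph_sum /=.
by apply: eq_bigr => i _; rewrite -(si_conj SI).
Qed.

Lemma Re_sum N (f : 'I_N -> R[i]) : Re (\sum_i f i) = \sum_i Re (f i).
Proof.
apply: (big_ind2 (fun a b => Re a = b)) => //.
by move=> [a b] y1 [c d] y2 /= <- <-.
Qed.

Lemma parseval m (f : nat -> X) : (forall k : nat, H (f k)) ->
  \sum_j q (@dft m f j) = (2 ^ m.+1)%:R * \sum_(k < 2 ^ m.+1) q (f k).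
Proof.
pose N := (2 ^ m.+1)%N; move=> hf; pose z : R[i] := root2 m.
have hz (j k : 'I_N) : H ((z ^+ j) ^+ k *: f k) by exact: si_Z.
rewrite /qf -!Re_sum -/N.
have E (j : 'I_N) : ip (@dft m f j) (@dft m f j) =
    \sum_(k < N) \sum_(l < N) ((z ^+ j) ^+ k * conjc ((z ^+ j) ^+ l)) * ip (f k) (f l).
  rewrite /dft ip_suml//; last exact: (si_sum (f := fun k : 'I_N => (z ^+ j) ^+ k *: f k)).
  apply: eq_bigr => k _; rewrite ip_sumr//.
  by apply: eq_bigr => l _; rewrite ip_Z// ip_Zr// mulrA.
have -> : \sum_j ip (@dft m f j) (@dft m f j) = N%:R * \sum_(k < N) ip (f k) (f k).
  rewrite (eq_bigr _ (fun j _ => E j)) exchange_big mulr_sumr /=.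
  apply: eq_bigr => k _; rewrite exchange_big /= (bigD1 k)//= [X in _ + X]big1 ?addr0.
    by rewrite -mulr_suml geometric_orthogonality// eqxx.
  move=> l; rewrite eq_sym => /negPf kl; rewrite -mulr_suml geometric_orthogonality//.
  by move: kl; rewrite -val_eqE /= => ->; rewrite mul0r.
have -> : (N%:R : R[i]) = (N%:R : R)%:C by rewrite rmorph_nat.
have ReM (t : R) (u : R[i]) : Re (t%:C * u) = t * Re u by case: u => u v /=; rewrite mul0r subr0.
by rewrite ReM.
Qed.

(** The shift is not cyclic: [f 0] leaves the sum and [f (2 ^ m.+1)] enters it, so both have to
    vanish. *)
Lemma dft_shift m (f : nat -> X) (j : 'I_(2 ^ m.+1)) : f 0%N = 0 -> f (2 ^ m.+1)%N = 0 ->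
  root2 m ^+ j *: @dft m (fun k => f k.+1) j = @dft m f j.
Proof.
move=> f0 fN; rewrite /dft scaler_sumr.
set N := (2 ^ m.+1)%N in fN *; set z : R[i] := root2 m ^+ j.
have : \sum_(k < N.+1) z ^+ k *: f k = \sum_(k < N) z ^+ k *: f k.
  by rewrite big_ord_recr /= fN scaler0 addr0.
move=> <-; rewrite big_ord_recl /= f0 scaler0 add0r; apply: eq_bigr => k _.
by rewrite scalerA -exprS.
Qed.

Lemma dftB m (f g : nat -> X) j :
  @dft m (fun k => f k - g k) j = @dft m f j - @dft m g j.
Proof. by rewrite /dft -sumrB; apply: eq_bigr => k _; rewrite scalerBr. Qed.

Lemma dftD m (f g : nat -> X) j :
  @dft m (fun k => f k + g k) j = @dft m f j + @dft m g j.
Proof. by rewrite /dft -big_split; apply: eq_bigr => k _; rewrite scalerDr. Qed.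

Lemma dftZ m c (f : nat -> X) j : @dft m (fun k => c *: f k) j = c *: @dft m f j.
Proof.
by rewrite /dft scaler_sumr; apply: eq_bigr => k _; rewrite !scalerA mulrC.
Qed.

(* The central difference becomes multiplication by i la with la real. *)
Lemma dft_central m (h : R) (f : nat -> X) (j : 'I_(2 ^ m.+1)) :
  f 0%N = 0 -> f 1%N = 0 -> f (2 ^ m.+1)%N = 0 -> f (2 ^ m.+1).+1 = 0 ->
  root2 m ^+ j *: @dft m (fun k => ((2 * h)^-1)%:C *: (f k.+2 - f k)) j =
  (Complex 0 (- complex.Im (root2 m ^+ j) / h)) *: @dft m f j.
Proof.
move=> f0 f1 fN fN1; rewrite dftZ dftB scalerA; set z : R[i] := root2 m ^+ j.
have zz : z * conjc z = 1 by rewrite sqmod1_conj// sqmodX root2_sqmod expr1n.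
have sh (g : nat -> X) : g 0%N = 0 -> g (2 ^ m.+1)%N = 0 ->
    @dft m (fun k => g k.+1) j = conjc z *: @dft m g j.
  by move=> g0 gN; rewrite -(dft_shift j g0 gN) -/z scalerA [X in X *: _]mulrC zz scale1r.
rewrite (sh (fun k => f k.+1))// (sh f)// scalerBr !scalerA -scalerBl; congr (_ *: _).
set c := ((2 * h)^-1)%:C.
transitivity (c * ((z * conjc z) * conjc z - z)); first by ring.
rewrite zz mul1r /c; case: z {zz sh} => u v; apply/eqP.
rewrite eq_complex /= invfM; apply/andP; split; apply/eqP; first by ring.
by move: (h^-1) => k; lra.
Qed.

End SemiInner.

Lemma double_norm_young (R : realType) (l s : R) : 0 < s ->
  2 * `|l| <= s + s^-1 * l ^+ 2.
Proof.
move=> s0; have ss : s * s^-1 = 1 by rewrite divff// lt0r_neq0.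
have is0 : 0 < s^-1 by pos.
have -> : l ^+ 2 = `|l| ^+ 2 by rewrite real_normK ?num_real.
have : 0 <= s^-1 * (s - `|l|) ^+ 2 by pos.
have -> : s^-1 * (s - `|l|) ^+ 2 = (s * s^-1) * (s - 2 * `|l|) + s^-1 * `|l| ^+ 2 by ring.
by rewrite ss; lra.
Qed.

(** * The resolvent bound applied frequency by frequency *)

Section DiscreteEstimate.
Local Open Scope complex_scope.
Context {R : realType} {X : lmodType R[i]}.
Context (H : X -> Prop) (ip : X -> X -> R[i]) (SI : semi_inner H ip).
Context (D : X -> Prop) (A : X -> X).
Local Notation q := (qf ip).
Local Notation nrm := (nm ip).
Local Notation eqv := (eqv ip).

(** Linearity of [A] holds modulo null vectors only: the concrete operator involves weak derivatives
    chosen separately for each function. *)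
Record domain_linear : Prop := DomainLinear {
  dl_H : forall x, D x -> H x;
  dl_A : forall x, D x -> H (A x);
  dl_0 : D 0;
  dl_lin : forall k x y, D x -> D y -> D (k *: x + y);
  dl_Alin : forall k x y, D x -> D y -> eqv (A (k *: x + y)) (k *: A x + A y) }.

Context (DL : domain_linear).

Lemma A0 : eqv (A 0) 0.
Proof.
have d0 := dl_0 DL; have h0 := dl_A DL d0; have z0 := si_0 SI.
have := dl_Alin DL 1 d0 d0; rewrite !scale1r addr0 => e.
have := eqvD SI h0 (si_D SI h0 h0) (si_N SI h0) (si_N SI h0) e (eqv_refl SI _).
by rewrite subrr addrK => /(eqv_sym SI z0 h0).
Qed.

Lemma dl_Z k x : D x -> D (k *: x) /\ eqv (A (k *: x)) (k *: A x).
Proof.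
move=> dx; have d0 := dl_0 DL.
rewrite -[k *: x]addr0; split; first exact: (dl_lin DL).
have := dl_Alin DL k dx d0; move=> e.
have hA := dl_A DL dx; have hA0 := dl_A DL d0; have hk := si_Z SI k hA.
apply: (eqv_trans SI (y := k *: A x + A 0)) => //.
- by apply: (dl_A DL); exact: (dl_lin DL).
- exact: (si_D SI).
- rewrite -[X in eqv _ X](addr0 (k *: A x)).
  by apply: (eqvD SI) => //; [exact: si_0 SI|exact: (eqv_refl SI)|exact: A0].
Qed.

Lemma dl_sum N (f : 'I_N -> X) : (forall i, D (f i)) ->
  D (\sum_i f i) /\ eqv (A (\sum_i f i)) (\sum_i A (f i)).
Proof.
move=> df.
have : D (\sum_i f i) /\ H (\sum_i A (f i)) /\ eqv (A (\sum_i f i)) (\sum_i A (f i)); last by case=> ? [].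
apply: (big_ind2 (fun a b => D a /\ H b /\ eqv (A a) b)) => //.
- by split; [exact: (dl_0 DL)|split; [exact: si_0 SI|exact: A0]].
- move=> x1 x2 y1 y2 [h1 [h2 h3]] [h4 [h5 h6]].
  have dd : D (x1 + y1) by rewrite -[x1]scale1r; exact: (dl_lin DL).
  split=> //; split; first exact: (si_D SI).
  have := dl_Alin DL 1 h1 h4; rewrite !scale1r => e.
  have a1 := dl_A DL h1; have a2 := dl_A DL h4.
  have hs := si_D SI a1 a2; have hxy := si_D SI h2 h5.
  exact: (eqv_trans SI (dl_A DL dd) hs hxy e (eqvD SI a1 h2 a2 h5 h3 h6)).
- by move=> i _; split=> //; split; [exact: (dl_A DL)|exact: (eqv_refl SI)].
Qed.

Context (K : R) (K0 : 0 < K).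
Context (RES : forall la x, D x ->
  q x <= K * (1 + `|la|) * q (Complex 0 la *: x - A x)).

(** Above the cutoff [Lam], [x] is dominated by [i la x], that is, by a time derivative. Below it
    the resolvent bound applies: for the discretization error [F2] the factor [|la|] is replaced by
    [Lam], and for the true source [F1] it is split by [2 |la| <= s + s^-1 la^2], which keeps [Lam]
    away from [F1]. *)
Lemma frequency_estimate (la Lam s : R) x F1 F2 : 0 < Lam -> 0 < s ->
  D x -> H F1 -> H F2 -> eqv (Complex 0 la *: x - A x) (F1 + F2) ->
  q x <= Lam^-1 ^+ 2 * q (Complex 0 la *: x)
    + (2 + s) * K * q F1 + K * s^-1 * q (Complex 0 la *: F1)
    + 4 * K * (1 + Lam) * q F2.
Proof.
move=> L0 s0 dx h1 h2 e; have hx := dl_H DL dx.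
have sq (t : R) : sqmod (Complex 0 t) = t ^+ 2 by rewrite /sqmod /= expr0n add0r.
rewrite (qZ SI _ hx) (qZ SI _ h1) !sq.
have q0 := q_ge0 SI hx; have q1 := q_ge0 SI h1; have q2 := q_ge0 SI h2.
have is0 : 0 < s^-1 by pos.
have iL0 : 0 < Lam^-1 by pos.
have [hL|hL] := leP Lam `|la|.
  have h : q x <= Lam^-1 ^+ 2 * (la ^+ 2 * q x).
    rewrite mulrA ler_peMl// -[la ^+ 2]real_normK ?num_real// -exprMn.
    by rewrite exprn_ege1// mulrC -[_ * _]/(_ / _) ler_pdivlMr// mul1r.
  apply: (le_trans h); rewrite -!addrA lerDl; pos.
have hr : H (Complex 0 la *: x - A x).
  by apply: (si_B SI); [exact: (si_Z SI)|exact: (dl_A DL)].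
have y2 := RES la dx; rewrite (eqv_q SI hr (si_D SI h1 h2) e) in y2.
have := qD_young SI h1 h2 ltr01; rewrite invr1 => y1.
have KL : 0 <= K * (1 + `|la|) by pos.
have := ler_wpM2l KL y1 => y3; apply: (le_trans y2); apply: (le_trans y3).
have l2 := double_norm_young la s0.
have t1 := ler_wpM2l (mulr_ge0 (ltW K0) q1) l2.
have t2 := ler_wpM2l (mulr_ge0 (ltW K0) q2) (ltW hL).
have t3 : 0 <= Lam^-1 ^+ 2 * (la ^+ 2 * q x) by pos.
have t4 : 0 <= K * q F2 by pos.
have t5 : 0 <= K * q F2 * Lam by pos.
have t6 : 0 <= K * (s * q F1) by pos.
have t7 : 0 <= K * (s^-1 * (la ^+ 2 * q F1)) by pos.
by move: t1 t2 t3 t4 t5 t6 t7; lra.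
Qed.

Lemma discrete_estimate m (h Lam s : R) (g w F1 F2 : nat -> X) :
  0 < Lam -> 0 < s ->
  (forall k, D (g k)) -> (forall k, H (w k)) -> (forall k, eqv (A (g k)) (w k)) ->
  (forall k, H (F1 k)) -> (forall k, H (F2 k)) ->
  g 0%N = 0 -> g 1%N = 0 -> g (2 ^ m.+1)%N = 0 -> g (2 ^ m.+1).+1 = 0 ->
  w 0%N = 0 -> w (2 ^ m.+1)%N = 0 ->
  F1 0%N = 0 -> F1 1%N = 0 -> F1 (2 ^ m.+1)%N = 0 -> F1 (2 ^ m.+1).+1 = 0 ->
  (forall k, ((2 * h)^-1)%:C *: (g k.+2 - g k) - w k.+1 = F1 k + F2 k) ->
  \sum_(k < 2 ^ m.+1) q (g k) <=
    Lam^-1 ^+ 2 * \sum_(k < 2 ^ m.+1) q (((2 * h)^-1)%:C *: (g k.+2 - g k))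
    + (2 + s) * K * \sum_(k < 2 ^ m.+1) q (F1 k)
    + K * s^-1 * \sum_(k < 2 ^ m.+1) q (((2 * h)^-1)%:C *: (F1 k.+2 - F1 k))
    + 4 * K * (1 + Lam) * \sum_(k < 2 ^ m.+1) q (F2 k).
Proof.
move=> L0 s0 dg hw ew hF1 hF2 g0 g1 gN gN1 w0 wN f0 f1 fN fN1 E.
have hg k : H (g k) := dl_H DL (dg k).
pose dif (f : nat -> X) k := ((2 * h)^-1)%:C *: (f k.+2 - f k).
have hdif f : (forall k, H (f k)) -> forall k, H (dif f k).
  by move=> hf k; apply: (si_Z SI); exact: (si_B SI).
have N0 : 0 < (2 ^ m.+1)%:R :> R by rewrite ltr0n expn_gt0.
rewrite -(ler_pM2l N0) !mulrDr ![(2 ^ m.+1)%:R * (_ * \sum_(k < _) _)]mulrCA.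
rewrite -(parseval SI m hg) -(parseval SI m (hdif g hg)) -(parseval SI m hF1).
rewrite -(parseval SI m (hdif F1 hF1)) -(parseval SI m hF2).
rewrite !mulr_sumr -!big_split /=; apply: ler_sum => j _.
pose z : R[i] := root2 m ^+ j.
have zq x : H x -> q (z *: x) = q x.
  by move=> hx; rewrite (qZ SI _ hx) /z sqmodX root2_sqmod expr1n mul1r.
pose la := - complex.Im z / h.
have dD : D (dft g j) /\ eqv (A (dft g j)) (dft w j).
  have hs (k : 'I_(2 ^ m.+1)) : D ((z ^+ k) *: g k) by exact: (dl_Z _ (dg k)).1.
  have [h1 h2] := dl_sum hs; split => //.
  have hh i : H (A (z ^+ i *: g i)) by apply: (dl_A DL); exact: (dl_Z _ (dg i)).1.
  have hz (i : nat) : H (z ^+ i *: w i) by exact: (si_Z SI).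
  apply: (eqv_trans SI (dl_A DL h1) _ _ h2).
  - by apply: (si_sum SI) => i; exact: hh.
  - by apply: (si_sum SI) => i; exact: hz.
  - apply: (eqv_sum SI) => // i.
    have hAg := dl_A DL (dg i); have hzA := si_Z SI (z ^+ i) hAg.
    by apply: (eqv_trans SI (hh i) hzA (hz i) (dl_Z _ (dg i)).2); apply: (eqvZ SI).
case: dD => dD eD.
have hdg := dft_H SI j hg; have hdw := dft_H SI j hw.
have hd1 := dft_H SI j hF1; have hd2 := dft_H SI j hF2.
have c1 : z *: @dft R X m (dif g) j = Complex 0 la *: dft g j by exact: dft_central.
have c2 : z *: @dft R X m (dif F1) j = Complex 0 la *: dft F1 j by exact: dft_central.
have q1 : q (dft (dif g) j) = q (Complex 0 la *: dft g j).
  by rewrite -c1 zq//; exact: (dft_H SI _ (hdif g hg)).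
have q2 : q (dft (dif F1) j) = q (Complex 0 la *: (z *: dft F1 j)).
  rewrite scalerA mulrC -scalerA -c2 !zq//; first exact: (dft_H SI _ (hdif F1 hF1)).
  by apply: (si_Z SI); exact: (dft_H SI _ (hdif F1 hF1)).
(* The difference [g k.+2 - g k] and [w k.+1] are both centred at [k + 1]; multiplication by [z]
   moves them to the transforms of [g] and [w]. *)
have e : eqv (Complex 0 la *: dft g j - A (dft g j)) (z *: dft F1 j + z *: dft F2 j).
  have -> : z *: dft F1 j + z *: dft F2 j = Complex 0 la *: dft g j - dft w j.
    rewrite -scalerDr -dftD -c1 -(dft_shift j w0 wN) -/z -scalerBr -dftB.
    by congr (_ *: _); apply: eq_bigr => k _; rewrite E.
  have hA := dl_A DL dD; have hl := si_Z SI (Complex 0 la) hdg.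
  exact: (eqvB SI hl hl hA hdw (eqv_refl SI _) eD).
have := frequency_estimate L0 s0 dD (si_Z SI z hd1) (si_Z SI z hd2) e.
by rewrite (zq _ hd1) (zq _ hd2) -q1 -q2 mulrDr.
Qed.

End DiscreteEstimate.

(** * Polynomial decay of contraction semigroups *)

Section Spline.
Local Open Scope complex_scope.
Context {R : realType}.
Implicit Types s t d : R.

Definition sqpos t : R := Num.max 0 t ^+ 2.
Definition dsqpos t : R := 2 * Num.max 0 t.

(* Quadratic B-spline supported in [1, 4], and its derivative. *)
Definition spline s : R :=
  sqpos (s - 1) - 3 * sqpos (s - 2) + 3 * sqpos (s - 3) - sqpos (s - 4).
Definition dspline s : R :=
  dsqpos (s - 1) - 3 * dsqpos (s - 2) + 3 * dsqpos (s - 3) - dsqpos (s - 4).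

Lemma sqpos_taylor t d : `|sqpos (t + d) - sqpos t - d * dsqpos t| <= d ^+ 2.
Proof.
rewrite /sqpos /dsqpos ler_norml.
have := sqr_ge0 d; have := sqr_ge0 (t + d); have := sqr_ge0 t.
by case: (leP 0 t) => h1; case: (leP 0 (t + d)) => h2; nra.
Qed.

Lemma dsqpos_lip t d : `|dsqpos (t + d) - dsqpos t| <= 2 * `|d|.
Proof.
have n1 := ler_norm d; have n2 := ler_norm (- d); rewrite normrN in n2.
rewrite /dsqpos; case: (leP 0 t) => h1; case: (leP 0 (t + d)) => h2;
  rewrite ler_norml; lra.
Qed.

(** The constant 8 is [1 + 3 + 3 + 1], the sum of the absolute coefficients; the 16 in [dspline_lip]
    arises in the same way. *)
Lemma spline_taylor s d : `|spline (s + d) - spline s - d * dspline s| <= 8 * d ^+ 2.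
Proof.
rewrite /spline /dspline.
have sh c : s + d - c = s - c + d by rewrite addrAC.
rewrite !sh.
have := sqpos_taylor (s - 1) d; have := sqpos_taylor (s - 2) d.
have := sqpos_taylor (s - 3) d; have := sqpos_taylor (s - 4) d.
rewrite !ler_norml; set a := sqpos _; set b := sqpos _; lra.
Qed.

Lemma dspline_lip s d : `|dspline (s + d) - dspline s| <= 16 * `|d|.
Proof.
rewrite /dspline.
have sh c : s + d - c = s - c + d by rewrite addrAC.
rewrite !sh.
have := dsqpos_lip (s - 1) d; have := dsqpos_lip (s - 2) d.
have := dsqpos_lip (s - 3) d; have := dsqpos_lip (s - 4) d.
rewrite !ler_norml; lra.
Qed.

Lemma sqpos_pos t : 0 <= t -> sqpos t = t ^+ 2 /\ dsqpos t = 2 * t.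
Proof. by move=> h; rewrite /sqpos /dsqpos max_r. Qed.

Lemma sqpos_neg t : t <= 0 -> sqpos t = 0 /\ dsqpos t = 0.
Proof. by move=> h; rewrite /sqpos /dsqpos max_l// expr0n mulr0. Qed.

(** To the left every term is zero; to the right all four are active and form a third difference of
    a quadratic polynomial. *)
Lemma spline_supp s : (s <= 1) || (4 <= s) -> spline s = 0 /\ dspline s = 0.
Proof.
rewrite /spline /dspline => /orP[] h.
  have [-> ->] := @sqpos_neg (s - 1) ltac:(lra).
  have [-> ->] := @sqpos_neg (s - 2) ltac:(lra).
  have [-> ->] := @sqpos_neg (s - 3) ltac:(lra).
  have [-> ->] := @sqpos_neg (s - 4) ltac:(lra).
  by split; ring.
have [-> ->] := @sqpos_pos (s - 1) ltac:(lra).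
have [-> ->] := @sqpos_pos (s - 2) ltac:(lra).
have [-> ->] := @sqpos_pos (s - 3) ltac:(lra).
have [-> ->] := @sqpos_pos (s - 4) ltac:(lra).
by split; ring.
Qed.

Lemma spline_bound s : `|spline s| <= 24 /\ `|dspline s| <= 24.
Proof.
have [h|h] := leP s 1.
  by have /spline_supp[-> ->] : (s <= 1) || (4 <= s); [rewrite h|rewrite normr0].
have [h'|h'] := leP 4 s.
  by have /spline_supp[-> ->] : (s <= 1) || (4 <= s); [rewrite h' orbT|rewrite normr0].
have B c : 1 <= c -> 0 <= sqpos (s - c) <= 9 /\ 0 <= dsqpos (s - c) <= 6.
  move=> c1; rewrite /sqpos /dsqpos; case: (leP 0 (s - c)) => hc; split; apply/andP; split; nra.
have [/andP[a1 a2] /andP[a3 a4]] := B 1 (lexx _).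
rewrite /spline /dspline.
have [-> ->] := @sqpos_neg (s - 4) ltac:(lra).
have [k|k] := leP s 2.
  have [-> ->] := @sqpos_neg (s - 2) ltac:(lra).
  have [-> ->] := @sqpos_neg (s - 3) ltac:(lra).
  by rewrite !ler_norml; split; apply/andP; split; lra.
have [-> ->] := @sqpos_pos (s - 1) ltac:(lra).
have [-> ->] := @sqpos_pos (s - 2) ltac:(lra).
have [k'|k'] := leP s 3.
  have [-> ->] := @sqpos_neg (s - 3) ltac:(lra).
  by rewrite !ler_norml; split; apply/andP; split; nra.
have [-> ->] := @sqpos_pos (s - 3) ltac:(lra).
by rewrite !ler_norml; split; apply/andP; split; nra.
Qed.

Lemma spline_ge1 s : 2 <= s <= 3 -> 1 <= spline s.
Proof.
move=> /andP[h1 h2]; rewrite /spline.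
have [-> _] := @sqpos_pos (s - 1) ltac:(lra).
have [-> _] := @sqpos_pos (s - 2) ltac:(lra).
have [-> _] := @sqpos_neg (s - 3) ltac:(lra).
have [-> _] := @sqpos_neg (s - 4) ltac:(lra).
nra.
Qed.

End Spline.

(** * Contraction semigroups modulo null vectors *)

Section Semigroup.
Local Open Scope complex_scope.
Context {R : realType} {X : lmodType R[i]}.
Context (H : X -> Prop) (ip : X -> X -> R[i]) (SI : semi_inner H ip).
Context (D : X -> Prop) (A : X -> X) (DL : domain_linear H ip D A).
Context (T : R -> X -> X).
Local Notation q := (qf ip).
Local Notation nrm := (nm ip).
Local Notation eqv := (eqv ip).

Record contraction_semigroup : Prop := ContractionSemigroup {
  sg_H : forall t x, 0 <= t -> H x -> H (T t x);
  sg_le : forall t x, 0 <= t -> H x -> nrm (T t x) <= nrm x;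
  sg_lin : forall t k x y, 0 <= t -> H x -> H y ->
    eqv (T t (k *: x + y)) (k *: T t x + T t y);
  sg_0 : forall x, H x -> eqv (T 0 x) x;
  sg_D : forall s t x, 0 <= s -> 0 <= t -> H x -> eqv (T (s + t) x) (T s (T t x));
  sg_cont : forall x, H x -> forall e, 0 < e ->
    exists2 d, 0 < d & forall h, 0 < h < d -> nrm (T h x - x) < e;
  sg_gen : forall x y, H x -> H y ->
    (forall e, 0 < e -> exists2 d, 0 < d & forall h, 0 < h < d ->
       nrm ((h^-1)%:C *: (T h x - x) - y) < e)
    <-> D x /\ eqv (A x) y }.

Context (SG : contraction_semigroup).

Lemma sg_dist t x y : 0 <= t -> H x -> H y -> nrm (T t x - T t y) <= nrm (x - y).
Proof.
move=> t0 hx hy; have hd := si_B SI hx hy.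
apply: le_trans (sg_le SG t0 hd).
have hTx := sg_H SG t0 hx; have hTy := sg_H SG t0 hy.
apply: (eqv_nrm_le SI); [exact: (si_B SI)|exact: (sg_H SG)|].
have := sg_lin SG (-1) t0 hy hx; rewrite !scaleN1r ![- _ + _]addrC => e.
by apply: (eqv_sym SI) e; [exact: (sg_H SG)|exact: (si_B SI)].
Qed.

Lemma sg_comm s t x : 0 <= s -> 0 <= t -> H x -> eqv (T s (T t x)) (T t (T s x)).
Proof.
move=> s0 t0 hx; have h1 := sg_H SG t0 hx; have h2 := sg_H SG s0 hx.
have h3 := sg_H SG s0 h1; have h4 := sg_H SG t0 h2.
have h5 := sg_H SG (addr_ge0 s0 t0) hx.
apply: (eqv_trans SI h3 h5 h4); first exact: (eqv_sym SI h5 h3 (sg_D SG s0 t0 hx)).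
by have := sg_D SG t0 s0 hx; rewrite addrC.
Qed.

Lemma sg_B t x y : 0 <= t -> H x -> H y -> eqv (T t (x - y)) (T t x - T t y).
Proof.
move=> t0 hx hy; have := sg_lin SG (-1) t0 hy hx.
by rewrite !scaleN1r ![- _ + _]addrC.
Qed.

Lemma sg_Z t k x : 0 <= t -> H x -> eqv (T t (k *: x)) (k *: T t x).
Proof.
move=> t0 hx; have h0 := si_0 SI.
have hT0 := sg_H SG t0 h0.
have e0 : eqv (T t 0) 0.
  have := sg_le SG t0 h0; rewrite (nrm0 SI) => h.
  change (nrm (T t 0 - 0) = 0); rewrite subr0; exact: nrm_le0.
have hk := si_Z SI k (sg_H SG t0 hx).
have := sg_lin SG k t0 hx h0; rewrite addr0 => e.
apply: (eqv_trans SI _ _ _ e) => //.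
- by apply: (sg_H SG) => //; exact: (si_Z SI).
- exact: (si_D SI).
- rewrite -[X in eqv _ X](addr0 (k *: T t x)).
  by apply: (eqvD SI) => //; exact: (eqv_refl SI).
Qed.

(** [T t] commutes with the difference quotient modulo null vectors and is a contraction, so
    quotients at [T t x] converge whenever those at [x] do. This is what keeps orbits inside the
    domain. *)
Lemma sg_quotient t h x y : 0 <= t -> 0 <= h -> H x -> H y ->
  nrm ((h^-1)%:C *: (T h (T t x) - T t x) - T t y) <=
  nrm ((h^-1)%:C *: (T h x - x) - y).
Proof.
move=> t0 h0 hx hy.
have hTx := sg_H SG t0 hx; have hhx := sg_H SG h0 hx; have hTy := sg_H SG t0 hy.
have hB := si_B SI hhx hx; have hZ := si_Z SI (h^-1)%:C hB.
have hhT := sg_H SG h0 hTx; have hTh := sg_H SG t0 hhx.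
apply: le_trans (sg_le SG t0 (si_B SI hZ hy)).
have hB' := si_B SI hhT hTx.
apply: (eqv_nrm_le SI); [exact: (si_B SI (si_Z SI _ hB') hTy)|exact: (sg_H SG t0 (si_B SI hZ hy))|].
have hB'' := si_B SI hTh hTx.
have e1 := sg_B t0 hZ hy; have e2 := sg_Z (h^-1)%:C t0 hB; have e3 := sg_B t0 hhx hx.
have hTZ := sg_H SG t0 hZ; have hTB := sg_H SG t0 hB.
have e4 : eqv (T t ((h^-1)%:C *: (T h x - x))) ((h^-1)%:C *: (T h (T t x) - T t x)).
  apply: (eqv_trans SI hTZ (si_Z SI _ hTB) (si_Z SI _ hB') e2).
  apply: (eqvZ SI) => //; apply: (eqv_trans SI hTB hB'' hB' e3).
  by apply: (eqvB SI) => //; [exact: sg_comm|exact: (eqv_refl SI)].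
apply: (eqv_sym SI); [exact: (sg_H SG t0 (si_B SI hZ hy))|exact: (si_B SI (si_Z SI _ hB') hTy)|].
apply: (eqv_trans SI _ _ _ e1).
- exact: (sg_H SG t0 (si_B SI hZ hy)).
- exact: (si_B SI hTZ hTy).
- exact: (si_B SI (si_Z SI _ hB') hTy).
- apply: (eqvB SI hTZ (si_Z SI _ hB') hTy hTy e4); exact: (eqv_refl SI).
Qed.

Lemma sg_domain t x : 0 <= t -> D x -> D (T t x) /\ eqv (A (T t x)) (T t (A x)).
Proof.
move=> t0 dx; have hx := dl_H DL dx; have hA := dl_A DL dx.
apply/(sg_gen SG); [exact: (sg_H SG)|exact: (sg_H SG)|] => e e0.
have /(sg_gen SG hx hA)/(_ e e0)[d d0 hd] : D x /\ eqv (A x) (A x).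
  by split=> //; exact: (eqv_refl SI).
exists d => // h hh; apply: le_lt_trans (hd h hh).
by case/andP: hh => /ltW h0 _; exact: sg_quotient.
Qed.

Lemma sg_mono s t x : 0 <= s -> s <= t -> H x -> nrm (T t x) <= nrm (T s x).
Proof.
move=> s0 st hx; have ts : 0 <= t - s by rewrite subr_ge0.
have hs := sg_H SG s0 hx.
have e := sg_D SG ts s0 hx; rewrite subrK in e.
have ht : H (T t x) by apply: (sg_H SG) => //; exact: le_trans st.
apply: le_trans (sg_le SG ts hs); apply: (eqv_nrm_le SI) e => //.
exact: (sg_H SG).
Qed.

End Semigroup.

Section RealCombinations.
Local Open Scope complex_scope.
Context {R : realType} {X : lmodType R[i]}.
Variables u0 u1 u2 w : X.

(** Coordinates for real combinations of four vectors, reducing identities in the module to scalar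
    ones. *)
Definition comb (a b c d : R) : X := a%:C *: u0 + b%:C *: u1 + c%:C *: u2 + d%:C *: w.

Lemma combD a b c d a' b' c' d' :
  comb a b c d + comb a' b' c' d' = comb (a + a') (b + b') (c + c') (d + d').
Proof. by rewrite /comb !rmorphD /= !scalerDl addrACA; congr (_ + _); rewrite addrACA; congr (_ + _); rewrite addrACA. Qed.

Lemma combZ r a b c d : r%:C *: comb a b c d = comb (r * a) (r * b) (r * c) (r * d).
Proof. by rewrite /comb !scalerDr !scalerA -!rmorphM. Qed.

Lemma combN a b c d : - comb a b c d = comb (- a) (- b) (- c) (- d).
Proof.
by rewrite -scaleN1r (_ : -1 = (-1 : R)%:C) ?combZ ?mulN1r// rmorphN1.
Qed.

Lemma comb0 : u0 = comb 1 0 0 0.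
Proof. by rewrite /comb !scale0r scale1r !addr0. Qed.
Lemma comb1 : u1 = comb 0 1 0 0.
Proof. by rewrite /comb !scale0r scale1r !addr0 add0r. Qed.
Lemma comb2 : u2 = comb 0 0 1 0.
Proof. by rewrite /comb !scale0r scale1r !addr0 add0r. Qed.
Lemma comb3 : w = comb 0 0 0 1.
Proof. by rewrite /comb !scale0r scale1r !add0r. Qed.

(** Decomposes the discretization error into parts that vanish with [h]: two Taylor remainders of
    the cutoff, a second difference of the orbit, and the error of the central difference quotient
    against the generator. Here [u0], [u1], [u2] are consecutive samples of the orbit, and [e0],
    [e1], [e2] those of the cutoff. *)
Lemma central_difference_split (h tau n e0 e1 e2 b : R) :
  h != 0 -> n != 0 -> tau = h * n ->
  ((2 * h)^-1)%:C *: (e2%:C *: u2 - e0%:C *: u0) - e1%:C *: w - (b / tau)%:C *: u1 =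
  ((2 * h)^-1 * (e2 - e1 - n^-1 * b))%:C *: u2 +
  (- (2 * h)^-1 * (e0 - e1 - - n^-1 * b))%:C *: u0 +
  (b / tau / 2)%:C *: ((u2 - u1) - (u1 - u0)) +
  e1%:C *: (((2 * h)^-1)%:C *: (u2 - u0) - w).
Proof.
move=> h0 n0 ->.
have E0 := comb0; have E1 := comb1; have E2 := comb2; have E3 := comb3.
set v0 := u0 in E0 *; set v1 := u1 in E1 *; set v2 := u2 in E2 *; set v3 := w in E3 *.
rewrite E0 E1 E2 E3 !(combN, combZ, combD).
by congr (comb _ _ _ _); field; rewrite ?h0 ?n0.
Qed.
End RealCombinations.

Lemma scale_diff (R : pzRingType) (X : lmodType R) (c0 c1 : R) (x0 x1 : X) :
  c1 *: x1 - c0 *: x0 = (c1 - c0) *: x1 + c0 *: (x1 - x0).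
Proof. by rewrite scalerBl scalerBr addrA subrK. Qed.

(** * Cutoff and sampling of an orbit *)

Section OneStep.
Local Open Scope complex_scope.
Context {R : realType} {X : lmodType R[i]}.
Context (H : X -> Prop) (ip : X -> X -> R[i]) (SI : semi_inner H ip).
Context (D : X -> Prop) (A : X -> X) (DL : domain_linear H ip D A).
Context (T : R -> X -> X) (SG : contraction_semigroup H ip D A T).
Local Notation q := (qf ip).
Local Notation nrm := (nm ip).
Local Notation eqv := (eqv ip).

Lemma orbit_diff t h x : 0 <= t -> 0 <= h -> H x ->
  nrm (T (t + h) x - T t x) <= nrm (T h x - x).
Proof.
move=> t0 h0 hx; have hh := sg_H SG h0 hx.
apply: le_trans (sg_dist SI SG t0 hh hx).
have h1 := sg_H SG t0 hh; have h2 := sg_H SG t0 hx; have h3 := sg_H SG (addr_ge0 t0 h0) hx.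
apply: (eqv_nrm_le SI (si_B SI h3 h2) (si_B SI h1 h2)).
by apply: (eqvB SI) => //; [exact: (sg_D SG)|exact: (eqv_refl SI)].
Qed.

(** Contractivity moves the error back to time 0. The last term appears because [y] is taken at the
    midpoint [t + h] of the difference. *)
Lemma orbit_quot t h x y (c : R) : 0 <= t -> 0 <= h -> H x -> H y ->
  nrm (c%:C *: (T (t + 2 * h) x - T t x) - T (t + h) y) <=
  nrm (c%:C *: (T (2 * h) x - x) - y) + nrm (T h y - y).
Proof.
move=> t0 h0 hx hy; have h20 : 0 <= 2 * h by rewrite mulr_ge0.
have ha := sg_H SG h20 hx; have hb := sg_H SG h0 hy.
have hax := si_B SI ha hx; have hca := si_Z SI c%:C hax.
have ht0 := sg_H SG t0 hx; have hta := sg_H SG t0 ha; have htb := sg_H SG t0 hb.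
have hz := si_B SI hca hb.
have h2 := sg_H SG (addr_ge0 t0 h20) hx; have h1 := sg_H SG (addr_ge0 t0 h0) hy.
apply: (@le_trans _ _ (nrm (c%:C *: (T (2 * h) x - x) - T h y))); last first.
  have -> : c%:C *: (T (2 * h) x - x) - T h y = (c%:C *: (T (2 * h) x - x) - y) - (T h y - y).
    by rewrite opprB addrA subrK.
  by apply: (nrmB SI); exact: (si_B SI).
apply: le_trans (sg_le SG t0 hz).
have hl := si_B SI (si_Z SI c%:C (si_B SI h2 ht0)) h1.
apply: (eqv_nrm_le SI hl (sg_H SG t0 hz)); apply: (eqv_sym SI (sg_H SG t0 hz) hl).
have hm := si_B SI (sg_H SG t0 hca) htb.
apply: (eqv_trans SI (sg_H SG t0 hz) hm hl (sg_B SG t0 hca hb)).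
apply: (eqvB SI (sg_H SG t0 hca) (si_Z SI c%:C (si_B SI h2 ht0)) htb h1); last first.
  by apply: (eqv_sym SI h1 htb); exact: (sg_D SG).
have hd := sg_H SG t0 hax.
apply: (eqv_trans SI (sg_H SG t0 hca) (si_Z SI _ hd) (si_Z SI c%:C (si_B SI h2 ht0)) (sg_Z SI SG _ t0 hax)).
apply: (eqvZ SI _ hd (si_B SI h2 ht0)).
apply: (eqv_trans SI hd (si_B SI hta ht0) (si_B SI h2 ht0) (sg_B SG t0 ha hx)).
apply: (eqvB SI hta h2 ht0 ht0); last exact: (eqv_refl SI).
by apply: (eqv_sym SI h2 hta); exact: (sg_D SG).
Qed.

Context (K : R) (K0 : 0 < K).
Context (RES : forall la x, D x ->
  q x <= K * (1 + `|la|) * q (Complex 0 la *: x - A x)).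

Lemma q_le x b : H x -> 0 <= b -> nrm x <= b -> q x <= b ^+ 2.
Proof.
move=> hx b0 h; rewrite -(nrm2 SI hx); apply: lerXn2r => //.
by rewrite nnegrE nrm_ge0.
Qed.

(** The samples are [g k], the cutoff at [k / n] times the orbit at [k h]. The source is [F1], the
    derivative of the cutoff times the orbit; all else goes into [F2], which is controlled by [rho].
    There are [8 n] samples up to time [8 tau], of which at least [n] lie where the cutoff is at
    least 1: hence the factor 8. The factor 576 is the square of the bound 24 for the spline and its
    derivative. *)
Lemma sampled_estimate x tau s Lam rho p (n := (2 ^ p.+1)%:R : R) (h := tau / n) :
  D x -> 1 <= tau -> 0 < s -> 0 < Lam -> 
  nrm x / n + nrm (T h x - x)
    + nrm (((2 * h)^-1)%:C *: (T (2 * h) x - x) - A x)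
    + nrm (T h (A x) - A x) <= rho ->
  q (T (8 * tau) x) <= 8 * (576 * (Lam^-1 ^+ 2 * (nrm x + nrm (A x) + rho) ^+ 2
    + (2 + s) * K * (nrm x / tau) ^+ 2
    + K * s^-1 * ((nrm x + nrm (A x) + rho) / tau) ^+ 2
    + 4 * K * (1 + Lam) * rho ^+ 2)).
Proof.
move=> dx tau1 s0 L0 hrho.
have hx := dl_H DL dx; have hy := dl_A DL dx.
set y := A x in hrho hy *; set M0 := nrm x in hrho *; set M1 := nrm y.
have n0 : 0 < n by rewrite ltr0n expn_gt0.
have tau0 : 0 < tau by exact: lt_le_trans tau1.
have h0 : 0 < h by rewrite /h; pos.
have hn : tau = h * n by rewrite /h divfK// lt0r_neq0.
clearbody h.
have i2h : 0 < (2 * h)^-1 by rewrite invr_gt0 mulr_gt0.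
have M00 : 0 <= M0 by exact: nrm_ge0.
have M10 : 0 <= M1 by exact: nrm_ge0.
set r0 := nrm (T h x - x) in hrho; set r1 := nrm (_ - y) in hrho.
set r2 := nrm (T h y - y) in hrho.
have r00 : 0 <= r0 by exact: nrm_ge0.
have r10 : 0 <= r1 by exact: nrm_ge0.
have r20 : 0 <= r2 by exact: nrm_ge0.
have rho0 : 0 <= rho by apply: le_trans hrho; pos.
pose tk (k : nat) : R := k%:R * h.
have tk0 k : 0 <= tk k by rewrite /tk; pos.
have tkS k : tk k.+1 = tk k + h by rewrite /tk -natr1 mulrDl mul1r.
have tkSS k : tk k.+2 = tk k + 2 * h by rewrite !tkS; ring.
pose u k := T (tk k) x; pose w0 k := T (tk k) y.
have hu k : H (u k) by exact: (sg_H SG).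
have hw0 k : H (w0 k) by exact: (sg_H SG).
have uM k : nrm (u k) <= M0 by exact: (sg_le SG).
have wM k : nrm (w0 k) <= M1 by exact: (sg_le SG).
pose sk (k : nat) : R := k%:R / n.
have skS k : sk k.+1 = sk k + n^-1 by rewrite /sk -natr1 mulrDl mul1r.
pose e k := spline (sk k); pose b k := dspline (sk k).
pose g k := (e k)%:C *: u k; pose w k := (e k)%:C *: w0 k.
pose F1 k := (b k.+1 / tau)%:C *: u k.+1.
pose F2 k := ((2 * h)^-1)%:C *: (g k.+2 - g k) - w k.+1 - F1 k.
have dg k : D (g k) by apply: (dl_Z SI DL _ _).1; exact: (sg_domain SI DL SG _ dx).1.
have hg k : H (g k) by exact: (si_Z SI).
have hw k : H (w k) by exact: (si_Z SI).
have hF1 k : H (F1 k) by exact: (si_Z SI).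
have hdg k : H (((2 * h)^-1)%:C *: (g k.+2 - g k)).
  by apply: (si_Z SI); exact: (si_B SI).
have hF2 k : H (F2 k) by apply: (si_B SI) => //; exact: (si_B SI).
have ew k : eqv (A (g k)) (w k).
  have [d1 d2] := sg_domain SI DL SG (tk0 k) dx.
  have hA1 := dl_A DL d1; have hZ1 := si_Z SI (e k)%:C hA1.
  apply: (eqv_trans SI (dl_A DL (dg k)) hZ1 (hw k) (dl_Z SI DL _ d1).2).
  exact: (eqvZ SI _ hA1 (hw0 k) d2).
(* The cutoff lives on [n <= k <= 4 n], well inside the [8 n] samples, so every vanishing condition
   at either end of the transform holds. *)
have z0 (k : nat) : ((k <= 2 ^ p.+1) || (4 * 2 ^ p.+1 <= k))%N -> e k = 0 /\ b k = 0.
  move=> hk; apply: spline_supp; rewrite /sk ler_pdivrMr// mul1r ler_pdivlMr//.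
  by rewrite /n -natrM !ler_nat.
have NE : (2 ^ p.+4 = 8 * 2 ^ p.+1)%N by rewrite !expnS !mulnA.
have p1 : (1 < 2 ^ p.+1)%N by rewrite -{1}(expn0 2) ltn_exp2l.
have zl (k : nat) : (k <= 2)%N -> e k = 0 /\ b k = 0.
  by move=> k2; apply: z0; rewrite (leq_trans k2 p1).
have zr (k : nat) : (2 ^ p.+4 <= k)%N -> e k = 0 /\ b k = 0.
  by move=> kN; apply: z0; rewrite (leq_trans _ kN) ?orbT// NE leq_mul2r orbT.
have gz k : e k = 0 -> g k = 0 by rewrite /g => ->; rewrite scale0r.
have wz k : e k = 0 -> w k = 0 by rewrite /w => ->; rewrite scale0r.
have Fz k : b k.+1 = 0 -> F1 k = 0 by rewrite /F1 => ->; rewrite mul0r scale0r.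
have DE := discrete_estimate SI DL K0 RES (m := p.+3) (h := h) L0 s0 dg hw ew hF1 hF2
  (gz _ (zl 0 isT).1) (gz _ (zl 1 isT).1) (gz _ (zr _ (leqnn _)).1)
  (gz _ (zr _ (leqnSn _)).1) (wz _ (zl 0 isT).1) (wz _ (zr _ (leqnn _)).1)
  (Fz _ (zl 1 isT).2) (Fz _ (zl 2 isT).2) (Fz _ (zr _ (leqnSn _)).2)
  (Fz _ (zr _ (leqW (leqnSn _))).2).
have {}DE := DE (fun k => esym (subrKC _ _)).
have eB k := spline_bound (sk k).
have F1n k : nrm (F1 k) <= 24 * (M0 / tau).
  rewrite (nrmZR SI)// normrM (gtr0_norm (_ : 0 < tau^-1)) ?invr_gt0//.
  rewrite mulrA mulrAC; apply: ler_wpM2r; first by rewrite invr_ge0 ltW.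
  by apply: ler_pM => //; [exact: nrm_ge0|exact: (eB _).2].
have dn k : nrm (u k.+1 - u k) <= r0.
  by rewrite /u tkS; exact: orbit_diff (ltW h0) hx.
have h20 : 0 <= 2 * h by pos.
have dn2 k : nrm (u k.+2 - u k) <= 2 * h * (M1 + r1).
  rewrite /u tkSS; apply: (le_trans (orbit_diff (tk0 k) h20 hx)).
  have hT2 := si_B SI (sg_H SG h20 hx) hx.
  have : nrm (((2 * h)^-1)%:C *: (T (2 * h) x - x)) <= M1 + r1.
    rewrite -[X in nrm X](subrK y) addrC; apply: le_trans (nrmD SI _ _) _ => //.
      by apply: (si_B SI) => //; exact: (si_Z SI).
  by rewrite (nrmZR SI)// (gtr0_norm i2h) -ler_pdivlMl// invrK.
have F2n k : nrm (F2 k) <= 24 * rho.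
  rewrite /F2 /g /w /F1.
  rewrite (central_difference_split _ _ _ _ _ _ _ _ (lt0r_neq0 h0) (lt0r_neq0 n0) hn).
  have t1 := spline_taylor (sk k.+1) n^-1; have t2 := spline_taylor (sk k.+1) (- n^-1).
  rewrite -skS sqrrN in t1 t2; rewrite {1}skS addrK in t2.
  have en : (2 * h)^-1 * (8 * n^-1 ^+ 2) * M0 <= 4 * (M0 / n).
    have -> : (2 * h)^-1 * (8 * n^-1 ^+ 2) * M0 = 4 * (M0 / n) * tau^-1.
      by rewrite hn; field; rewrite !lt0r_neq0.
    apply: ler_piMr; first by pos.
    by rewrite invf_le1.
  have P1 : nrm (((2 * h)^-1 * (e k.+2 - e k.+1 - n^-1 * b k.+1))%:C *: u k.+2) <= 4 * (M0 / n).
    apply: le_trans en; rewrite (nrmZR SI)// normrM (gtr0_norm i2h).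
    apply: ler_pM => //; first by rewrite mulr_ge0// ltW.
      exact: nrm_ge0.
    by apply: ler_wpM2l; [exact: ltW|].
  have P2 : nrm ((- (2 * h)^-1 * (e k - e k.+1 - - n^-1 * b k.+1))%:C *: u k) <= 4 * (M0 / n).
    apply: le_trans en; rewrite (nrmZR SI)// normrM normrN (gtr0_norm i2h).
    apply: ler_pM => //; first by rewrite mulr_ge0// ltW.
      exact: nrm_ge0.
    by apply: ler_wpM2l; [exact: ltW|].
  have hdd : H ((u k.+2 - u k.+1) - (u k.+1 - u k)) by do 2?apply: (si_B SI).
  have P3 : nrm ((b k.+1 / tau / 2)%:C *: ((u k.+2 - u k.+1) - (u k.+1 - u k))) <= 24 * r0.
    rewrite (nrmZR SI)//.
    have -> : 24 * r0 = 12 * (r0 + r0) by ring.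
    apply: ler_pM => //; first exact: nrm_ge0.
      rewrite !normrM (gtr0_norm (_ : 0 < tau^-1)) ?invr_gt0// (@ger0_norm _ 2^-1) ?invr_ge0//.
      have := (eB k.+1).2 => hb.
      have it1 : tau^-1 <= 1 by rewrite invf_le1.
      have : `|b k.+1| * tau^-1 <= 24 * 1.
        by apply: ler_pM => //; rewrite invr_ge0 ltW.
      lra.
    by apply: le_trans (nrmB SI _ _) _; [exact: (si_B SI)|exact: (si_B SI)|exact: lerD].
  have hq : H (((2 * h)^-1)%:C *: (u k.+2 - u k) - w0 k.+1).
    by apply: (si_B SI) => //; apply: (si_Z SI); exact: (si_B SI).
  have P4 : nrm ((e k.+1)%:C *: (((2 * h)^-1)%:C *: (u k.+2 - u k) - w0 k.+1)) <= 24 * (r1 + r2).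
    rewrite (nrmZR SI)//; apply: ler_pM => //; first exact: nrm_ge0.
      exact: (eB _).1.
    by rewrite /u /w0 tkSS tkS; exact: orbit_quot (ltW h0) hx hy.
  apply: le_trans (nrmD SI _ _) _; [|exact: (si_Z SI)|].
    by apply: (si_D SI); [apply: (si_D SI)|]; exact: (si_Z SI).
  apply: (@le_trans _ _ (4 * (M0 / n) + 4 * (M0 / n) + 24 * r0 + 24 * (r1 + r2))).
    apply: lerD => //.
    apply: le_trans (nrmD SI _ _) _; [|exact: (si_Z SI)|].
      by apply: (si_D SI); exact: (si_Z SI).
    apply: lerD => //.
    by apply: le_trans (nrmD SI _ _) _; [exact: (si_Z SI)|exact: (si_Z SI)|exact: lerD].
  have : 0 <= M0 / n by pos.
  by move: hrho; clear; lra.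
have MT : M0 / tau <= M0.
  by rewrite ler_pdivrMr// ler_peMr.
have Dgn k : nrm (((2 * h)^-1)%:C *: (g k.+2 - g k)) <= 24 * (M0 + M1 + rho).
  have -> : ((2 * h)^-1)%:C *: (g k.+2 - g k) = (F2 k + F1 k) + w k.+1.
    by rewrite /F2 !subrK.
  apply: le_trans (nrmD SI _ (hw _)) _; first exact: (si_D SI).
  have wn : nrm (w k.+1) <= 24 * M1.
    rewrite (nrmZR SI)//; apply: ler_pM => //; [exact: nrm_ge0|exact: (eB _).1].
  have := nrmD SI (hF2 k) (hF1 k); have := F1n k; have := F2n k.
  by move: wn MT; clear; lra.
have it1 : 0 < tau^-1 by pos.
have it2 : tau^-1 <= 1 by rewrite invf_le1.
have DF1n k : nrm (((2 * h)^-1)%:C *: (F1 k.+2 - F1 k)) <= 24 * ((M0 + M1 + rho) / tau).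
  have -> : F1 k.+2 - F1 k = ((b k.+3 - b k.+1) / tau)%:C *: u k.+3
      + (b k.+1 / tau)%:C *: (u k.+3 - u k.+1).
    by rewrite /F1 (scale_diff (b k.+1 / tau)%:C) (mulrBl tau^-1 (b k.+3) (b k.+1)) (rmorphB (real_complex R) (b k.+3 / tau) (b k.+1 / tau)).
  have hu1 := si_Z SI ((b k.+3 - b k.+1) / tau)%:C (hu k.+3).
  have hu2 := si_Z SI (b k.+1 / tau)%:C (si_B SI (hu k.+3) (hu k.+1)).
  rewrite (nrmZR SI _ (si_D SI hu1 hu2)) (gtr0_norm i2h).
  have bl : `|b k.+3 - b k.+1| <= 32 * n^-1.
    have := dspline_lip (sk k.+1) (n^-1 + n^-1).
    rewrite addrA -!skS (gtr0_norm (_ : 0 < n^-1 + n^-1)).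
      by move=> hb; apply: (le_trans hb); rewrite le_eqVlt; apply/orP; left; apply/eqP; ring.
    by rewrite addr_gt0// invr_gt0.
  have N1 : nrm (((b k.+3 - b k.+1) / tau)%:C *: u k.+3) <= 32 * n^-1 * tau^-1 * M0.
    rewrite (nrmZR SI)// normrM (gtr0_norm it1).
    by apply: ler_pM => //; [exact: mulr_ge0 (ltW it1)|exact: nrm_ge0|apply: ler_wpM2r => //; exact: ltW].
  have N2 : nrm ((b k.+1 / tau)%:C *: (u k.+3 - u k.+1)) <= 24 * tau^-1 * (2 * h * (M1 + r1)).
    rewrite (nrmZR SI); last exact: (si_B SI).
    rewrite normrM (gtr0_norm it1).
    apply: ler_pM => //; [exact: mulr_ge0 (ltW it1)|exact: nrm_ge0|].
    by apply: ler_wpM2r; [exact: ltW|exact: (eB _).2].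
  have := nrmD SI hu1 hu2 => N3.
  have N4 : nrm (((b k.+3 - b k.+1) / tau)%:C *: u k.+3 + (b k.+1 / tau)%:C *: (u k.+3 - u k.+1))
     <= 32 * n^-1 * tau^-1 * M0 + 24 * tau^-1 * (2 * h * (M1 + r1)).
    by apply: (le_trans N3); exact: lerD.
  apply: (le_trans (ler_wpM2l (ltW i2h) N4)).
  have -> : (2 * h)^-1 * (32 * n^-1 * tau^-1 * M0 + 24 * tau^-1 * (2 * h * (M1 + r1))) =
    16 * (M0 * tau^-1) * tau^-1 + 24 * tau^-1 * (M1 + r1).
    by rewrite hn; field; rewrite !lt0r_neq0.
  have m1 : 16 * (M0 * tau^-1) * tau^-1 <= 16 * (M0 * tau^-1).
    by apply: ler_piMr => //; pos.
  have m2 : 0 <= M0 * tau^-1 by pos.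
  have m3 : r1 <= rho.
    have m4 : 0 <= M0 / n by pos.
    by move: hrho m4 r00 r20; clear; lra.
  have := ler_wpM2l (ltW it1) m3.
  by move: m1 m2; clear; lra.
set n' := (2 ^ p.+1)%N in NE.
(* On [2 n <= k < 3 n] the cutoff is at least 1, and the orbit decreases in norm up to time
   [8 tau]. *)
have low : n * q (T (8 * tau) x) <= \sum_(k < 2 ^ p.+4) q (g k).
  rewrite -(big_mkord xpredT (fun k => q (g k))) NE.
  have n23 : (2 * n' <= 3 * n')%N by rewrite leq_mul2r orbT.
  have n38 : (3 * n' <= 8 * n')%N by rewrite leq_mul2r orbT.
  have n28 := leq_trans n23 n38.
  rewrite (big_cat_nat (n := (2 * n')%N))//= (big_cat_nat (n := (3 * n')%N) (m := (2 * n')%N))//=.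
  have S1 : 0 <= \sum_(0 <= i < 2 * n') q (g i) by apply: sumr_ge0 => i _; exact: (q_ge0 SI).
  have S3 : 0 <= \sum_(3 * n' <= i < 8 * n') q (g i) by apply: sumr_ge0 => i _; exact: (q_ge0 SI).
  have S2 : n * q (T (8 * tau) x) <= \sum_(2 * n' <= i < 3 * n') q (g i).
    have -> : n * q (T (8 * tau) x) = \sum_(2 * n' <= i < 3 * n') q (T (8 * tau) x).
      by rewrite sumr_const_nat -mulnBl -[(3 - 2)%N]/1%N mul1n -[RHS]mulr_natl.
    rewrite big_nat [X in _ <= X]big_nat; apply: ler_sum => k /andP[k1 k2].
    have sk23 : 2 <= sk k <= 3.
      by rewrite /sk ler_pdivlMr// ler_pdivrMr// -!natrM !ler_nat k1 ltnW.
    have e1 := spline_ge1 sk23.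
    rewrite (qZ SI)// sqmodR.
    have tk8 : tk k <= 8 * tau.
      rewrite /tk hn; have : k%:R <= 3 * n.
        by case/andP: sk23 => _; rewrite /sk ler_pdivrMr.
      move=> k3; apply: (@le_trans _ _ (3 * n * h)); first by apply: ler_wpM2r; [exact: ltW|].
      by rewrite -mulrA (mulrC n); apply: ler_wpM2r; [pos|rewrite ler_nat].
    have hT8 : H (T (8 * tau) x) by apply: (sg_H SG) => //; pos.
    have mono := sg_mono SI SG (tk0 k) tk8 hx.
    have q1 : q (T (8 * tau) x) <= q (u k).
      by rewrite -(nrm2 SI hT8) -(nrm2 SI (hu k)); apply: lerXn2r => //; rewrite nnegrE nrm_ge0.
    apply: (le_trans q1); apply: ler_peMl; first exact: (q_ge0 SI).
    by rewrite exprn_ege1.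
  by move: S1 S2 S3; clear; lra.
have Sle (f : nat -> X) (c : R) : (forall k, H (f k)) -> 0 <= c -> (forall k, nrm (f k) <= c) ->
    \sum_(k < 2 ^ p.+4) q (f k) <= 8 * n * c ^+ 2.
  move=> hf c0 fc; apply: (@le_trans _ _ (\sum_(k < 2 ^ p.+4) c ^+ 2)).
    by apply: ler_sum => k _; exact: q_le.
  by rewrite sumr_const card_ord NE -[leLHS]mulr_natl natrM.
have z24 : 0 <= 24 :> R by [].
have S1 := Sle _ (24 * (M0 + M1 + rho)) hdg ltac:(pos) Dgn.
have S2 := Sle F1 (24 * (M0 / tau)) hF1 ltac:(pos) F1n.
have hDF k : H (((2 * h)^-1)%:C *: (F1 k.+2 - F1 k)) by apply: (si_Z SI); exact: (si_B SI).
have S3 := Sle _ (24 * ((M0 + M1 + rho) / tau)) hDF ltac:(pos) DF1n.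
have S4 := Sle F2 (24 * rho) hF2 ltac:(pos) F2n.
have c1 : 0 <= Lam^-1 ^+ 2 by exact: sqr_ge0.
have c2 : 0 <= (2 + s) * K by pos.
have c3 : 0 <= K * s^-1 by pos.
have c4 : 0 <= 4 * K * (1 + Lam) by pos.
have U1 := ler_wpM2l c1 S1; have U2 := ler_wpM2l c2 S2.
have U3 := ler_wpM2l c3 S3; have U4 := ler_wpM2l c4 S4.
rewrite -(ler_pM2l n0); apply: (le_trans low); apply: (le_trans DE).
apply: (le_trans (lerD (lerD (lerD U1 U2) U3) U4)).
by rewrite le_eqVlt; apply/orP; left; apply/eqP; ring.
Qed.

Lemma step_scale x tau rho : D x -> 0 < tau -> 0 < rho ->
  exists p : nat, let n := (2 ^ p.+1)%:R : R in let h := tau / n in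
  nrm x / n + nrm (T h x - x) + nrm (((2 * h)^-1)%:C *: (T (2 * h) x - x) - A x)
    + nrm (T h (A x) - A x) <= rho.
Proof.
move=> dx tau0 rho0; have hx := dl_H DL dx; have hy := dl_A DL dx.
have r4 : 0 < rho / 4 by rewrite divr_gt0.
have [e1 e10 h1] := sg_cont SG hx r4; have [e2 e20 h2] := sg_cont SG hy r4.
have /(sg_gen SG hx hy)/(_ _ r4)[e3 e30 h3] : D x /\ eqv (A x) (A x).
  by split=> //; exact: (eqv_refl SI).
pose B := tau / e1 + tau / e2 + 2 * tau / e3 + nrm x / (rho / 4).
have b1 : 0 <= tau / e1 by pos.
have b2 : 0 <= tau / e2 by pos.
have b3 : 0 <= 2 * tau / e3 by pos.
have b4 : 0 <= nrm x / (rho / 4) by have := nrm_ge0 ip x => n0; pos.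
exists (Num.truncn B) => n h.
have Bn : B < n.
  apply: lt_trans (truncnS_gt B) _; rewrite ltr_nat; exact: ltn_expl.
have n0 : 0 < n by rewrite ltr0n expn_gt0.
have h0 : 0 < h by rewrite /h; pos.
have c1 : h < e1 by rewrite /h ltr_pdivrMr// mulrC -ltr_pdivrMr//; move: Bn; rewrite /B; lra.
have c2 : h < e2 by rewrite /h ltr_pdivrMr// mulrC -ltr_pdivrMr//; move: Bn; rewrite /B; lra.
have c3 : 2 * h < e3.
  by rewrite /h mulrA ltr_pdivrMr// (mulrC e3) -ltr_pdivrMr//; move: Bn; rewrite /B; lra.
have c4 : nrm x / n < rho / 4.
  by rewrite ltr_pdivrMr// mulrC -ltr_pdivrMr//; move: Bn; rewrite /B; lra.
have := h1 h; rewrite h0 c1 => /(_ isT).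
have := h2 h; rewrite h0 c2 => /(_ isT).
have := h3 (2 * h); rewrite c3 mulr_gt0// => /(_ isT).
by move: c4; lra.
Qed.

(** Removes the sampling. With error [rho = e^2] and cutoff frequency [Lam = e^-1], both [Lam^-2]
    and [(1 + Lam) rho^2] are of order [e] or smaller, and [e] is arbitrary. *)
Lemma one_step x tau s : D x -> 1 <= tau -> 0 < s ->
  q (T (8 * tau) x) <= 8 * 576 * K * tau^-1 ^+ 2 *
    ((2 + s) * nrm x ^+ 2 + s^-1 * (nrm x + nrm (A x)) ^+ 2).
Proof.
move=> dx tau1 s0.
have tau0 : 0 < tau by exact: lt_le_trans tau1.
set M := nrm x + nrm (A x).
have M0 : 0 <= M by rewrite addr_ge0 ?nrm_ge0.
set Z := (X in _ <= X).
(* [W] collects the coefficients of [e] in all error terms, using [e <= 1] and [tau >= 1]. *)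
pose W := 8 * (576 * ((M + 1) ^+ 2 + K * s^-1 * (2 * M + 1) + 8 * K)).
have s1 : 0 < s^-1 by rewrite invr_gt0.
have W0 : 0 < W.
  have w1 : 0 <= (M + 1) ^+ 2 by exact: sqr_ge0.
  have w2 : 0 <= K * s^-1 * (2 * M + 1) by pos.
  have w3 : 0 < 8 * K by rewrite mulr_gt0.
  by rewrite /W !pmulr_rgt0 ?ltr0n//; apply: ltr_wpDl => //; exact: addr_ge0.
suff main (e : R) : 0 < e -> e <= 1 -> q (T (8 * tau) x) <= Z + e * W.
  apply/ler_addgt0Pr => e e0.
  have m0 : 0 < Num.min 1 (e / W) by rewrite lt_min ltr01 divr_gt0.
  have m1 : Num.min 1 (e / W) <= 1 by rewrite ge_min lexx.
  apply: (le_trans (main _ m0 m1)); rewrite lerD2l -ler_pdivlMr//.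
  by rewrite ge_min lexx orbT.
move=> e0 e1; have r0 : 0 < e ^+ 2 by exact: exprn_gt0.
have [p /= hp] := step_scale dx tau0 r0.
have L0 : 0 < e^-1 by rewrite invr_gt0.
apply: (le_trans (sampled_estimate dx tau1 s0 L0 hp)).
rewrite -/M invrK.
have i0 : 0 < tau^-1 by rewrite invr_gt0.
have i1 : tau^-1 <= 1 by rewrite invf_le1.
have i2 : tau^-1 ^+ 2 <= 1 by rewrite exprn_ile1// ltW.
have ee : e ^+ 2 <= e by rewrite expr2 ler_piMr// ltW.
have ee1 : e ^+ 2 <= 1 by exact: le_trans ee e1.
have q1 : (M + e ^+ 2) ^+ 2 <= (M + 1) ^+ 2.
  by apply: lerXn2r; rewrite ?nnegrE ?lerD2l//; move: M0 r0; lra.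
have q2 : (M + e ^+ 2) ^+ 2 <= M ^+ 2 + e * (2 * M + 1).
  have : e ^+ 2 * (2 * M + e ^+ 2) <= e * (2 * M + 1).
    by apply: ler_pM => //; [exact: ltW|lra|rewrite lerD2l].
  by move: M0; nra.
have q3 : e ^+ 2 * (M + e ^+ 2) ^+ 2 <= e * (M + 1) ^+ 2.
  by apply: ler_pM => //; [exact: ltW|exact: sqr_ge0].
have q4 : ((M + e ^+ 2) / tau) ^+ 2 <= tau^-1 ^+ 2 * M ^+ 2 + e * (2 * M + 1).
  rewrite exprMn mulrC.
  have q5 : tau^-1 ^+ 2 * (M + e ^+ 2) ^+ 2 <= tau^-1 ^+ 2 * (M ^+ 2 + e * (2 * M + 1)).
    by apply: ler_wpM2l => //; exact: sqr_ge0.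
  apply: (le_trans q5); rewrite mulrDr lerD2l; apply: ler_piMl => //.
  by rewrite mulr_ge0 ?(ltW e0)//; lra.
have q6 : (1 + e^-1) * e ^+ 2 ^+ 2 <= 2 * e.
  have -> : (1 + e^-1) * e ^+ 2 ^+ 2 = e ^+ 2 * e ^+ 2 + e ^+ 2 * e.
    by field; rewrite lt0r_neq0.
  have : e ^+ 2 * e ^+ 2 <= 1 * e by apply: ler_pM => //; exact: ltW.
  have : e ^+ 2 * e <= e * 1 by apply: ler_pM => //; exact: ltW.
  lra.
have Ks : 0 <= K * s^-1 by pos.
have q7 := ler_wpM2l Ks q4.
have K4 : 0 <= 4 * K by pos.
have q8 := ler_wpM2l K4 q6.
have q9 : 0 <= (2 + s) * K * (nrm x / tau) ^+ 2 by pos.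
apply: (@le_trans _ _ (8 * (576 * (e * (M + 1) ^+ 2 + (2 + s) * K * (nrm x / tau) ^+ 2
    + K * s^-1 * (tau^-1 ^+ 2 * M ^+ 2 + e * (2 * M + 1)) + 4 * K * (2 * e))))).
  rewrite !(ler_pM2l (ltr0n _ 8)) (ler_pM2l (ltr0n _ 576)) -[4 * K * _ * _]mulrA.
  by apply: lerD q8; apply: lerD q7; apply: lerD.
rewrite le_eqVlt; apply/orP; left; apply/eqP; rewrite /Z /W.
move: (nrm x) (s^-1) (tau^-1) => N s' t'.
by ring.
Qed.

End OneStep.

Section Decay.
Local Open Scope complex_scope.
Context {R : realType} {X : lmodType R[i]}.
Context (H : X -> Prop) (ip : X -> X -> R[i]) (SI : semi_inner H ip).
Context (D : X -> Prop) (A : X -> X) (DL : domain_linear H ip D A).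
Context (T : R -> X -> X) (SG : contraction_semigroup H ip D A T).
Local Notation q := (qf ip).
Local Notation nrm := (nm ip).

(* With [tau = t / 9] the one-step estimate for [T tau x] and [s = tau^2 / m]
   carries the bound [m B / tau^2] to the scale [9 tau]. *)
Lemma bootstrap K x : 0 < K -> D x ->
  (forall x tau s, D x -> 1 <= tau -> 0 < s ->
     q (T (8 * tau) x) <=
       K * tau^-1 ^+ 2 * ((2 + s) * nrm x ^+ 2 + s^-1 * (nrm x + nrm (A x)) ^+ 2)) ->
  let tau0 := 1 + 4 * 9 ^+ 4 * K in
  forall k t, 0 < t -> t <= 9 ^+ k * (9 * tau0) ->
    nrm (T t x) * t ^+ 2 <= (9 * tau0) ^+ 2 * (nrm x + nrm (A x)).
Proof.
move=> K0 dx step tau0.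
have hx := dl_H DL dx; set B := nrm x + nrm (A x).
have B0 : 0 <= B by rewrite addr_ge0 ?nrm_ge0.
have nineK : 0 < 9 ^+ 4 * K by rewrite mulr_gt0// exprn_gt0 ?ltr0n.
have t01 : 1 <= tau0 by rewrite /tau0 -mulrA; lra.
set m := (9 * tau0) ^+ 2.
have m0 : 0 < m by rewrite exprn_gt0// mulr_gt0 ?ltr0n//; lra.
(* On the initial range contractivity alone suffices, as [t ^+ 2 <= m] there. *)
have base t : 0 < t -> t <= 9 * tau0 -> nrm (T t x) * t ^+ 2 <= m * B.
  move=> t0 ht; rewrite mulrC; apply: ler_pM; [exact: sqr_ge0|exact: nrm_ge0| |].
    by apply: lerXn2r; rewrite ?nnegrE; lra.
  apply: (le_trans (sg_le SG (ltW t0) hx)).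
  by rewrite /B lerDl nrm_ge0.
elim=> [|k IH] t t0 ht; first by apply: base => //; rewrite expr0 mul1r in ht.
have [ts|tl] := leP t (9 * tau0); first exact: base.
pose tau := t / 9; have tE : t = 9 * tau by rewrite /tau mulrC divfK// pnatr_eq0.
have tau_ge : tau0 <= tau by rewrite /tau ler_pdivlMr ?ltr0n// mulrC ltW.
have tau1 : 1 <= tau by exact: le_trans tau_ge.
have tau_gt0 : 0 < tau by exact: lt_le_trans tau1.
have tau_le : tau <= 9 ^+ k * (9 * tau0).
  rewrite /tau ler_pdivrMr ?ltr0n//; apply: (le_trans ht).
  by rewrite exprS le_eqVlt; apply/orP; left; apply/eqP; ring.
have {IH} := IH tau tau_gt0 tau_le; set n := nrm (T tau x) => IH.
have n0 : 0 <= n by exact: nrm_ge0.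
have [dT eT] := sg_domain SI DL SG (ltW tau_gt0) dx.
have hA := dl_A DL dx; have hT := dl_A DL dT.
have nB : n + nrm (A (T tau x)) <= B.
  apply: lerD; first exact: (sg_le SG (ltW tau_gt0) hx).
  by rewrite (eqv_nrm SI hT (sg_H SG (ltW tau_gt0) hA) eT); exact: (sg_le SG (ltW tau_gt0) hA).
have s0 : 0 < tau ^+ 2 / m by rewrite divr_gt0// exprn_gt0.
have := step _ _ _ dT tau1 s0.
have e8 : 9 * tau = 8 * tau + tau by ring.
have h89 : q (T (8 * tau) (T tau x)) = nrm (T t x) ^+ 2.
  have t8 : 0 <= 8 * tau by rewrite mulr_ge0// ltW.
  have hh := sg_H SG t8 (sg_H SG (ltW tau_gt0) hx).
  have ht' := sg_H SG (ltW t0) hx.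
  rewrite -(nrm2 SI hh); congr (_ ^+ 2); apply: (eqv_nrm SI hh ht').
  apply: (eqv_sym SI ht' hh); rewrite tE e8; exact: (sg_D SG t8 (ltW tau_gt0) hx).
rewrite h89 -/n => st.
have l1 : n * tau ^+ 2 <= m * B := IH.
have C2 : (n + nrm (A (T tau x))) ^+ 2 <= B ^+ 2.
  by apply: lerXn2r nB; rewrite nnegrE ?addr_ge0 ?nrm_ge0.
have C1 : n ^+ 2 * tau ^+ 4 <= m ^+ 2 * B ^+ 2.
  rewrite (exprM tau 2 2) -!exprMn.
  have l0 : 0 <= n * tau ^+ 2 by rewrite mulr_ge0 ?sqr_ge0.
  by apply: lerXn2r (l1); rewrite nnegrE// (le_trans l0 l1).
have big : nrm (T t x) ^+ 2 * tau ^+ 4 <= K * (2 * m ^+ 2 * tau^-1 ^+ 2 + 2 * m) * B ^+ 2.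
  have t4 : 0 <= tau ^+ 4 by rewrite exprn_ge0// ltW.
  apply: (le_trans (ler_wpM2r t4 st)).
  set Y := (n + _) ^+ 2 in C2 *.
  have -> : K * tau^-1 ^+ 2 * ((2 + tau ^+ 2 / m) * n ^+ 2 + (tau ^+ 2 / m)^-1 * Y) * tau ^+ 4
     = K * (2 * tau^-1 ^+ 2 + m^-1) * (n ^+ 2 * tau ^+ 4) + K * m * Y.
    by field; rewrite !lt0r_neq0.
  have -> : K * (2 * m ^+ 2 * tau^-1 ^+ 2 + 2 * m) * B ^+ 2 =
     K * (2 * tau^-1 ^+ 2 + m^-1) * (m ^+ 2 * B ^+ 2) + K * m * B ^+ 2.
    by field; rewrite !lt0r_neq0.
  have it0 : 0 <= tau^-1 ^+ 2 by exact: sqr_ge0.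
  have im0 : 0 < m^-1 by rewrite invr_gt0.
  apply: lerD; apply: ler_wpM2l => //; last by rewrite mulr_ge0// ltW.
  by rewrite mulr_ge0 ?(ltW K0)//; lra.
(* The reason for [tau0]: the factor [9 ^+ 4] is the ratio of [t ^+ 4] to [tau ^+ 4], and
   [tau0 >= 4 * 9 ^+ 4 * K] together with [tau >= tau0] and [m >= tau0] makes each of the two terms
   at most [m ^+ 2 / 2]. The constant [m] is thus reproduced without growth. *)
have fin : 9 ^+ 4 * (K * (2 * m ^+ 2 * tau^-1 ^+ 2 + 2 * m)) <= m ^+ 2.
  have hm : tau0 <= m.
    have h9 : 1 <= 9 * tau0 by lra.
    rewrite /m expr2; apply: (@le_trans _ _ (9 * tau0)); first lra.
    by rewrite ler_peMl//; lra.
  have h1 : 4 * (9 ^+ 4 * K) <= tau0 by rewrite /tau0 -mulrA; lra.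
  have h2 : 4 * (9 ^+ 4 * K) * m <= m * m.
    by apply: ler_wpM2r; [exact: ltW|exact: le_trans hm].
  have i1 : tau^-1 <= 1 by rewrite invf_le1.
  have i0 : 0 < tau^-1 by rewrite invr_gt0.
  have i2 : tau^-1 ^+ 2 <= tau^-1 by rewrite expr2 ler_piMr// ltW.
  have h3 : 4 * (9 ^+ 4 * K) * tau^-1 ^+ 2 <= 1.
    apply: (@le_trans _ _ (tau * tau^-1)); last by rewrite divff// lt0r_neq0.
    have nn4 : 0 <= 4 * (9 ^+ 4 * K) by move: nineK; lra.
    exact: (ler_pM nn4 (sqr_ge0 _) (le_trans h1 tau_ge) i2).
  have h4 := ler_wpM2r (sqr_ge0 m) h3.
  have -> : 9 ^+ 4 * (K * (2 * m ^+ 2 * tau^-1 ^+ 2 + 2 * m)) =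
     2^-1 * (4 * (9 ^+ 4 * K) * tau^-1 ^+ 2 * m ^+ 2 + 4 * (9 ^+ 4 * K) * m).
    by field; rewrite lt0r_neq0.
  by move: h2 h4; rewrite mul1r -expr2; lra.
have mB : 0 <= m * B by rewrite mulr_ge0// ltW.
rewrite -(@ler_pXn2r _ 2)// ?nnegrE ?mulr_ge0 ?nrm_ge0 ?sqr_ge0 ?(ltW t0)//.
have -> : (nrm (T t x) * t ^+ 2) ^+ 2 = 9 ^+ 4 * (nrm (T t x) ^+ 2 * tau ^+ 4).
  by rewrite [in t ^+ 2]tE; ring.
have n4 : 0 <= 9 ^+ 4 :> R by rewrite exprn_ge0.
apply: (le_trans (ler_wpM2l n4 big)).
rewrite (_ : (m * B) ^+ 2 = m ^+ 2 * B ^+ 2); last by ring.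
by rewrite [leLHS]mulrA; apply: ler_wpM2r => //; exact: sqr_ge0.
Qed.

(** The bootstrap constant does not depend on the number of scales, so every time [t] is reached
    with the same [m]. *)
Lemma abstract_decay K : 0 < K ->
  (forall la x, D x -> q x <= K * (1 + `|la|) * q (Complex 0 la *: x - A x)) ->
  exists2 C, 0 < C & forall x t, D x -> 0 < t ->
    q (T t x) <= C / t ^+ 4 * (q x + q (A x)).
Proof.
move=> K0 RES; set K' := 8 * 576 * K.
have K'0 : 0 < K' by rewrite /K' !pmulr_rgt0 ?ltr0n.
have step x tau s : D x -> 1 <= tau -> 0 < s -> _ :=
  @one_step _ _ _ _ SI _ _ DL _ SG _ K0 RES x tau s.
rewrite -/K' in step.
pose tau0 := 1 + 4 * 9 ^+ 4 * K'.
have t01 : 1 <= tau0.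
  have : 0 < 4 * 9 ^+ 4 * K' by rewrite mulr_gt0// pmulr_rgt0 ?ltr0n// exprn_gt0 ?ltr0n.
  by rewrite /tau0; lra.
have t91 : 1 <= 9 * tau0 by lra.
set m := (9 * tau0) ^+ 2.
have m0 : 0 < m by rewrite exprn_gt0//; lra.
exists (2 * m ^+ 2); first by rewrite mulr_gt0// exprn_gt0.
move=> x t dx t0; have hx := dl_H DL dx; have hA := dl_A DL dx.
have [k tk] : exists k : nat, t <= 9 ^+ k * (9 * tau0).
  exists (Num.truncn t).+1; apply: (@le_trans _ _ (9 ^+ (Num.truncn t).+1 * 1)).
    rewrite mulr1; apply/ltW; apply: (lt_le_trans (truncnS_gt t)).
    by rewrite -natrX ler_nat ltnW// ltn_expl.
  by apply: ler_wpM2l => //; rewrite exprn_ge0.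
have := bootstrap K'0 dx step t0 tk; rewrite -/tau0 -/m.
have hT := sg_H SG (ltW t0) hx.
rewrite -(nrm2 SI hT) -(nrm2 SI hx) -(nrm2 SI hA).
set n := nrm (T t x); set n0 := nrm x; set n1 := nrm (A x) => hb.
have n00 : 0 <= n0 := nrm_ge0 _ _; have n10 : 0 <= n1 := nrm_ge0 _ _.
have nn : 0 <= n := nrm_ge0 _ _.
have t4 : 0 < t ^+ 4 by rewrite exprn_gt0.
rewrite mulrAC ler_pdivlMr//.
have -> : n ^+ 2 * t ^+ 4 = (n * t ^+ 2) ^+ 2 by rewrite exprMn -exprM.
apply: (@le_trans _ _ ((m * (n0 + n1)) ^+ 2)).
  have h0 : 0 <= n * t ^+ 2 by rewrite mulr_ge0 ?sqr_ge0.
  by apply: lerXn2r (hb); rewrite nnegrE// (le_trans h0 hb).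
rewrite exprMn (_ : 2 * m ^+ 2 * _ = m ^+ 2 * (2 * (n0 ^+ 2 + n1 ^+ 2))); last by ring.
apply: ler_wpM2l; first exact: sqr_ge0.
by have := sqr_ge0 (n0 - n1); nra.
Qed.
End Decay.

(** * Weak derivatives on an interval *)

Section RealTests.
Context {R : realType}.
Implicit Types (al be L x y k : R) (f g phi psi : R -> R).
Local Notation mu := (@lebesgue_measure R).

Lemma continuous_itg_cc al be f : continuous f -> mu.-integrable `[al, be] (EFin \o f).
Proof.
move=> cf; apply: continuous_compact_integrable; first exact: segment_compact.
exact: continuous_subspaceT.
Qed.

Lemma continuous_itg al be f : continuous f -> itg al be f.
Proof.
move=> cf; apply: integrableS (continuous_itg_cc al be cf) => //.
exact: subset_itv_oo_cc.
Qed.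

Lemma continuous_sq al be f : continuous f -> sq al be f.
Proof.
move=> cf; split; first exact: itg_meas (continuous_itg _ _ cf).
by apply: continuous_itg => x; apply: continuousM; exact: cf.
Qed.

Lemma continuous_I_eq0 al be g : continuous g -> (forall x, 0 <= g x) ->
  I al be g = 0 -> forall x, al < x < be -> g x = 0.
Proof.
move=> cg g0 hI x /andP[ax xb]; apply/eqP/negPn/negP => gx.
have gx0 : 0 < g x by rewrite lt_neqAle eq_sym gx g0.
have e0 : 0 < g x / 2 by rewrite divr_gt0.
have /cvgrPdist_lt/(_ _ e0) := cg x.
move=> /nbhs_ballP[d /= d0 hd].
pose r := Num.min (d / 2) (Num.min ((x - al) / 2) ((be - x) / 2)).
have r0 : 0 < r by rewrite /r !lt_min !divr_gt0 ?subr_gt0.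
have [rd [ra rb]] : r <= d / 2 /\ r <= (x - al) / 2 /\ r <= (be - x) / 2.
  by rewrite /r !ge_min !lexx !orbT.
have := I_mono (_ : al <= x - r) (_ : x - r <= x + r) (_ : x + r <= be) (continuous_itg al be cg).
rewrite hI => H.
have {}H : I (x - r) (x + r) g <= 0 by apply: H => //; lra.
have : I (x - r) (x + r) (fun=> g x / 2) <= I (x - r) (x + r) g.
  apply: I_le; [exact: itg_cst|exact: continuous_itg|].
  move=> t; rewrite in_itv/= => /andP[t1 t2].
  have : `|g x - g t| < g x / 2.
    by apply: hd; rewrite /ball/= ltr_distl; apply/andP; split; lra.
  by rewrite ltr_distl => /andP[_]; lra.
rewrite Icst; last lra.
have : 0 < g x / 2 * (x + r - (x - r)) by apply: mulr_gt0 => //; lra.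
by move: H; lra.
Qed.

Definition real_test L phi := [/\ forall x, derivable phi x 1,
  continuous (derive1 phi) & exists al be, [/\ 0 < al, be < L &
    forall x, x \notin `[al, be] -> phi x = 0]].

Lemma ac_of_C1 al be phi : (forall x, derivable phi x 1) -> continuous (derive1 phi) ->
  ac al be phi (derive1 phi).
Proof.
move=> dphi cphi; split; first exact: continuous_sq.
move=> x /andP[ax xb].
have [<-|nax] := eqVneq al x; first by rewrite I_ge// addr0.
have {ax nax}ax : al < x by rewrite lt_neqAle nax.
have cc y : {for y, continuous phi}.
  by apply: differentiable_continuous; apply/derivable1_diffP.
have E : \int[mu]_(t in `[al, x]) derive1 phi t = phi x - phi al.
  have h1 : {within `[al, x], continuous (derive1 phi)} by exact: continuous_subspaceT.
  have h2 : derivable_oo_LRcontinuous phi al x.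
    split; first by move=> y _; exact: dphi.
      by apply: cvg_at_right_filter; exact: cc.
    by apply: cvg_at_left_filter; exact: cc.
  have h3 : {in `]al, x[, derive1 phi =1 derive1 phi} by move=> y _.
  by rewrite /Rintegral (continuous_FTC2 ax h1 h2 h3).
rewrite /I (Rintegral_itv_bndo_bndc (continuous_itg _ _ cphi)).
rewrite (Rintegral_itv_obnd_cbnd (b := BRight x)); last first.
  apply: integrableS (continuous_itg_cc al x cphi) => //.
  exact: subset_itv_oc_cc.
by rewrite E addrC subrK.
Qed.

Lemma real_test_vanish L phi : real_test L phi -> phi 0 = 0 /\ phi L = 0.
Proof.
move=> [_ _ [al [be [a0 bL h]]]].
by split; apply: h; rewrite in_itv/= negb_and -!ltNge ?a0 ?bL ?orbT.
Qed.

(** The primitive from minus infinity vanishes left of [al]; right of [be] it equals the total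
    integral of [g], which is zero. *)
Lemma real_test_primitive L al be g : 0 < al -> be < L -> continuous g ->
  (forall x, x \notin `[al, be] -> g x = 0) -> I 0 L g = 0 ->
  exists2 phi, real_test L phi & (derive1 phi) = g.
Proof.
move=> a0 bL cg gz hI.
have gE (D : set R) : `[al, be] `<=` D -> g \_ D = g.
  move=> sD; apply/funext => x; rewrite patchE; case: ifPn => // /negP xD.
  rewrite gz//; apply/negP => h; apply: xD; exact/mem_set/sD.
have gi : mu.-integrable setT (EFin \o g).
  have /(integrable_mkcond _ _) := continuous_itg_cc al be cg.
  move=> /(_ (measurable_itv _)); congr (_.-integrable _ _); apply/funext => x/=.
  by rewrite -[in RHS](gE `[al, be]%classic)// !patchE; case: ifP.
pose phi x := \int[mu]_(t in `]-oo, x]) g t.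
have D x : derivable phi x 1 /\ (derive1 phi) x = g x.
  apply: (@continuous_FTC1 _ g -oo%O x (x + 1)).
  - by rewrite ltrDl.
  - exact: integrableS gi.
  - by rewrite ltNyr.
  - exact: cg.
have dE : (derive1 phi) = g by apply/funext => x; exact: (D x).2.
exists phi => //; split; [by move=> x; exact: (D x).1|by rewrite dE|].
exists al, be; split=> // x; rewrite in_itv/= negb_and -!ltNge => /orP[xa|bx].
  rewrite /phi (_ : Rintegral _ _ _ = \int[mu]_(t in `]-oo, x]) (cst 0 : R -> R) t); first by rewrite Rintegral_cst// mul0r.
  apply: eq_Rintegral => t; rewrite inE/= in_itv/= => tx; apply: gz.
  by rewrite in_itv/= negb_and -ltNge (le_lt_trans tx).
rewrite /phi -hI /I Rintegral_mkcond [RHS]Rintegral_mkcond !gE//.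
- by move=> y /=; rewrite !in_itv/= => /andP[ay yb]; rewrite (lt_le_trans a0 ay) (le_lt_trans yb).
- by move=> y /=; rewrite !in_itv/= => /andP[ay yb]; rewrite (le_trans yb)// ltW.
Qed.

End RealTests.

(** * The fundamental lemma and the du Bois-Reymond lemma *)

Section DuBoisReymond.
Context {R : realType}.
Implicit Types (al be L x y : R) (f g phi psi : R -> R).
Local Notation mu := (@lebesgue_measure R).

(** A parabolic bump. Continuity is enough, since it is only used as a piece of the derivative of a
    C^1 test function. *)
Definition tent al be x : R := Num.max 0 ((x - al) * (be - x)).

Lemma tent_continuous al be : continuous (tent al be).
Proof.
move=> x; apply: (@continuous_max _ _ (cst 0) (fun x => (x - al) * (be - x))); first exact: cvg_cst.
apply: (@continuousM _ _ (fun x => x - al) (fun x => be - x)).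
  by apply: continuousB; [exact: cvg_id|exact: cvg_cst].
by apply: continuousB; [exact: cvg_cst|exact: cvg_id].
Qed.

Lemma tent_ge0 al be x : 0 <= tent al be x.
Proof. by rewrite /tent le_max lexx. Qed.

Lemma tent_out al be x : al < be -> x \notin `[al, be] -> tent al be x = 0.
Proof.
move=> ab; rewrite in_itv/= negb_and -!ltNge => h; apply/max_idPl.
by case/orP: h => h; nra.
Qed.

Lemma tent_gt0 al be x : al < x < be -> 0 < tent al be x.
Proof. by move=> /andP[ax xb]; rewrite /tent lt_max mulr_gt0 ?subr_gt0// orbT. Qed.

Lemma I_tent_gt0 L al be : 0 < al -> al < be -> be < L -> 0 < I 0 L (tent al be).
Proof.
move=> a0 ab bL; rewrite lt_neqAle eq_sym I_ge0 ?andbT; last by move=> x _; exact: tent_ge0.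
apply/eqP => h.
have m : al < (al + be) / 2 < be by apply/andP; split; lra.
have := tent_gt0 m; rewrite (continuous_I_eq0 (@tent_continuous al be) (tent_ge0 al be) h) ?ltxx//.
by case/andP: m => m1 m2; apply/andP; split; lra.
Qed.

(* [phi' = psi - c tent] has a compactly supported primitive for the right [c],
   so testing against derivatives is testing against all mean-zero functions. *)
Lemma mean_zero_test L (k psi : R -> R) al be : 0 < al -> al < be -> be < L -> sq 0 L k ->
  continuous psi -> (forall x, x \notin `[al, be] -> psi x = 0) ->
  (forall phi, real_test L phi -> I 0 L (fun x => k x * derive1 phi x) = 0) ->
  I 0 L (fun x => k x * psi x) * I 0 L (tent al be) =
  I 0 L (fun x => k x * tent al be x) * I 0 L psi.
Proof.
move=> a0 ab bL sk cpsi zpsi hk.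
have W0 := I_tent_gt0 a0 ab bL; set W := I 0 L (tent al be) in W0 *.
have ct := @tent_continuous al be.
set m := I 0 L psi / W.
pose g x := psi x - m * tent al be x.
have cg : continuous g.
  move=> x; apply: (@continuousB _ _ _ psi (fun x => m * tent al be x)); first exact: cpsi.
  by apply: continuousM; [exact: cvg_cst|exact: ct].
have spsi := continuous_sq 0 L cpsi; have st := continuous_sq 0 L ct.
have gz x : x \notin `[al, be] -> g x = 0.
  by move=> hx; rewrite /g zpsi// tent_out// mulr0 subr0.
have hI : I 0 L g = 0.
  by rewrite /g IB ?IZ; itg_tac; rewrite -/W /m divfK ?subrr// lt0r_neq0.
have [phi tphi E] := real_test_primitive a0 bL cg gz hI.
have := hk _ tphi; rewrite E.
rewrite (_ : (fun x => _) = (fun x => k x * psi x - m * (k x * tent al be x))); last first.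
  by apply/funext => x; rewrite /g; ring.
rewrite IB ?IZ; itg_tac => /eqP; rewrite subr_eq0 => /eqP ->.
by rewrite mulrAC /m divfK ?lt0r_neq0// mulrC.
Qed.

Lemma I0x_ac L (k : R -> R) : sq 0 L k -> ac 0 L (fun x => I 0 x k) k.
Proof. by move=> sk; split=> // x _; rewrite (I_ge _ (lexx 0)) add0r. Qed.

Lemma ibp_test L F f phi : 0 < L -> ac 0 L F f -> real_test L phi ->
  I 0 L (fun x => F x * derive1 phi x) = - I 0 L (fun x => f x * phi x).
Proof.
move=> L0 aF tphi; have [dphi cphi _] := tphi.
have aphi := ac_of_C1 0 L dphi cphi; have [p0 pL] := real_test_vanish tphi.
have := (acM (ltW L0) aF aphi).2 L; rewrite ltW// lexx => /(_ isT).
have sF := ac_sq (ltW L0) aF; have sphi := ac_sq (ltW L0) aphi.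
have sf := aF.1; have sdphi := aphi.1.
by rewrite p0 pL !mulr0 add0r ID; itg_tac; move/esym/eqP; rewrite addrC addr_eq0 => /eqP.
Qed.

(** Passes to the primitive [K] of [k]. Integration by parts shows that [K] is orthogonal to all
    derivatives of test functions, which forces the continuous function [K] to be locally constant;
    [k] is its derivative almost everywhere. *)
Lemma fundamental_lemma L (k : R -> R) : 0 < L -> sq 0 L k ->
  (forall phi, real_test L phi -> I 0 L (fun x => k x * phi x) = 0) ->
  {ae mu, forall x, x \in `]0, L[ -> k x = 0}.
Proof.
move=> L0 sk hk; pose K x := I 0 x k.
have aK : ac 0 L K k by exact: I0x_ac.
have sK := ac_sq (ltW L0) aK.
have hK phi : real_test L phi -> I 0 L (fun x => K x * derive1 phi x) = 0.
  by move=> tphi; rewrite (ibp_test L0 aK tphi) hk// oppr0.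
pose Kc x := K (Num.max 0 (Num.min x L)).
have cKc : continuous Kc := ac_clamp_continuous (ltW L0) aK.
have KcE x : x \in `]0, L[ -> Kc x = K x.
  by rewrite in_itv/= => /andP[/ltW x0 /ltW xL]; rewrite /Kc (min_idPl xL) (max_idPr x0).
have sKc := continuous_sq 0 L cKc.
have cst al be : 0 < al -> al < be -> be < L ->
    exists m, forall x, al < x < be -> K x = m.
  move=> a0 ab bL; have W0 := I_tent_gt0 a0 ab bL.
  have ct := @tent_continuous al be; have st := continuous_sq 0 L ct.
  set W := I 0 L (tent al be) in W0.
  pose m := I 0 L (fun x => K x * tent al be x) / W; exists m => x /andP[ax xb].
  have xL : x \in `]0, L[ by rewrite in_itv/= (lt_trans a0 ax) (lt_trans xb bL).
  (* As [m] is the mean of [K] weighted by the bump, testing with [psi] makes the integral of the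
     bump times [(K - m)^2] vanish. The clamped [Kc] makes [psi] continuous on the whole line. *)
  pose psi x := tent al be x * (Kc x - m).
  have cpsi : continuous psi.
    move=> y; apply: continuousM; first exact: ct.
    by apply: continuousB; [exact: cKc|exact: cvg_cst].
  have zpsi y : y \notin `[al, be] -> psi y = 0.
    by move=> hy; rewrite /psi tent_out// mul0r.
  have := mean_zero_test a0 ab bL sK cpsi zpsi hK; rewrite -/W => E.
  have spsi := continuous_sq 0 L cpsi.
  have E2 : I 0 L (fun x => K x * psi x) = m * I 0 L psi.
    by apply: (mulIf (lt0r_neq0 W0)); rewrite E /m mulrAC divfK// lt0r_neq0.
  have Z : I 0 L (fun x => tent al be x * (Kc x - m) ^+ 2) = 0.
    rewrite (_ : I 0 L _ = I 0 L (fun x => K x * psi x - m * psi x)); last first.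
      by apply: I_eq => y /KcE <-; rewrite /psi; ring.
    by rewrite IB ?IZ; itg_tac; rewrite E2 subrr.
  have cZ : continuous (fun x => tent al be x * (Kc x - m) ^+ 2).
    move=> y; apply: continuousM; first exact: ct.
    by apply: continuousM; (apply: continuousB; [exact: cKc|exact: cvg_cst]).
  have /eqP := continuous_I_eq0 cZ (fun y => mulr_ge0 (tent_ge0 al be y) (sqr_ge0 _)) Z xL.
  rewrite mulf_eq0 gt_eqF ?tent_gt0 ?ax//= sqrf_eq0 subr_eq0 => /eqP.
  by rewrite KcE.
have Kloc x : x \in `]0, L[ -> \forall y \near x, K y = K x.
  rewrite in_itv/= => /andP[x0 xL].
  have [m hm] := cst (x / 2) ((x + L) / 2) ltac:(lra) ltac:(lra) ltac:(lra).
  near=> y; rewrite !hm//; first by apply/andP; split; lra.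
  apply/andP; split; near: y.
    by apply: lt_nbhsr; lra.
  by apply: lt_nbhsl; lra.
(* Extension by zero, so that the differentiation theorem for primitives from minus infinity
   applies. *)
pose k0 := k \_ `]0, L[.
have ik0 : mu.-integrable setT (EFin \o k0).
  have /(integrable_mkcond _ _) := sq_itg sk => /(_ (measurable_itv _)).
  congr (_.-integrable _ _); apply/funext => x/=.
  by rewrite /k0 !patchE; case: ifP.
have := @FTC1Ny R k0 (fun y => _) (open_integrable_locally openT ik0).
rewrite /=; move=> H.
apply: aeS (H _) _; first by move=> y; exact: integrableS ik0.
move=> x [dx kx] hx; move: kx; rewrite {2}/k0 patchE mem_set// => <-.
have x0L : \forall y \near x, 0 < y < L.
  move: hx; rewrite in_itv/= => /andP[x0 xL]; near=> y.
  by apply/andP; split; near: y; [apply: lt_nbhsr|apply: lt_nbhsl].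
rewrite derive1E -[RHS](derive_cst (K x) x (1 : R)); apply: near_eq_derive.
near=> y.
have /andP[y0 yL] : 0 < y < L by near: y.
transitivity (K y); last by near: y; exact: Kloc.
have iky : itg 0 y k by apply: itgS (sq_itg sk) => //; exact: ltW.
rewrite /K /I (Rintegral_itv_bndo_bndc iky) [RHS]Rintegral_mkcond [LHS]Rintegral_mkcond.
congr (Rintegral _ _ _); apply/funext => t.
rewrite /k0 !patchE !mem_setE !in_itv/=; case: (leP t y) => ty; last by rewrite andbF.
by rewrite andbT (le_lt_trans ty yL) andbT.
Unshelve. all: by end_near. Qed.

(** The constant is the mean of [k] weighted by one fixed bump; [k] minus this constant is shown to
    be orthogonal to every test function. *)
Lemma du_Bois_Reymond L (k : R -> R) : 0 < L -> sq 0 L k ->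
  (forall phi, real_test L phi -> I 0 L (fun x => k x * derive1 phi x) = 0) ->
  exists m, {ae mu, forall x, x \in `]0, L[ -> k x = m}.
Proof.
move=> L0 sk hk.
pose t := tent (L / 4) (3 * L / 4).
have l1 : 0 < L / 4 by lra.
have l2 : L / 4 < 3 * L / 4 by lra.
have l3 : 3 * L / 4 < L by lra.
have W0 : 0 < I 0 L t := I_tent_gt0 l1 l2 l3.
exists (I 0 L (fun x => k x * t x) / I 0 L t); set m := _ / _.
have skm : sq 0 L (fun x => k x - m) by itg_tac.
suff : {ae mu, forall x, x \in `]0, L[ -> k x - m = 0}.
  by move=> h; apply: (aeS h) => x hx /hx /eqP; rewrite subr_eq0 => /eqP.
apply: (fundamental_lemma L0 skm) => psi [dpsi cpsi [al [be [a0 bL zpsi]]]].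
(* An interval containing both the support of [psi] and that of the fixed bump. Comparing each of
   them with the bump of this interval eliminates the latter. *)
pose al' := Num.min al (L / 4); pose be' := Num.max be (3 * L / 4).
have cp : continuous psi.
  by move=> x; apply: differentiable_continuous; apply/derivable1_diffP.
have a'0 : 0 < al' by rewrite /al' lt_min a0.
have b'L : be' < L by rewrite /be' gt_max bL.
have ab' : al' < be'.
  by rewrite /al' /be' gt_min !lt_max; apply/orP; right; rewrite l2 orbT.
have zp x : x \notin `[al', be'] -> psi x = 0.
  move=> h; apply: zpsi; apply: contra h; rewrite !in_itv/= => /andP[h1 h2].
  by rewrite /al' /be' ge_min h1 le_max h2.
have zt x : x \notin `[al', be'] -> t x = 0.
  move=> h; apply: tent_out => //; apply: contra h; rewrite !in_itv/= => /andP[h1 h2].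
  by rewrite /al' /be' ge_min h1 le_max h2 !orbT.
have ct : continuous t := @tent_continuous _ _.
have E1 := mean_zero_test a'0 ab' b'L sk cp zp hk.
have E2 := mean_zero_test a'0 ab' b'L sk ct zt hk.
have W'0 := I_tent_gt0 a'0 ab' b'L.
set W := I 0 L (tent al' be') in E1 E2 W'0; set Q := I 0 L (fun x => k x * tent al' be' x) in E1 E2.
have sp := continuous_sq 0 L cp.
rewrite (_ : (fun x => _) = (fun x => k x * psi x - m * psi x)); last first.
  by apply/funext => x; ring.
rewrite IB ?IZ; itg_tac; apply/eqP; rewrite subr_eq0; apply/eqP.
apply: (mulIf (lt0r_neq0 W'0)); rewrite E1 /m.
apply: (mulIf (lt0r_neq0 W0)).
have -> : Q * I 0 L psi * I 0 L t = (Q * I 0 L t) * I 0 L psi by ring.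
rewrite -E2.
by field; rewrite lt0r_neq0.
Qed.

Definition real_wderiv L f g := forall phi, real_test L phi ->
  I 0 L (fun x => f x * derive1 phi x) = - I 0 L (fun x => g x * phi x).

Lemma real_test_sq L phi : real_test L phi -> sq 0 L phi /\ sq 0 L (derive1 phi).
Proof.
move=> [dphi cphi _]; split; apply: continuous_sq => //.
by move=> x; apply: differentiable_continuous; apply/derivable1_diffP.
Qed.

Lemma real_wderiv_unique L f g g' : 0 < L -> sq 0 L g -> sq 0 L g' ->
  real_wderiv L f g -> real_wderiv L f g' -> {ae mu, forall x, x \in `]0, L[ -> g x = g' x}.
Proof.
move=> L0 sg sg' h h'.
suff : {ae mu, forall x, x \in `]0, L[ -> g x - g' x = 0}.
  by move=> H; apply: (aeS H) => x hx /hx /eqP; rewrite subr_eq0 => /eqP.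
apply: fundamental_lemma => //; first by itg_tac.
move=> phi tphi; have [sp _] := real_test_sq tphi.
rewrite (_ : (fun x => _) = (fun x => g x * phi x - g' x * phi x)); last first.
  by apply/funext => x; ring.
rewrite IB; itg_tac.
by have := h phi tphi; rewrite (h' phi tphi) => /oppr_inj ->; rewrite subrr.
Qed.

(** The du Bois-Reymond lemma for [f] minus the primitive of [g]. *)
Lemma real_wderiv_ac L f g : 0 < L -> sq 0 L f -> sq 0 L g -> real_wderiv L f g ->
  exists2 F, ac 0 L F g & {ae mu, forall x, x \in `]0, L[ -> f x = F x}.
Proof.
move=> L0 sf sg h; have aG := I0x_ac sg.
have sG := ac_sq (ltW L0) aG.
have sfG : sq 0 L (fun x => f x - I 0 x g) by itg_tac.
have [|m hm] := du_Bois_Reymond L0 sfG.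
  move=> phi tphi; have [_ sp] := real_test_sq tphi.
  rewrite (_ : (fun x => _) = (fun x => f x * derive1 phi x - I 0 x g * derive1 phi x)); last first.
    by apply/funext => x; ring.
  by rewrite IB; itg_tac; rewrite (ibp_test L0 aG tphi) h// subrr.
exists (fun x => m + I 0 x g).
  apply: ac_eq (acD (ac_cst 0 L m) aG) => x _; exact: add0r.
by apply: (aeS hm) => x hx /hx <-; rewrite subrK.
Qed.

Lemma ac_real_wderiv L F f g : 0 < L -> ac 0 L F g -> sq 0 L f ->
  {ae mu, forall x, x \in `]0, L[ -> f x = F x} -> real_wderiv L f g.
Proof.
move=> L0 aF sf fF phi tphi; rewrite -(ibp_test L0 aF tphi).
have [_ sp] := real_test_sq tphi; have sF := ac_sq (ltW L0) aF.
apply: I_ae_eq; [apply: itg_meas; itg_tac..|].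
by apply: (aeS fF) => x hx /hx ->.
Qed.

Lemma real_wderivD L f g f' g' : sq 0 L f -> sq 0 L g -> sq 0 L f' -> sq 0 L g' ->
  real_wderiv L f g -> real_wderiv L f' g' -> real_wderiv L (fun x => f x + f' x) (fun x => g x + g' x).
Proof.
move=> sf sg sf' sg' h h' phi tphi; have [sp sdp] := real_test_sq tphi.
under [X in I _ _ X]eq_fun do rewrite mulrDl.
under [X in - I _ _ X]eq_fun do rewrite mulrDl.
by rewrite !ID; itg_tac; rewrite h// h'// opprD.
Qed.

Lemma real_wderivZ L k f g : sq 0 L f -> sq 0 L g -> real_wderiv L f g ->
  real_wderiv L (fun x => k * f x) (fun x => k * g x).
Proof.
move=> sf sg h phi tphi; have [sp sdp] := real_test_sq tphi.
under [X in I _ _ X]eq_fun do rewrite -mulrA.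
under [X in - I _ _ X]eq_fun do rewrite -mulrA.
by rewrite !IZ; itg_tac; rewrite h// mulrN.
Qed.
End DuBoisReymond.

(** * Weak derivatives of complex-valued functions *)

Section ComplexFunctions.
Local Open Scope complex_scope.
Context {R : realType}.
Implicit Types (L x y : R) (f g h : R -> R[i]) (k z : R[i]).
Local Notation mu := (@lebesgue_measure R).
Local Notation Re := complex.Re.
Local Notation Im := complex.Im.

Lemma ReM z k : Re (z * k) = Re z * Re k - Im z * Im k. Proof. by case: z k => [? ?] []. Qed.
Lemma ImM z k : Im (z * k) = Re z * Im k + Im z * Re k. Proof. by case: z k => [? ?] []. Qed.

Definition aeq L f g := {ae mu, forall x, x \in `]0, L[ -> f x = g x}.

Record L2parts L f : Prop := L2Parts {
  ld_1 : sq 0 L (fun x => Re (f x)); ld_2 : sq 0 L (fun x => Im (f x)) }.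

Lemma L2P L f : L2 L f <-> L2parts L f.
Proof.
split=> [[m1 m2 h]|[s1 s2]].
  have ms : measurable_fun `]0, L[ (fun x => sqmod (f x)).
    rewrite /sqmod; apply: measurable_funD; exact: measurable_funX.
  have isq : itg 0 L (fun x => sqmod (f x)).
    apply/integrableP; split; first exact/measurable_EFinP.
    apply: le_lt_trans h; apply: ge0_le_integral => //.
    - by apply: measurableT_comp => //; exact/measurable_EFinP.
    - exact/measurable_EFinP.
    - by move=> x _ /=; rewrite lee_fin ger0_norm// addr_ge0 ?sqr_ge0.
  have s0 x : 0 <= Re (f x) ^+ 2 /\ 0 <= Im (f x) ^+ 2 by rewrite !sqr_ge0.
  split; split=> //; apply: itg_le isq _; try exact: measurable_funX.
    by move=> x _; rewrite ger0_norm ?sqr_ge0// lerDl sqr_ge0.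
  by move=> x _; rewrite ger0_norm ?sqr_ge0// lerDr sqr_ge0.
have isq : itg 0 L (fun x => sqmod (f x)) by rewrite /sqmod; itg_tac.
split; [exact: s1.1|exact: s2.1|].
have /integrableP[_] := isq; apply: le_lt_trans.
have mi : measurable_fun `]0, L[ (EFin \o (fun x => sqmod (f x))) by have /integrableP[] := isq.
apply: ge0_le_integral => //.
- by move=> x _; rewrite lee_fin addr_ge0 ?sqr_ge0.
- exact: measurableT_comp.
- by move=> x _ /=; rewrite lee_fin ler_norm.
Qed.

Lemma L2parts0 L : L2parts L 0.
Proof. by split; exact: sq_cst. Qed.

Lemma Re_lin k f g : (fun x => Re ((k *: f + g) x)) =
  fun x => Re k * Re (f x) + - Im k * Im (f x) + Re (g x).
Proof. by apply/funext => x; rewrite raddfD/= ReM mulNr. Qed.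

Lemma Im_lin k f g : (fun x => Im ((k *: f + g) x)) =
  fun x => Re k * Im (f x) + Im k * Re (f x) + Im (g x).
Proof. by apply/funext => x; rewrite raddfD/= ImM. Qed.

Lemma L2parts_lin L k f g : L2parts L f -> L2parts L g -> L2parts L (k *: f + g).
Proof.
by move=> [? ?] [? ?]; split; rewrite (Re_lin, Im_lin); itg_tac.
Qed.

Lemma L2parts_mul L (b : R -> R) (M : R) f : measurable_fun `]0, L[ b ->
  (forall x, x \in `]0, L[ -> `|b x| <= M) -> L2parts L f ->
  L2parts L (fun x => (b x)%:C * f x).
Proof.
move=> mb hb [s1 s2]; split.
  under [X in sq _ _ X]eq_fun do rewrite ReM/= mul0r subr0.
  exact: sqM_bnd hb s1.
under [X in sq _ _ X]eq_fun do rewrite ImM/= mul0r addr0.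
exact: sqM_bnd hb s2.
Qed.

Record has_wderiv L f g : Prop := HasWderiv {
  hd_f : L2parts L f; hd_g : L2parts L g;
  hd_1 : real_wderiv L (fun x => Re (f x)) (fun x => Re (g x));
  hd_2 : real_wderiv L (fun x => Im (f x)) (fun x => Im (g x)) }.

Lemma test_real L (phi : R -> R) : real_test L phi -> test_function L (fun x => (phi x)%:C).
Proof.
move=> [dphi cphi [al [be [a0 bL z]]]].
have z0 : derive1 (fun=> 0 : R) = (fun=> 0).
  by apply/funext => x; rewrite derive1_cst.
split; [|exact: cphi| |].
- by move=> x; split; [exact: dphi|exact: derivable_cst].
- by rewrite /= z0; exact: cst_continuous.
- by exists al, be; split=> // x /z ->.
Qed.

Lemma cderive_real (phi : R -> R) x : cderive (fun x => (phi x)%:C) x = (derive1 phi x)%:C.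
Proof. by rewrite /cderive/= derive1_cst. Qed.

Lemma test_parts L f : test_function L f ->
  real_test L (fun x => Re (f x)) /\ real_test L (fun x => Im (f x)).
Proof.
move=> [d c1 c2 [al [be [a0 bL z]]]].
split; split; [by move=> x; have [] := d x|exact: c1|exists al, be; split; [exact: a0|exact: bL|by move=> x /z ->]
  |by move=> x; have [] := d x|exact: c2|exists al, be; split; [exact: a0|exact: bL|by move=> x /z ->]].
Qed.

(** Real test functions, regarded as complex ones, already separate the real and imaginary parts;
    the converse expands the complex products. *)
Lemma weak_derivativeP L f g : L2parts L f -> L2parts L g ->
  weak_derivative L f g <-> has_wderiv L f g.
Proof.
move=> lf lg; have [f1 f2] := lf; have [g1 g2] := lg; split=> [h|[_ _ h1 h2] phi tphi].
  have key phi : real_test L phi ->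
      I 0 L (fun x => Re (f x) * derive1 phi x) = - I 0 L (fun x => Re (g x) * phi x) /\
      I 0 L (fun x => Im (f x) * derive1 phi x) = - I 0 L (fun x => Im (g x) * phi x).
    move=> tphi; have /eqP := h _ (test_real tphi).
    rewrite /cintegral eq_complex/= => /andP[/eqP e1 /eqP e2]; split.
      transitivity (I 0 L (fun x => Re (f x * cderive (fun x => (phi x)%:C) x))).
        by apply: I_eq => x _; rewrite ReM cderive_real/= mulr0 subr0.
      rewrite [LHS]e1; congr (- _); apply: I_eq => x _.
      by rewrite ReM/= mulr0 subr0.
    transitivity (I 0 L (fun x => Im (f x * cderive (fun x => (phi x)%:C) x))).
      by apply: I_eq => x _; rewrite ImM cderive_real/= mulr0 add0r.
    rewrite [LHS]e2; congr (- _); apply: I_eq => x _.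
    by rewrite ImM/= mulr0 add0r.
  by split=> // phi /key[].
have [t1 t2] := test_parts tphi.
have [s1 ds1] := real_test_sq t1; have [s2 ds2] := real_test_sq t2.
apply/eqP; rewrite /cintegral eq_complex/=; apply/andP; split; apply/eqP.
  transitivity (I 0 L (fun x => Re (f x) * derive1 (fun x => Re (phi x)) x
      - Im (f x) * derive1 (fun x => Im (phi x)) x)).
    by apply: I_eq => x _; rewrite ReM.
  rewrite [in RHS](_ : (fun x => _) = (fun x => Re (g x) * Re (phi x) - Im (g x) * Im (phi x))); last first.
    by apply/funext => x; rewrite ReM.
  by rewrite -/(I 0 L _) !IB; itg_tac; rewrite h1// h2// opprD.
transitivity (I 0 L (fun x => Re (f x) * derive1 (fun x => Im (phi x)) x
    + Im (f x) * derive1 (fun x => Re (phi x)) x)).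
  by apply: I_eq => x _; rewrite ImM.
rewrite [in RHS](_ : (fun x => _) = (fun x => Re (g x) * Im (phi x) + Im (g x) * Re (phi x))); last first.
  by apply/funext => x; rewrite ImM.
by rewrite -/(I 0 L _) !ID; itg_tac; rewrite h1// h2// opprD.
Qed.

Lemma has_wderiv_wderiv L f g : has_wderiv L f g -> has_wderiv L f (wderiv L f).
Proof.
move=> h; have : [set g | L2 L g /\ weak_derivative L f g] (wderiv L f).
  (* The witness [g] excludes the default value 0 of the choice in [wderiv]. *)
  apply: xgetPex; exists g; split; first exact/L2P/(hd_g h).
  by apply/weak_derivativeP => //; [exact: hd_f h|exact: hd_g h].
by move=> [/L2P l2 /weak_derivativeP]; apply=> //; exact: hd_f h.
Qed.

Lemma H1P L f : H1 L f <-> has_wderiv L f (wderiv L f).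
Proof.
split=> [[/L2P lf [g [/L2P lg /(weak_derivativeP lf lg)/has_wderiv_wderiv]]]//|h].
split; first exact/L2P/(hd_f h).
exists (wderiv L f); split; first exact/L2P/(hd_g h).
by apply/weak_derivativeP => //; [exact: hd_f h|exact: hd_g h].
Qed.

Lemma has_wderivP L f : L2parts L f -> has_L2_wderiv L f <-> has_wderiv L f (wderiv L f).
Proof.
move=> lf; split; last by move=> /H1P[].
by move=> h; apply/H1P; split => //; apply/L2P.
Qed.

Lemma has_wderiv_H1 L f g : has_wderiv L f g -> H1 L f.
Proof. by move=> /has_wderiv_wderiv/H1P. Qed.

Lemma complex_eq z k : Re z = Re k -> Im z = Im k -> z = k.
Proof. by case: z k => [? ?] [? ?] /= -> ->. Qed.

Lemma has_wderiv_unique L f g h : 0 < L -> has_wderiv L f g -> has_wderiv L f h -> aeq L g h.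
Proof.
move=> L0 [_ [g1 g2] rg1 rg2] [_ [h1 h2] rh1 rh2].
have := aeI (real_wderiv_unique L0 g1 h1 rg1 rh1) (real_wderiv_unique L0 g2 h2 rg2 rh2).
by move=> H; apply: (aeS H) => x [e1 e2] hx; apply: complex_eq; auto.
Qed.

Lemma real_wderiv_ae L (f f' g g' : R -> R) : sq 0 L f -> sq 0 L f' -> sq 0 L g -> sq 0 L g' ->
  {ae mu, forall x, x \in `]0, L[ -> f x = f' x} ->
  {ae mu, forall x, x \in `]0, L[ -> g x = g' x} -> real_wderiv L f g -> real_wderiv L f' g'.
Proof.
move=> s1 s2 s3 s4 ef eg h phi tphi; have [s5 s6] := real_test_sq tphi.
rewrite -(@I_ae_eq _ _ _ (fun x => f x * derive1 phi x)).
- rewrite h// (@I_ae_eq _ _ _ _ (fun x => g' x * phi x))//; try by apply: itg_meas; itg_tac.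
  by apply: (aeS eg) => x hx /hx ->.
- by apply: itg_meas; itg_tac.
- by apply: itg_meas; itg_tac.
- by apply: (aeS ef) => x hx /hx ->.
Qed.

Lemma has_wderiv_ae L f g f' g' : L2parts L f' -> L2parts L g' -> aeq L f f' -> aeq L g g' ->
  has_wderiv L f g -> has_wderiv L f' g'.
Proof.
move=> lf' lg' ef eg [lf lg h1 h2].
have [? ?] := lf; have [? ?] := lg; have [? ?] := lf'; have [? ?] := lg'.
split=> //.
  apply: real_wderiv_ae h1 => //.
    by apply: (aeS ef) => x hx /hx ->.
  by apply: (aeS eg) => x hx /hx ->.
apply: real_wderiv_ae h2 => //.
  by apply: (aeS ef) => x hx /hx ->.
by apply: (aeS eg) => x hx /hx ->.
Qed.

Lemma has_wderiv_lin L k f g f' g' : has_wderiv L f g -> has_wderiv L f' g' ->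
  has_wderiv L (k *: f + f') (k *: g + g').
Proof.
move=> [lf lg r1 r2] [lf' lg' r1' r2'].
split; [exact: L2parts_lin|exact: L2parts_lin| |].
  rewrite !Re_lin; have [? ?] := lf; have [? ?] := lg; have [? ?] := lf'; have [? ?] := lg'.
  by do 2?(apply: real_wderivD; itg_tac) => //; exact: real_wderivZ.
rewrite !Im_lin; have [? ?] := lf; have [? ?] := lg; have [? ?] := lf'; have [? ?] := lg'.
by do 2?(apply: real_wderivD; itg_tac) => //; exact: real_wderivZ.
Qed.

Lemma has_wderiv_test L phi : 0 < L -> test_function L phi -> has_wderiv L phi (cderive phi).
Proof.
move=> L0 tphi; have [t1 t2] := test_parts tphi.
have [? ?] := real_test_sq t1; have [? ?] := real_test_sq t2.
have [d1 c1 _] := t1; have [d2 c2 _] := t2.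
split; [by split|by split| |].
  apply: (ac_real_wderiv L0 (ac_of_C1 0 L d1 c1)) => //.
  by apply: (aeS (ae_eq_refl mu setT (fun=> 0 : R))).
apply: (ac_real_wderiv L0 (ac_of_C1 0 L d2 c2)) => //.
by apply: (aeS (ae_eq_refl mu setT (fun=> 0 : R))).
Qed.

End ComplexFunctions.

(** * The space H^1_0 and its boundary values *)

Section SobolevZero.
Local Open Scope complex_scope.
Context {R : realType}.
Implicit Types (L x y : R) (f g h : R -> R[i]) (k z : R[i]).
Local Notation mu := (@lebesgue_measure R).
Local Notation Re := complex.Re.
Local Notation Im := complex.Im.

Lemma I_eq0 (al be : R) (f : R -> R) : (forall x, f x = 0) -> I al be f = 0.
Proof.
move=> h; rewrite -(mul0r (I al be f)) -IZ; first by apply: I_eq => x _; rewrite h mul0r.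
by apply: itg_eq (itg_cst al be 0) => x _; rewrite h.
Qed.

Lemma real_test_lin L (a b : R) (phi psi chi : R -> R) : real_test L phi -> real_test L psi -> real_test L chi ->
  real_test L (fun x => a * phi x + b * psi x + chi x) /\
  derive1 (fun x => a * phi x + b * psi x + chi x) =
  fun x => a * derive1 phi x + b * derive1 psi x + derive1 chi x.
Proof.
move=> [d1 c1 [al1 [be1 [a1 b1 z1]]]] [d2 c2 [al2 [be2 [a2 b2 z2]]]] [d3 c3 [al3 [be3 [a3 b3 z3]]]].
have Z1 x : derivable (a *: phi) x 1 by apply: derivableZ; exact: d1.
have Z2 x : derivable (b *: psi) x 1 by apply: derivableZ; exact: d2.
have Z12 x : derivable (a *: phi + b *: psi) x 1 by apply: derivableD; [exact: Z1|exact: Z2].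
have D x : derivable (a *: phi + b *: psi + chi) x 1 by apply: derivableD; [exact: Z12|exact: d3].
have E : derive1 (fun x => a * phi x + b * psi x + chi x) =
    fun x => a * derive1 phi x + b * derive1 psi x + derive1 chi x.
  apply/funext => x; rewrite !derive1E.
  transitivity ('D_1 (a *: phi + b *: psi + chi) x); first by [].
  rewrite (deriveD (Z12 x) (d3 x)) (deriveD (Z1 x) (Z2 x)).
  by rewrite (deriveZ a (d1 x)) (deriveZ b (d2 x)).
split; last exact: E.
split; [exact: D| |].
  have C1 : continuous (fun x => a * derive1 phi x).
    by move=> x; apply: continuousM; [exact: cvg_cst|exact: c1].
  have C2 : continuous (fun x => b * derive1 psi x).
    by move=> x; apply: continuousM; [exact: cvg_cst|exact: c2].
  have C12 : continuous (fun x => a * derive1 phi x + b * derive1 psi x).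
    by move=> x; apply: (@continuousD _ _ _ (fun x => a * derive1 phi x) (fun x => b * derive1 psi x)); [exact: C1|exact: C2].
  by rewrite E => x; apply: (@continuousD _ _ _ (fun x => a * derive1 phi x + b * derive1 psi x) (derive1 chi)); [exact: C12|exact: c3].
exists (Num.min al1 (Num.min al2 al3)), (Num.max be1 (Num.max be2 be3)).
split; [by rewrite !lt_min a1 a2|by rewrite !gt_max b1 b2|].
move=> x hx; rewrite z1 ?z2 ?z3 ?mulr0 ?addr0//.
- by apply: contra hx; rewrite !in_itv/= !ge_min !le_max => /andP[-> ->]; rewrite !orbT.
- by apply: contra hx; rewrite !in_itv/= !ge_min !le_max => /andP[-> ->]; rewrite !orbT.
- by apply: contra hx; rewrite !in_itv/= !ge_min !le_max => /andP[-> ->].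
Qed.

Lemma test_of_parts L f : real_test L (fun x => Re (f x)) -> real_test L (fun x => Im (f x)) ->
  test_function L f.
Proof.
move=> [d1 c1 [al1 [be1 [a1 b1 z1]]]] [d2 c2 [al2 [be2 [a2 b2 z2]]]].
split; [by move=> x; split; [exact: d1|exact: d2]|exact: c1|exact: c2|].
exists (Num.min al1 al2), (Num.max be1 be2).
split; [by rewrite lt_min a1|by rewrite gt_max b1|].
move=> x hx; apply: complex_eq => /=.
- by apply: z1; apply: contra hx; rewrite !in_itv/= !ge_min !le_max => /andP[-> ->].
- by apply: z2; apply: contra hx; rewrite !in_itv/= !ge_min !le_max => /andP[-> ->]; rewrite !orbT.
Qed.

Lemma real_test0 L : 0 < L -> real_test L (fun=> 0).
Proof.
move=> L0; split; [move=> x; exact: derivable_cst| |].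
  rewrite (_ : derive1 _ = fun=> 0); last by apply/funext => x; rewrite derive1_cst.
  exact: cst_continuous.
by exists (L / 2), (L / 2); split=> //; lra.
Qed.

Lemma test0 L : 0 < L -> test_function L 0.
Proof. by move=> L0; apply: test_of_parts; exact: real_test0. Qed.

Lemma test_lin L k f g : test_function L f -> test_function L g -> test_function L (k *: f + g).
Proof.
move=> /test_parts[f1 f2] /test_parts[g1 g2]; apply: test_of_parts.
  by rewrite Re_lin; exact: (real_test_lin _ _ f1 f2 g1).1.
by rewrite Im_lin; exact: (real_test_lin _ _ f2 f1 g2).1.
Qed.

Lemma sqmod_itg L f : L2parts L f -> itg 0 L (fun x => sqmod (f x)).
Proof. by move=> [? ?]; rewrite /sqmod; itg_tac. Qed.

Lemma L2sqnorm_ge0 L f : 0 <= L2sqnorm L f.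
Proof. by apply: I_ge0 => x _; rewrite addr_ge0 ?sqr_ge0. Qed.

Lemma L2sqnorm_ae L f g : L2parts L f -> L2parts L g -> aeq L f g -> L2sqnorm L f = L2sqnorm L g.
Proof.
move=> lf lg e; apply: I_ae_eq; try by apply: itg_meas; exact: sqmod_itg.
by apply: (aeS e) => x hx /hx ->.
Qed.

Lemma L2sqnorm_lin L k f g : L2parts L f -> L2parts L g ->
  L2sqnorm L (k *: f + g) <= 2 * sqmod k * L2sqnorm L f + 2 * L2sqnorm L g.
Proof.
move=> lf lg; rewrite -!IZ ?sqmod_itg// -ID; try by apply: itgZ; exact: sqmod_itg.
apply: I_le; [by apply: sqmod_itg; exact: L2parts_lin|by apply: itgD; apply: itgZ; exact: sqmod_itg|].
move=> x _; have e1 : Re ((k *: f + g) x) = Re k * Re (f x) + - Im k * Im (f x) + Re (g x).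
  by have /funeqP := Re_lin k f g; apply.
have e2 : Im ((k *: f + g) x) = Re k * Im (f x) + Im k * Re (f x) + Im (g x).
  by have /funeqP := Im_lin k f g; apply.
rewrite /sqmod e1 e2 /=.
have := sqr_ge0 (Re k * Re (f x) + - Im k * Im (f x) - Re (g x)).
have := sqr_ge0 (Re k * Im (f x) + Im k * Re (f x) - Im (g x)).
by move: (Re k) (Im k) (Re (f x)) (Im (f x)) (Re (g x)) (Im (g x)) => *; lra.
Qed.

(** Any weak derivative at hand may replace the chosen one, as the two agree almost everywhere. *)
Lemma H1norm_ltP L f g (e : R) : 0 < L -> 0 < e -> has_wderiv L f g ->
  (H1norm L f < e) <-> (L2sqnorm L f + L2sqnorm L g < e ^+ 2).
Proof.
move=> L0 e0 h; suff -> : (H1norm L f < e) = (L2sqnorm L f + L2sqnorm L g < e ^+ 2) by [].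
have h' := has_wderiv_wderiv h.
rewrite /H1norm -(ltr_pXn2r (n := 2))// ?nnegrE ?sqrtr_ge0 ?(ltW e0)//.
rewrite sqr_sqrtr ?addr_ge0 ?L2sqnorm_ge0//.
by rewrite (L2sqnorm_ae (hd_g h') (hd_g h) (has_wderiv_unique L0 h' h)).
Qed.

Lemma has_wderiv0 L : has_wderiv L 0 0.
Proof.
by split; [exact: L2parts0|exact: L2parts0| |] => phi _; rewrite !I_eq0 ?oppr0// => x; rewrite mul0r.
Qed.

Lemma L2sqnorm0 L : L2sqnorm L 0 = 0.
Proof.
by apply: I_eq0 => x; rewrite /sqmod/= expr0n addr0.
Qed.

Lemma H10_0 L : 0 < L -> H10 L 0.
Proof.
move=> L0; split; first exact: has_wderiv_H1 (has_wderiv0 L).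
move=> e e0; exists 0; first exact: test0.
by rewrite subr0; apply/(H1norm_ltP L0 e0 (has_wderiv0 L)); rewrite !L2sqnorm0 addr0 exprn_gt0.
Qed.

Lemma has_wderivB L f g f' g' : has_wderiv L f g -> has_wderiv L f' g' -> has_wderiv L (f - f') (g - g').
Proof.
move=> h h'; have := has_wderiv_lin (-1) h' h.
by rewrite !scaleN1r ![- _ + _]addrC.
Qed.

Lemma H10_lin_arith (E A s x1 y1 x2 y2 : R) : 2 * s * (x1 + y1) <= 2 * s * E ->
  E * (2 * s + 2) <= A -> x2 + y2 < E ->
  2 * s * x1 + 2 * x2 + (2 * s * y1 + 2 * y2) < A.
Proof. by lra. Qed.

Lemma H10_lin L k f g : 0 < L -> H10 L f -> H10 L g -> H10 L (k *: f + g).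
Proof.
move=> L0 [/H1P hf af] [/H1P hg ag]; split; first exact: has_wderiv_H1 (has_wderiv_lin k hf hg).
(* Accuracy [e / M] for both approximations gives a squared error below [M (e / M)^2], at most [e^2]
   because [M >= 1]. *)
move=> e e0; pose M := 2 * sqmod k + 2.
have s0 : 0 <= sqmod k by rewrite addr_ge0 ?sqr_ge0.
have M2 : 2 <= M by rewrite /M; lra.
have M0 : 0 < M by lra.
have iM : M^-1 <= 1 by rewrite invf_le1//; lra.
have d0 : 0 < e / M by rewrite divr_gt0.
have [phi tphi nphi] := af _ d0; have [psi tpsi npsi] := ag _ d0.
exists (k *: phi + psi); first exact: test_lin.
have h1 := has_wderivB hf (has_wderiv_test L0 tphi); have h2 := has_wderivB hg (has_wderiv_test L0 tpsi).
have := has_wderiv_lin k h1 h2.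
rewrite (_ : k *: (f - phi) + (g - psi) = k *: f + g - (k *: phi + psi)); last first.
  by rewrite scalerBr opprD addrACA.
have n1 := (H1norm_ltP L0 d0 h1).1 nphi; have n2 := (H1norm_ltP L0 d0 h2).1 npsi.
move=> h3; apply: (H1norm_ltP L0 e0 h3).2.
have l1 := L2sqnorm_lin k (hd_f h1) (hd_f h2).
have l2 := L2sqnorm_lin k (hd_g h1) (hd_g h2).
rewrite (_ : k *: (f - phi) + (g - psi) = k *: f + g - (k *: phi + psi)) in l1; last first.
  by rewrite scalerBr opprD addrACA.
apply: (le_lt_trans (lerD l1 l2)).
have q1 := ler_wpM2l (mulr_ge0 (ler0n R 2) s0) (ltW n1).
have q2 : (e / M) ^+ 2 * M <= e ^+ 2.
  rewrite exprMn -mulrA ler_piMr ?sqr_ge0// expr2 -mulrA mulVf ?mulr1 ?lt0r_neq0//.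
exact: (H10_lin_arith q1 q2 n2).
Qed.

(** The representative minus an approximating test function is bounded pointwise by the H^1 norm of
    the difference, through [ac_interp] with weight 1, whence [C = L^-1 + 1]. Test functions vanish
    at 0 and L, so the boundary values are arbitrarily small. *)
Lemma H10_trace L f g : 0 < L -> H10 L f -> has_wderiv L f g -> exists F1 F2 : R -> R,
  [/\ ac 0 L F1 (fun x => Re (g x)), ac 0 L F2 (fun x => Im (g x)),
    {ae mu, forall x, x \in `]0, L[ -> f x = F1 x +i* F2 x} &
    [/\ F1 0 = 0, F2 0 = 0, F1 L = 0 & F2 L = 0]].
Proof.
move=> L0 [_ af] h; have [[f1 f2] [g1 g2] r1 r2] := h.
have [F1 a1 e1] := real_wderiv_ac L0 f1 g1 r1; have [F2 a2 e2] := real_wderiv_ac L0 f2 g2 r2.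
exists F1, F2; split=> //.
  by apply: (aeS (aeI e1 e2)) => x [h1 h2] hx; apply: complex_eq; [exact: h1|exact: h2].
pose C := L^-1 + 1.
have C1 : 1 <= C by rewrite /C lerDr invr_ge0 ltW.
have small (t : R) : (forall e, 0 < e -> t ^+ 2 <= C * e ^+ 2) -> t = 0.
  move=> H; apply/eqP; rewrite -sqrf_eq0; apply/eqP/le_anti; rewrite sqr_ge0 andbT.
  apply/ler_addgt0Pr => e e0; rewrite add0r.
  have d0 : 0 < Num.min 1 (e / C) by rewrite lt_min ltr01 divr_gt0//; lra.
  apply: (le_trans (H _ d0)).
  have m1 : Num.min 1 (e / C) <= 1 by rewrite ge_min lexx.
  have m2 : Num.min 1 (e / C) <= e / C by rewrite ge_min lexx orbT.
  rewrite mulrC -ler_pdivlMr ?expr2; last lra.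
  by apply: le_trans m2; rewrite ler_piMr// ltW.
have main (F G phi : R -> R) : ac 0 L F G -> real_test L phi -> forall (e : R),
    I 0 L (fun x => (F x - phi x) ^+ 2) + I 0 L (fun x => (G x - derive1 phi x) ^+ 2) <= e ^+ 2 ->
    F 0 ^+ 2 <= C * e ^+ 2 /\ F L ^+ 2 <= C * e ^+ 2.
  move=> aF tphi e he; have [p0 pL] := real_test_vanish tphi; have [d c _] := tphi.
  have aB := acB aF (ac_of_C1 0 L d c).
  have K x : 0 <= x <= L -> (F x - phi x) ^+ 2 <= C * e ^+ 2.
    move=> hx; apply: (le_trans (ac_interp L0 ltr01 aB hx)).
    rewrite subr0 invr1 mul1r -/C.
    set A := I _ _ _ in he *; set B := I _ _ _ in he *.
    have B0 : 0 <= B by apply: I_ge0 => ? _; exact: sqr_ge0.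
    apply: (@le_trans _ _ (C * (A + B))); last by apply: ler_wpM2l => //; lra.
    by rewrite mulrDr lerD2l ler_peMl.
  split; first by have := K 0; rewrite p0 subr0; apply; rewrite lexx ltW.
  by have := K L; rewrite pL subr0; apply; rewrite lexx ltW.
have app (e : R) : 0 < e -> [/\ F1 0 ^+ 2 <= C * e ^+ 2, F2 0 ^+ 2 <= C * e ^+ 2,
    F1 L ^+ 2 <= C * e ^+ 2 & F2 L ^+ 2 <= C * e ^+ 2].
  move=> e0; have [phi tphi nphi] := af _ e0.
  have hB := has_wderivB h (has_wderiv_test L0 tphi).
  have he := (H1norm_ltP L0 e0 hB).1 nphi.
  have [t1 t2] := test_parts tphi; have [s1 ds1] := real_test_sq t1; have [s2 ds2] := real_test_sq t2.
  have [lf lg _ _] := hB.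
  have sF1 := ac_sq (ltW L0) a1; have sF2 := ac_sq (ltW L0) a2.
  have M1 : I 0 L (fun x => (F1 x - Re (phi x)) ^+ 2) <= L2sqnorm L (f - phi).
    apply: I_le_ae; [by itg_tac|exact: sqmod_itg|].
    by apply: (aeS e1) => x hx /hx <-; rewrite /sqmod !raddfB/= lerDl sqr_ge0.
  have M2 : I 0 L (fun x => (F2 x - Im (phi x)) ^+ 2) <= L2sqnorm L (f - phi).
    apply: I_le_ae; [by itg_tac|exact: sqmod_itg|].
    by apply: (aeS e2) => x hx /hx <-; rewrite /sqmod !raddfB/= lerDr sqr_ge0.
  have N1 : I 0 L (fun x => (Re (g x) - derive1 (fun x => Re (phi x)) x) ^+ 2) <= L2sqnorm L (g - cderive phi).
    apply: I_le; [by itg_tac|exact: sqmod_itg|].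
    by move=> x _; rewrite /sqmod !raddfB/= lerDl sqr_ge0.
  have N2 : I 0 L (fun x => (Im (g x) - derive1 (fun x => Im (phi x)) x) ^+ 2) <= L2sqnorm L (g - cderive phi).
    apply: I_le; [by itg_tac|exact: sqmod_itg|].
    by move=> x _; rewrite /sqmod !raddfB/= lerDr sqr_ge0.
  have [] := main _ _ _ a1 t1 e (le_trans (lerD M1 N1) (ltW he)).
  by have [] := main _ _ _ a2 t2 e (le_trans (lerD M2 N2) (ltW he)).
by split; apply: small => e /app[].
Qed.

End SobolevZero.

(** * The energy space and the damped operator *)

Section EnergyInnerProduct.
Local Open Scope complex_scope.
Context {R : realType}.
Implicit Types (L x y : R) (f g h : R -> R[i]) (k z : R[i]).
Local Notation mu := (@lebesgue_measure R).
Local Notation Re := complex.Re.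
Local Notation Im := complex.Im.

Definition cdot L f g := cintegral L (fun x => f x * conjc (g x)).

Lemma aeq_refl L f : aeq L f f.
Proof. by apply: (aeS (ae_eq_refl mu setT (fun=> 0 : R))). Qed.

Lemma aeq_sym L f g : aeq L f g -> aeq L g f.
Proof. by move=> h1; apply: (aeS h1) => x e1 hx; rewrite e1. Qed.

Lemma I_ae (al be : R) (f g : R -> R) : itg al be f -> itg al be g ->
  {ae mu, forall x, x \in `]al, be[ -> f x = g x} -> I al be f = I al be g.
Proof. by move=> h1 h2; apply: I_ae_eq; exact: itg_meas. Qed.

Lemma ReMc z k : Re (z * conjc k) = Re z * Re k + Im z * Im k.
Proof. by case: z k => [? ?] [? ?] /=; rewrite mulrN opprK. Qed.

Lemma ImMc z k : Im (z * conjc k) = Im z * Re k - Re z * Im k.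
Proof. by case: z k => [? ?] [? ?] /=; rewrite mulrN addrC. Qed.

Lemma cdotE L f g : L2parts L f -> L2parts L g -> cdot L f g =
  (I 0 L (fun x => Re (f x) * Re (g x)) + I 0 L (fun x => Im (f x) * Im (g x))) +i*
  (I 0 L (fun x => Im (f x) * Re (g x)) - I 0 L (fun x => Re (f x) * Im (g x))).
Proof.
move=> [f1 f2] [g1 g2].
have e1 : I 0 L (fun x => Re (f x * conjc (g x))) =
    I 0 L (fun x => Re (f x) * Re (g x)) + I 0 L (fun x => Im (f x) * Im (g x)).
  by rewrite -ID; itg_tac; apply: I_eq => x _; exact: ReMc.
have e2 : I 0 L (fun x => Im (f x * conjc (g x))) =
    I 0 L (fun x => Im (f x) * Re (g x)) - I 0 L (fun x => Re (f x) * Im (g x)).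
  by rewrite -IB; itg_tac; apply: I_eq => x _; exact: ImMc.
by rewrite -e1 -e2.
Qed.

Lemma four_lin (k z v1 v2 u1 u2 w1 w2 y1 y2 : R[i]) :
  k * v1 + v2 + z * (k * u1 + u2) + (k * w1 + w2) + (k * y1 + y2) =
  k * (v1 + z * u1 + w1 + y1) + (v2 + z * u2 + w2 + y2).
Proof. by ring. Qed.

Lemma I_lin L (p q : R) (f1 f2 f3 g : R -> R) : sq 0 L f1 -> sq 0 L f2 -> sq 0 L f3 -> sq 0 L g ->
  I 0 L (fun x => (p * f1 x + q * f2 x + f3 x) * g x) =
  p * I 0 L (fun x => f1 x * g x) + q * I 0 L (fun x => f2 x * g x) + I 0 L (fun x => f3 x * g x).
Proof.
move=> s1 s2 s3 sg; rewrite -!IZ -?ID; itg_tac.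
by apply: I_eq => x _; ring.
Qed.

Lemma cdot_linl L k f f' g : L2parts L f -> L2parts L f' -> L2parts L g ->
  cdot L (k *: f + f') g = k * cdot L f g + cdot L f' g.
Proof.
move=> lf lf' lg; rewrite !cdotE//; last exact: L2parts_lin.
have [f1 f2] := lf; have [f1' f2'] := lf'; have [g1 g2] := lg.
have /funeqP e1 := Re_lin k f f'; have /funeqP e2 := Im_lin k f f'.
have E1 (G : R -> R) : sq 0 L G -> I 0 L (fun x => Re ((k *: f + f') x) * G x) =
    Re k * I 0 L (fun x => Re (f x) * G x) + - Im k * I 0 L (fun x => Im (f x) * G x)
    + I 0 L (fun x => Re (f' x) * G x).
  by move=> sG; rewrite -I_lin//; apply: I_eq => x _; rewrite e1.
have E2 (G : R -> R) : sq 0 L G -> I 0 L (fun x => Im ((k *: f + f') x) * G x) =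
    Re k * I 0 L (fun x => Im (f x) * G x) + Im k * I 0 L (fun x => Re (f x) * G x)
    + I 0 L (fun x => Im (f' x) * G x).
  by move=> sG; rewrite -I_lin//; apply: I_eq => x _; rewrite e2.
rewrite !E1// !E2//; case: k {e1 e2 E1 E2} => kr ki.
by apply: complex_eq => /=; ring.
Qed.

Lemma cdot_conj L f g : L2parts L f -> L2parts L g -> cdot L g f = conjc (cdot L f g).
Proof.
move=> lf lg; rewrite !cdotE//; apply: complex_eq => /=.
  by congr (_ + _); apply: I_eq => x _; rewrite mulrC.
rewrite opprB; congr (_ - _); apply: I_eq => x _; by rewrite mulrC.
Qed.

Lemma cdot_ae L f f' g g' : L2parts L f -> L2parts L f' -> L2parts L g -> L2parts L g' ->
  aeq L f f' -> aeq L g g' -> cdot L f g = cdot L f' g'.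
Proof.
move=> lf lf' lg lg' ef eg; rewrite !cdotE//.
have [f1 f2] := lf; have [f1' f2'] := lf'; have [g1 g2] := lg; have [g1' g2'] := lg'.
congr (Complex (_ + _) (_ - _)); (apply: I_ae; [by itg_tac|by itg_tac|]);
  by apply: (aeS (aeI ef eg)) => x [e1 e2] hx; rewrite e1// e2.
Qed.

Lemma cdot_self L f : L2parts L f -> Re (cdot L f f) = L2sqnorm L f.
Proof.
move=> lf; have [f1 f2] := lf; rewrite cdotE//= -ID; itg_tac.
by apply: I_eq => x _; rewrite /sqmod !expr2.
Qed.

Lemma innerHE L a (U V : state R) : innerH L a U V =
  cdot L U.1.2 V.1.2 + a%:C * cdot L (wderiv L U.1.1) (wderiv L V.1.1)
  + cdot L U.2.2 V.2.2 + cdot L (wderiv L U.2.1) (wderiv L V.2.1).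
Proof. by case: U V => [[u v] [y z]] [[u1 v1] [y1 z1]]. Qed.

Lemma H10_hasd L f : H10 L f -> has_wderiv L f (wderiv L f).
Proof. by move=> [/H1P]. Qed.

Lemma wderiv_lin L k f g : 0 < L -> has_wderiv L f (wderiv L f) -> has_wderiv L g (wderiv L g) ->
  aeq L (wderiv L (k *: f + g)) (k *: wderiv L f + wderiv L g).
Proof.
move=> L0 hf hg; have h := has_wderiv_lin k hf hg.
exact: (has_wderiv_unique L0 (has_wderiv_wderiv h) h).
Qed.

Lemma conj_four (b : R) (v u w y : R[i]) :
  conjc v + b%:C * conjc u + conjc w + conjc y = conjc (v + b%:C * u + w + y).
Proof. by case: v u w y => [? ?] [? ?] [? ?] [? ?]; apply: complex_eq => /=; ring. Qed.

Lemma Re_four (b : R) (v u w y : R[i]) :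
  Re (v + b%:C * u + w + y) = Re v + b * Re u + Re w + Re y.
Proof. by case: v u w y => [? ?] [? ?] [? ?] [? ?] /=; ring. Qed.

Lemma cdot_wderiv_lin L k f g h : 0 < L -> has_wderiv L f (wderiv L f) -> has_wderiv L g (wderiv L g) ->
  L2parts L h -> cdot L (wderiv L (k *: f + g)) h = k * cdot L (wderiv L f) h + cdot L (wderiv L g) h.
Proof.
move=> L0 hf hg lh; rewrite -(cdot_linl k (hd_g hf) (hd_g hg) lh).
have h4 := has_wderiv_wderiv (has_wderiv_lin k hf hg).
apply: (cdot_ae (hd_g h4) (L2parts_lin k (hd_g hf) (hd_g hg)) lh lh) => //.
  exact: wderiv_lin.
exact: aeq_refl.
Qed.

Record inH_parts L (U : state R) : Prop := InHParts {
  ih_u : has_wderiv L U.1.1 (wderiv L U.1.1); ih_v : L2parts L U.1.2;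
  ih_y : has_wderiv L U.2.1 (wderiv L U.2.1); ih_z : L2parts L U.2.2 }.

Lemma inH_partsP L U : inH L U -> inH_parts L U.
Proof. by move=> [/H10_hasd h1 /L2P h2 /H10_hasd h3 /L2P h4]. Qed.

Lemma inH_lin L k (U V : state R) : 0 < L -> inH L U -> inH L V -> inH L (k *: U + V).
Proof.
move=> L0 [u1 /L2P v1 y1 /L2P z1] [u2 /L2P v2 y2 /L2P z2].
have v3 := (L2P _ _).2 (L2parts_lin k v1 v2); have z3 := (L2P _ _).2 (L2parts_lin k z1 z2).
by split; [exact: (H10_lin k L0 u1 u2)|exact: v3|exact: (H10_lin k L0 y1 y2)|exact: z3].
Qed.

Lemma qfE L a (U : state R) : inH L U -> qf (innerH L a) U =
  L2sqnorm L U.1.2 + a * L2sqnorm L (wderiv L U.1.1)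
  + L2sqnorm L U.2.2 + L2sqnorm L (wderiv L U.2.1).
Proof.
move=> hU; have [u1 v1 y1 z1] := inH_partsP hU.
rewrite /qf innerHE Re_four; congr (_ + _ * _ + _ + _); apply: cdot_self.
- exact: v1.
- exact: hd_g u1.
- exact: z1.
- exact: hd_g y1.
Qed.

Lemma energy_semi_inner L a : 0 < L -> 0 < a -> semi_inner (inH L) (innerH L a).
Proof.
move=> L0 a0; split.
- by split; [exact: H10_0|exact/L2P/L2parts0|exact: H10_0|exact/L2P/L2parts0].
- by move=> k U V; exact: inH_lin.
- move=> k U V W hU hV hW.
  have [u1 v1 y1 z1] := inH_partsP hU; have [u2 v2 y2 z2] := inH_partsP hV.
  have [u3 v3 y3 z3] := inH_partsP hW.
  rewrite [LHS]innerHE.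
  have -> : (k *: U + V).1.1 = k *: U.1.1 + V.1.1 by [].
  have -> : (k *: U + V).1.2 = k *: U.1.2 + V.1.2 by [].
  have -> : (k *: U + V).2.1 = k *: U.2.1 + V.2.1 by [].
  have -> : (k *: U + V).2.2 = k *: U.2.2 + V.2.2 by [].
  rewrite (cdot_linl k v1 v2 v3) (cdot_linl k z1 z2 z3).
  rewrite (cdot_wderiv_lin k L0 u1 u2 (hd_g u3)) (cdot_wderiv_lin k L0 y1 y2 (hd_g y3)).
  rewrite (innerHE L a U W) (innerHE L a V W); exact: four_lin.
- move=> U V hU hV.
  have [u1 v1 y1 z1] := inH_partsP hU; have [u2 v2 y2 z2] := inH_partsP hV.
  rewrite !innerHE (cdot_conj v1 v2) (cdot_conj z1 z2).
  rewrite (cdot_conj (hd_g u1) (hd_g u2)) (cdot_conj (hd_g y1) (hd_g y2)).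
  exact: conj_four.
- move=> U hU; have := qfE a hU; rewrite /qf => ->.
  apply: addr_ge0; last exact: L2sqnorm_ge0.
  apply: addr_ge0; last exact: L2sqnorm_ge0.
  apply: addr_ge0; first exact: L2sqnorm_ge0.
  by apply: mulr_ge0; [exact: ltW|exact: L2sqnorm_ge0].
Qed.

Lemma energyE L a (U : state R) : inH L U -> energy L a U = 2^-1 * qf (innerH L a) U.
Proof.
move=> hU; have [u1 v1 y1 z1] := inH_partsP hU; rewrite qfE//.
case: U u1 v1 y1 z1 {hU} => [[u v] [y z]] /= u1 v1 y1 z1.
have i1 := sqmod_itg v1; have i2 := sqmod_itg (hd_g u1).
have i3 := sqmod_itg z1; have i4 := sqmod_itg (hd_g y1).
have i2' := itgZ a i2; have i12 := itgD i1 i2'; have i123 := itgD i12 i3.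
congr (_ * _); rewrite -/(I 0 L _) (ID i123 i4) (ID i12 i3) (ID i1 i2') (IZ a i2).
by [].
Qed.

Lemma normH_eq0 L a (U : state R) : 0 < L -> inH L U -> aeq L (wderiv L U.1.1) 0 -> aeq L U.1.2 0 ->
  aeq L (wderiv L U.2.1) 0 -> aeq L U.2.2 0 -> normH L a U = 0.
Proof.
move=> L0 hU e1 e2 e3 e4; have [u1 v1 y1 z1] := inH_partsP hU.
rewrite /normH -/(qf _ _) qfE//.
rewrite (L2sqnorm_ae v1 (L2parts0 L) e2) (L2sqnorm_ae z1 (L2parts0 L) e4).
rewrite (L2sqnorm_ae (hd_g u1) (L2parts0 L) e1) (L2sqnorm_ae (hd_g y1) (L2parts0 L) e3).
by rewrite L2sqnorm0 mulr0 !addr0 sqrtr0.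
Qed.

Lemma wderiv0 L : 0 < L -> aeq L (wderiv L 0) 0.
Proof. by move=> L0; exact: (has_wderiv_unique L0 (has_wderiv_wderiv (has_wderiv0 L)) (has_wderiv0 L)). Qed.

End EnergyInnerProduct.

(** * From one component of a state to a wave *)

Section Component.
Local Open Scope complex_scope.
Context {R : realType}.
Implicit Types (L x y la : R) (u v g h : R -> R[i]).
Local Notation mu := (@lebesgue_measure R).
Local Notation Re := complex.Re.
Local Notation Im := complex.Im.

Definition bounded_meas L (b : R -> R) := measurable_fun `]0, L[ b /\
  exists M, forall x, x \in `]0, L[ -> `|b x| <= M.

Lemma local_coef_bounded_meas L (k al be : R) : bounded_meas L (local_coef k al be).
Proof.
split; first exact: local_coef_meas.
exists `|k| => x _; rewrite /local_coef normrM indicE.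
by case: (x \in _); rewrite ?normr1 ?mulr1// normr0 mulr0.
Qed.

Lemma L2parts_mul_bounded L (b : R -> R) f : bounded_meas L b -> L2parts L f -> L2parts L (fun x => (b x)%:C * f x).
Proof. by move=> [mb [M hb]] lf; exact: (L2parts_mul mb hb lf). Qed.

Lemma bounded_measN L (b : R -> R) : bounded_meas L b -> bounded_meas L (fun x => - b x).
Proof.
move=> [mb [M hb]]; split; first exact: measurableT_comp.
by exists M => x hx; rewrite normrN hb.
Qed.

(** Turns one half of a state into data for the interval estimates. The last identity says that [a]
    times the source density integrates to the energy norm of the corresponding half of
    [i la U - A U]. *)
Lemma wave_of_state L a la (ka k : R -> R) u v S o (V1 V2 O1 O2 dO1 dO2 : R -> R) :
  0 < L -> 0 < a -> bounded_meas L k ->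
  has_wderiv L u (wderiv L u) -> has_wderiv L v (wderiv L v) -> has_wderiv L S (wderiv L S) ->
  aeq L S (fun x => a%:C * wderiv L u x + (ka x)%:C * wderiv L v x) ->
  ac 0 L V1 (fun x => Re (wderiv L v x)) -> ac 0 L V2 (fun x => Im (wderiv L v x)) ->
  aeq L v (fun x => V1 x +i* V2 x) ->
  ac 0 L O1 dO1 -> ac 0 L O2 dO2 -> aeq L o (fun x => O1 x +i* O2 x) -> L2parts L o ->
  exists w, [/\ wave 0 L a la ka k O1 O2 w, v1 w = V1, v2 w = V2,
    p1 w = (fun x => Re (wderiv L u x)) /\ p2 w = (fun x => Im (wderiv L u x)) &
    I 0 L (ent a w) = L2sqnorm L v + a * L2sqnorm L (wderiv L u) /\
    a * I 0 L (src a w) =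
      L2sqnorm L (Complex 0 la *: v - (wderiv L S - (fun x => (k x)%:C * o x)))
      + a * L2sqnorm L (Complex 0 la *: wderiv L u - wderiv L v)].
Proof.
move=> L0 a0 bk hu hv hS eS aV1 aV2 eV aO1 aO2 eO lo.
have [[u1 u2] [du1 du2] _ _] := hu; have [[v1 v2] [gv1 gv2] _ _] := hv.
have [[s1 s2] [ds1 ds2] rs1 rs2] := hS; have [lo1 lo2] := lo.
have [F1 a1 e1] := real_wderiv_ac L0 s1 ds1 rs1; have [F2 a2 e2] := real_wderiv_ac L0 s2 ds2 rs2.
have sV1 := ac_sq (ltW L0) aV1; have sV2 := ac_sq (ltW L0) aV2.
have sO1 := ac_sq (ltW L0) aO1; have sO2 := ac_sq (ltW L0) aO2.
have kO1 : sq 0 L (fun x => k x * O1 x) by case: bk => mk [M hM]; exact: sqM_bnd hM sO1.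
have kO2 : sq 0 L (fun x => k x * O2 x) by case: bk => mk [M hM]; exact: sqM_bnd hM sO2.
(* The sources are defined by the equations themselves, with the absolutely continuous
   representatives in place of [v] and [o], so that these equations hold identically. *)
pose w := WD V1 V2 F1 F2 (fun x => Re (wderiv L u x)) (fun x => Im (wderiv L u x))
  (fun x => - la * Im (wderiv L u x) - Re (wderiv L v x))
  (fun x => la * Re (wderiv L u x) - Im (wderiv L v x))
  (fun x => - la * V2 x - (Re (wderiv L S x) - k x * O1 x))
  (fun x => la * V1 x - (Im (wderiv L S x) - k x * O2 x)).
have sf1 : sq 0 L (f1 w) by rewrite /=; itg_tac.
have sf2 : sq 0 L (f2 w) by rewrite /=; itg_tac.
have sh1 : sq 0 L (h1 w) by rewrite /=; itg_tac.
have sh2 : sq 0 L (h2 w) by rewrite /=; itg_tac.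
have lF : L2parts L (Complex 0 la *: wderiv L u - wderiv L v).
  rewrite -[- wderiv L v]scaleN1r -[_ + _ *: _]addr0 -addrA.
  by apply: L2parts_lin; [split|apply: L2parts_lin; [split|exact: L2parts0]].
have lko := L2parts_mul_bounded bk lo.
have lB : L2parts L (wderiv L S - (fun x => (k x)%:C * o x)).
  rewrite -[- (fun x => _)]scaleN1r addrC; apply: L2parts_lin; first exact: lko.
  exact: hd_g hS.
have lH : L2parts L (Complex 0 la *: v - (wderiv L S - (fun x => (k x)%:C * o x))).
  rewrite -[- (_ - _)]scaleN1r -[_ + _ *: _]addr0 -addrA.
  by apply: L2parts_lin; [split|apply: L2parts_lin; [exact: lB|exact: L2parts0]].
exists w; split; [|exact: erefl|exact: erefl|by split|].
- split; [exact: du1|exact: du2|exact: sf1|exact: sf2|exact: sh1|exact: sh2| | | | |].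
  + by apply: ac_eq aV1 => x _; rewrite /dv1/=; ring.
  + by apply: ac_eq aV2 => x _; rewrite /dv2/=; ring.
  + by apply: ac_eq a1 => x _ /=; ring.
  + by apply: ac_eq a2 => x _ /=; ring.
  + apply: (aeS (aeI eS (aeI e1 e2))) => x [es [h1 h2]] hx.
    rewrite /= -h1// -h2// es//= /dv1 /dv2/=.
    by case: (wderiv L u x) (wderiv L v x) => [? ?] [? ?] /=; split; ring.
- have L2s F G : L2parts L F -> L2parts L G -> L2sqnorm L F + a * L2sqnorm L G =
      I 0 L (fun x => sqmod (F x) + a * sqmod (G x)).
    by move=> /sqmod_itg h1 /sqmod_itg h2; rewrite (ID h1 (itgZ a h2)) (IZ a h2).
  have itL F G : L2parts L F -> L2parts L G -> itg 0 L (fun x => sqmod (F x) + a * sqmod (G x)).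
    by move=> /sqmod_itg h1 /sqmod_itg h2; exact: (itgD h1 (itgZ a h2)).
  split.
    rewrite (L2s _ _ (hd_f hv) (hd_g hu)).
    apply: I_ae; [by rewrite /ent/=; itg_tac|exact: (itL _ _ (hd_f hv) (hd_g hu))|].
    by apply: (aeS eV) => x hx /hx; rewrite /ent/= => ->; rewrite /sqmod/=; ring.
  have isrc : itg 0 L (src a w) by rewrite /src; itg_tac.
  rewrite (L2s _ _ lH lF) -(IZ a isrc).
  apply: I_ae; [exact: itgZ|exact: (itL _ _ lH lF)|].
  apply: (aeS (aeI eV eO)) => x [h1 h2] hx.
  change (a * src a w x = sqmod (Complex 0 la * v x - (wderiv L S x - (k x)%:C * o x))
    + a * sqmod (Complex 0 la * wderiv L u x - wderiv L v x)).
  rewrite /src h1// h2//= /sqmod.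
  case: (wderiv L u x) (wderiv L v x) (wderiv L S x) => [? ?] [? ?] [? ?] /=.
  by field; rewrite lt0r_neq0.
Qed.

End Component.

(** * The domain and the linearity of the operator *)

Section OperatorDomain.
Local Open Scope complex_scope.
Context {R : realType}.
Variables (L a : R) (b c d : R -> R).
Hypotheses (L0 : 0 < L) (a0 : 0 < a) (hb : bounded_meas L b) (hc : bounded_meas L c) (hd : bounded_meas L d).
Local Notation mu := (@lebesgue_measure R).
Local Notation Re := complex.Re.
Local Notation Im := complex.Im.
Local Notation D := (domA L a b d).
Local Notation A := (opA L a b c d).
Implicit Types (f g h : R -> R[i]) (k z : R[i]) (U V : state R).

(** The domain expressed through the chosen weak derivatives of the fluxes, which are the ones that
    occur in [opA]. *)
Record domA_parts U : Prop := DomAParts {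
  di_H : inH L U; di_v : H10 L U.1.2; di_z : H10 L U.2.2;
  di_S1 : has_wderiv L (flux1 L a b U) (wderiv L (flux1 L a b U));
  di_S2 : has_wderiv L (flux2 L d U) (wderiv L (flux2 L d U)) }.

Lemma L2partsZ k f : L2parts L f -> L2parts L (k *: f).
Proof. by move=> h; rewrite -[k *: f]addr0; apply: L2parts_lin => //; exact: L2parts0. Qed.

Lemma L2partsD f g : L2parts L f -> L2parts L g -> L2parts L (f + g).
Proof. by move=> h; rewrite -[f]scale1r; exact: L2parts_lin. Qed.

Lemma L2partsB f g : L2parts L f -> L2parts L g -> L2parts L (f - g).
Proof. by move=> hf hg; rewrite -[- g]scaleN1r; apply: L2partsD => //; exact: L2partsZ. Qed.

Lemma flux1_L2parts U : inH L U -> H10 L U.1.2 -> L2parts L (flux1 L a b U).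
Proof.
move=> /inH_partsP[hu _ _ _] /H10_hasd hv.
have h1 := L2partsZ a%:C (hd_g hu); have h2 := L2parts_mul_bounded hb (hd_g hv).
exact: (L2partsD h1 h2).
Qed.

Lemma flux2_L2parts U : inH L U -> H10 L U.2.2 -> L2parts L (flux2 L d U).
Proof.
move=> /inH_partsP[_ _ hy _] /H10_hasd hz.
have h2 := L2parts_mul_bounded hd (hd_g hz); exact: (L2partsD (hd_g hy) h2).
Qed.

Lemma domA_partsP U : D U <-> domA_parts U.
Proof.
split=> [[h1 h2 h3 h4 h5]|[h1 h2 h3 h4 h5]]; split=> //.
- by apply/has_wderivP => //; exact: flux1_L2parts.
- by apply/has_wderivP => //; exact: flux2_L2parts.
- by apply/has_wderivP => //; exact: flux1_L2parts.
- by apply/has_wderivP => //; exact: flux2_L2parts.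
Qed.

Lemma flux_lin (p q : R) k (x1 x2 y1 y2 : R[i]) :
  p%:C * (k * x1 + x2) + q%:C * (k * y1 + y2) =
  k * (p%:C * x1 + q%:C * y1) + (p%:C * x2 + q%:C * y2).
Proof. by ring. Qed.

Lemma flux1_lin k U V : domA_parts U -> domA_parts V ->
  aeq L (flux1 L a b (k *: U + V)) (k *: flux1 L a b U + flux1 L a b V).
Proof.
move=> [/inH_partsP[hu _ _ _] /H10_hasd hv _ _ _] [/inH_partsP[hu' _ _ _] /H10_hasd hv' _ _ _].
apply: (aeS (aeI (wderiv_lin k L0 hu hu') (wderiv_lin k L0 hv hv'))) => x [e1 e2] hx.
change (a%:C * wderiv L (k *: U.1.1 + V.1.1) x + (b x)%:C * wderiv L (k *: U.1.2 + V.1.2) x =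
  k * (a%:C * wderiv L U.1.1 x + (b x)%:C * wderiv L U.1.2 x)
  + (a%:C * wderiv L V.1.1 x + (b x)%:C * wderiv L V.1.2 x)).
by rewrite e1// e2//; exact: flux_lin.
Qed.

Lemma flux2_lin k U V : domA_parts U -> domA_parts V ->
  aeq L (flux2 L d (k *: U + V)) (k *: flux2 L d U + flux2 L d V).
Proof.
move=> [/inH_partsP[_ _ hu _] _ /H10_hasd hv _ _] [/inH_partsP[_ _ hu' _] _ /H10_hasd hv' _ _].
apply: (aeS (aeI (wderiv_lin k L0 hu hu') (wderiv_lin k L0 hv hv'))) => x [e1 e2] hx.
change (wderiv L (k *: U.2.1 + V.2.1) x + (d x)%:C * wderiv L (k *: U.2.2 + V.2.2) x =
  k * (wderiv L U.2.1 x + (d x)%:C * wderiv L U.2.2 x)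
  + (wderiv L V.2.1 x + (d x)%:C * wderiv L V.2.2 x)).
by rewrite e1// e2//; have := flux_lin 1 (d x) k; rewrite rmorph1 => H; move: (H (wderiv L U.2.1 x) (wderiv L V.2.1 x) (wderiv L U.2.2 x) (wderiv L V.2.2 x)); rewrite !mul1r.
Qed.

Lemma domA_parts_lin k U V : domA_parts U -> domA_parts V -> domA_parts (k *: U + V).
Proof.
move=> hU hV; have [H1 v1 z1 S1 T1] := hU; have [H2 v2 z2 S2 T2] := hV.
have H3 := inH_lin k L0 H1 H2.
have v3 : H10 L (k *: U + V).1.2 by exact: (H10_lin k L0 v1 v2).
have z3 : H10 L (k *: U + V).2.2 by exact: (H10_lin k L0 z1 z2).
split; [exact: H3|exact: v3|exact: z3| |].
- have hl := has_wderiv_lin k S1 S2.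
  exact: (has_wderiv_wderiv (has_wderiv_ae (flux1_L2parts H3 v3) (hd_g hl) (aeq_sym (flux1_lin k hU hV)) (aeq_refl L _) hl)).
- have hl := has_wderiv_lin k T1 T2.
  exact: (has_wderiv_wderiv (has_wderiv_ae (flux2_L2parts H3 z3) (hd_g hl) (aeq_sym (flux2_lin k hU hV)) (aeq_refl L _) hl)).
Qed.

Lemma wderiv_flux_lin k f g h : has_wderiv L f (wderiv L f) -> has_wderiv L g (wderiv L g) -> has_wderiv L h (wderiv L h) ->
  aeq L h (k *: f + g) -> aeq L (wderiv L h) (k *: wderiv L f + wderiv L g).
Proof.
move=> hf hg hh e; have hl := has_wderiv_lin k hf hg.
exact: (has_wderiv_unique L0 hh (has_wderiv_ae (hd_f hh) (hd_g hl) (aeq_sym e) (aeq_refl L _) hl)).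
Qed.

Lemma opA_inH U : domA_parts U -> inH L (A U).
Proof.
move=> [_ v1 z1 S1 S2]; have hv := H10_hasd v1; have hz := H10_hasd z1.
have cz := L2parts_mul_bounded hc (hd_f hz); have cv := L2parts_mul_bounded hc (hd_f hv).
have r1 := (L2P _ _).2 (L2partsB (hd_g S1) cz); have r2 := (L2P _ _).2 (L2partsD (hd_g S2) cv).
by split; [exact: v1|exact: r1|exact: z1|exact: r2].
Qed.

Lemma domA_parts0 : domA_parts 0.
Proof.
have H0 := H10_0 L0; have z0 := wderiv0 L0.
have I0 : inH L (0 : state R) by split; [exact: H0|exact/L2P/L2parts0|exact: H0|exact/L2P/L2parts0].
split; [exact: I0|exact: H0|exact: H0| |].
- apply: has_wderiv_wderiv; apply: (has_wderiv_ae _ (L2parts0 L) _ (aeq_refl L _) (has_wderiv0 L)).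
    exact: flux1_L2parts.
  apply: (aeS z0) => x e hx.
  change (0 = a%:C * wderiv L 0 x + (b x)%:C * wderiv L 0 x).
  by rewrite e// !mulr0 addr0.
- apply: has_wderiv_wderiv; apply: (has_wderiv_ae _ (L2parts0 L) _ (aeq_refl L _) (has_wderiv0 L)).
    exact: flux2_L2parts.
  apply: (aeS z0) => x e hx.
  change (0 = wderiv L 0 x + (d x)%:C * wderiv L 0 x).
  by rewrite e// mulr0 addr0.
Qed.

Lemma aeq_lower k f g h (q : R -> R) (f' g' : R -> R[i]) : aeq L h (k *: f + g) ->
  aeq L ((fun x => h x + (q x)%:C * (k *: f' + g') x)
    - (k *: (fun x => f x + (q x)%:C * f' x) + (fun x => g x + (q x)%:C * g' x))) 0.
Proof.
move=> e; apply: (aeS e) => x ex hx.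
change (h x + (q x)%:C * (k * f' x + g' x)
  - (k * (f x + (q x)%:C * f' x) + (g x + (q x)%:C * g' x)) = 0).
rewrite ex//.
change (k * f x + g x + (q x)%:C * (k * f' x + g' x)
  - (k * (f x + (q x)%:C * f' x) + (g x + (q x)%:C * g' x)) = 0).
by ring.
Qed.

Lemma aeq_lowerN k f g h (q : R -> R) (f' g' : R -> R[i]) : aeq L h (k *: f + g) ->
  aeq L ((fun x => h x - (q x)%:C * (k *: f' + g') x)
    - (k *: (fun x => f x - (q x)%:C * f' x) + (fun x => g x - (q x)%:C * g' x))) 0.
Proof.
move=> e; apply: (aeS e) => x ex hx.
change (h x - (q x)%:C * (k * f' x + g' x)
  - (k * (f x - (q x)%:C * f' x) + (g x - (q x)%:C * g' x)) = 0).
rewrite ex//.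
change (k * f x + g x - (q x)%:C * (k * f' x + g' x)
  - (k * (f x - (q x)%:C * f' x) + (g x - (q x)%:C * g' x)) = 0).
by ring.
Qed.

Lemma opA12 U : (A U).1.2 = fun x => wderiv L (flux1 L a b U) x - (c x)%:C * U.2.2 x.
Proof. by []. Qed.

Lemma opA22 U : (A U).2.2 = fun x => wderiv L (flux2 L d U) x + (c x)%:C * U.1.2 x.
Proof. by []. Qed.

Lemma opA_lin k U V : domA_parts U -> domA_parts V ->
  normH L a (A (k *: U + V) - (k *: A U + A V)) = 0.
Proof.
move=> hU hV; have hS := domA_parts_lin k hU hV.
have hA := opA_inH hS; have hB := inH_lin k L0 (opA_inH hU) (opA_inH hV).
have SI := energy_semi_inner L0 a0.
apply: (normH_eq0 a L0 (si_B SI hA hB)).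
- change (aeq L (wderiv L ((k *: U.1.2 + V.1.2) - (k *: U.1.2 + V.1.2))) 0).
  by rewrite subrr; exact: wderiv0.
- have e := wderiv_flux_lin (di_S1 hU) (di_S1 hV) (di_S1 hS) (flux1_lin k hU hV).
  change (aeq L ((A (k *: U + V)).1.2 - (k *: (A U).1.2 + (A V).1.2)) 0).
  have H := aeq_lowerN c U.2.2 V.2.2 e.
  by rewrite opA12 (opA12 U) (opA12 V).
- change (aeq L (wderiv L ((k *: U.2.2 + V.2.2) - (k *: U.2.2 + V.2.2))) 0).
  by rewrite subrr; exact: wderiv0.
- have e := wderiv_flux_lin (di_S2 hU) (di_S2 hV) (di_S2 hS) (flux2_lin k hU hV).
  change (aeq L ((A (k *: U + V)).2.2 - (k *: (A U).2.2 + (A V).2.2)) 0).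
  have H := aeq_lower c U.1.2 V.1.2 e.
  by rewrite opA22 (opA22 U) (opA22 V).
Qed.

Lemma domain_linear_A : domain_linear (inH L) (innerH L a) D A.
Proof.
split.
- by move=> U [].
- by move=> U /domA_partsP; exact: opA_inH.
- by apply/domA_partsP; exact: domA_parts0.
- by move=> k U V /domA_partsP hU /domA_partsP hV; apply/domA_partsP; exact: domA_parts_lin.
- by move=> k U V /domA_partsP hU /domA_partsP hV; exact: opA_lin.
Qed.

End OperatorDomain.

(** * Transfer of the estimates to the energy space *)

Section Glue.
Local Open Scope complex_scope.
Context {R : realType}.
Implicit Types (L a la : R).
Local Notation mu := (@lebesgue_measure R).
Local Notation Re := complex.Re.
Local Notation Im := complex.Im.

Lemma wderivB_ae L (k : R[i]) (u v : R -> R[i]) : 0 < L -> has_wderiv L u (wderiv L u) -> has_wderiv L v (wderiv L v) ->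
  has_wderiv L (k *: u - v) (k *: wderiv L u - wderiv L v).
Proof.
move=> L0 hu hv; have := has_wderiv_lin k hu (has_wderivB (has_wderiv0 L) hv).
by rewrite !sub0r.
Qed.

Lemma L2sqnorm_wderivB L (k : R[i]) (u v : R -> R[i]) : 0 < L ->
  has_wderiv L u (wderiv L u) -> has_wderiv L v (wderiv L v) ->
  L2sqnorm L (wderiv L (k *: u - v)) = L2sqnorm L (k *: wderiv L u - wderiv L v).
Proof.
move=> L0 hu hv; have h := wderivB_ae k L0 hu hv; have h' := has_wderiv_wderiv h.
exact: (L2sqnorm_ae (hd_g h') (hd_g h) (has_wderiv_unique L0 h' h)).
Qed.

Lemma source_ge0 a w (x : R) : 0 <= a -> 0 <= src a w x.
Proof.
move=> a0; apply: addr_ge0; first by apply: addr_ge0; exact: sqr_ge0.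
by apply: divr_ge0 => //; apply: addr_ge0; exact: sqr_ge0.
Qed.

(** [Nsrc] weights the first wave by [n1], the energy norm by [a n1]; the factor [1 + a^-1] covers
    the discrepancy whether [a] is large or small. *)
Lemma resolvent_arith (a K l e1 e2 e3 e4 n1 n2 r1 r2 r3 r4 : R) :
  0 < a -> 0 <= K -> 0 <= l -> 0 <= n1 -> 0 <= n2 ->
  a * n1 = r1 + r2 -> n2 = r3 + r4 ->
  e1 + e2 + (e3 + e4) <= K * l * (n1 + n2) ->
  e1 + e2 + e3 + e4 <= K * (1 + a^-1) * l * (r1 + r2 + r3 + r4).
Proof.
move=> a0 K0 l0 p1 p2 E1 E2 h; rewrite addrA in h; apply: (le_trans h).
have -> : K * (1 + a^-1) * l * (r1 + r2 + r3 + r4) = K * l * ((1 + a^-1) * (a * n1 + n2)).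
  by rewrite E1 E2; ring.
apply: ler_wpM2l; first exact: mulr_ge0.
rewrite mulrDl mul1r mulrDr mulKf ?lt0r_neq0//.
have q1 : 0 <= a * n1 by rewrite mulr_ge0// ltW.
have q2 : 0 <= a^-1 * n2 by rewrite mulr_ge0// invr_ge0 ltW.
lra.
Qed.

(** Both velocities and both displacements are replaced by representatives vanishing at 0 and L. The
    second component is a wave with [a = 1] and coupling coefficient [- c]. *)
Lemma resolvent_estimate L a (b0 b1 b2 c0 c1 c2 d0 d1 d2 : R)
  (b := local_coef b0 b1 b2) (c := local_coef c0 c1 c2) (d := local_coef d0 d1 d2) :
  0 < L -> 0 < a -> 0 < b0 -> 0 < d0 ->
  [&& 0 < b1, b1 < b2, b2 < c1, c1 < c2, c2 < d1, d1 < d2 & d2 < L] ->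
  `|c0| * (c2 - c1) < Num.sqrt a -> `|c0| * (c2 - c1) < 1 ->
  exists2 K : R, 0 < K & forall la (U : state R), domA L a b d U ->
    qf (innerH L a) U <=
    K * (1 + `|la|) * qf (innerH L a) (Complex 0 la *: U - opA L a b c d U).
Proof.
move=> L0 a0 b00 d00 ord hc1 hc2.
have [K K0 HK] := wave_resolvent_estimate L0 a0 b00 d00 ord hc1 hc2.
have SI := energy_semi_inner L0 a0.
have hb : bounded_meas L b by exact: local_coef_bounded_meas.
have hc : bounded_meas L c by exact: local_coef_bounded_meas.
have hd : bounded_meas L d by exact: local_coef_bounded_meas.
have ia0 : 0 < a^-1 by rewrite invr_gt0.
exists (K * (1 + a^-1)); first by rewrite mulr_gt0// addr_gt0.
move=> la U /(domA_partsP a hb hd) dU; have [HU v10 z10 S1 S2] := dU.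
have hA := opA_inH hc dU.
set k := Complex 0 la; set F := k *: U - opA L a b c d U.
have HF : inH L F := si_B SI (si_Z SI k HU) hA.
have [u10 _ y10 _] := HU.
have hu := H10_hasd u10; have hv := H10_hasd v10; have hy := H10_hasd y10; have hz := H10_hasd z10.
have [V1 [V2 [aV1 aV2 eV [V10 V20 V1L V2L]]]] := H10_trace L0 v10 hv.
have [Z1 [Z2 [aZ1 aZ2 eZ [Z10 Z20 Z1L Z2L]]]] := H10_trace L0 z10 hz.
have [u1 [u2 [au1 au2 _ [u1_0 u2_0 u1L u2L]]]] := H10_trace L0 u10 hu.
have [y1 [y2 [ay1 ay2 _ [y1_0 y2_0 y1L y2L]]]] := H10_trace L0 y10 hy.
have eS2 : aeq L (flux2 L d U)
    (fun x => 1%:C * wderiv L U.2.1 x + (d x)%:C * wderiv L U.2.2 x).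
  apply: (aeS (aeq_refl L (flux2 L d U))) => x _ _.
  by rewrite rmorph1 mul1r.
have [wu [Wu wu1 wu2 [pu1 pu2] [Eu Nu]]] := wave_of_state la L0 a0 hc hu hv S1
  (aeq_refl L (flux1 L a b U)) aV1 aV2 eV aZ1 aZ2 eZ (hd_f hz).
have [wy [Wy wy1 wy2 [py1 py2] [Ey Ny]]] := wave_of_state la L0 ltr01 (bounded_measN hc) hy hz S2
  eS2 aZ1 aZ2 eZ aV1 aV2 eV (hd_f hv).
have ws : wsystem L a b c d la wu wy.
  split; rewrite ?wu1 ?wu2 ?wy1 ?wy2//.
have du : displacement L wu u1 u2 by split; rewrite ?pu1 ?pu2.
have dy : displacement L wy y1 y2 by split; rewrite ?py1 ?py2.
have := HK la wu wy u1 u2 y1 y2 ws du dy.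
rewrite /Etot /Nsrc (ID (ent_itg (ltW L0) Wu) (ent_itg (ltW L0) Wy)) Eu Ey.
have iu := src_itg a (w_f1 Wu) (w_f2 Wu) (w_h1 Wu) (w_h2 Wu).
have iy := src_itg 1 (w_f1 Wy) (w_f2 Wy) (w_h1 Wy) (w_h2 Wy).
rewrite (ID iu iy).
rewrite (qfE a HU) (qfE a HF) mul1r.
have F12 : F.1.2 = k *: U.1.2 - (wderiv L (flux1 L a b U) - (fun x => (c x)%:C * U.2.2 x)) by [].
have F22 : F.2.2 = k *: U.2.2 - (wderiv L (flux2 L d U) - (fun x => (- c x)%:C * U.1.2 x)).
  change (k *: U.2.2 - (opA L a b c d U).2.2 = k *: U.2.2 - (wderiv L (flux2 L d U) - (fun x => (- c x)%:C * U.1.2 x))).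
  congr (_ - _); rewrite opA22; apply/funext => x.
  change (wderiv L (flux2 L d U) x + (c x)%:C * U.1.2 x = wderiv L (flux2 L d U) x - (- c x)%:C * U.1.2 x).
  by rewrite rmorphN mulNr opprK.
have F11 : F.1.1 = k *: U.1.1 - U.1.2 by [].
have F21 : F.2.1 = k *: U.2.1 - U.2.2 by [].
rewrite F12 F22 F11 F21 (L2sqnorm_wderivB k L0 hu hv) (L2sqnorm_wderivB k L0 hy hz).
rewrite mul1r [in RHS]mul1r in Ny.
have [s1 s2] : 0 <= I 0 L (src a wu) /\ 0 <= I 0 L (src 1 wy).
  split; apply: I_ge0 => x _; apply: source_ge0; first exact: ltW.
  exact: ler01.
rewrite -/k in Nu Ny; have la1 : 0 <= 1 + `|la| by rewrite addr_ge0.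
move=> hE; have := resolvent_arith a0 (ltW K0) la1 s1 s2 Nu Ny hE.
by [].
Qed.

Lemma cvg_right0P (g : R -> R) : (forall h, 0 <= g h) ->
  (g h @[h --> 0^'+] --> (0 : R)) <->
  forall e, 0 < e -> exists2 d, 0 < d & forall h, 0 < h < d -> g h < e.
Proof.
move=> g0; split=> [H e e0|H].
  move/cvgrPdist_lt : H => /(_ _ e0).
  rewrite near_withinE => /nbhs_ballP[d /= d0 hd].
  exists d => // h /andP[h0 hlt].
  have := hd h; rewrite /ball/= sub0r normrN gtr0_norm// => /(_ hlt h0).
  by rewrite sub0r normrN ger0_norm.
apply/cvgrPdist_lt => e /H[d d0 hd].
rewrite near_withinE; apply/nbhs_ballP; exists d => //= h.
rewrite /ball/= sub0r normrN => hlt h0; rewrite sub0r normrN ger0_norm//.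
by apply: hd; rewrite h0 -(gtr0_norm h0).
Qed.

Lemma contraction_semigroup_of_C0 L a (b c d : R -> R) (T : R -> state R -> state R) : 0 < L -> 0 < a ->
  contraction_C0_semigroup L a T -> is_generator L a T (domA L a b d) (opA L a b c d) ->
  contraction_semigroup (inH L) (innerH L a) (domA L a b d) (opA L a b c d) T.
Proof.
move=> L0 a0 [t1 t2 t3 t4 t5] hg; split.
- by move=> t U t0 hU; exact: (t1 t U t0 hU).1.
- by move=> t U t0 hU; exact: (t1 t U t0 hU).2.
- exact: t2.
- exact: t3.
- exact: t4.
- by move=> U hU; apply/cvg_right0P; [move=> h; exact: sqrtr_ge0|exact: t5].
- move=> U V hU hV; rewrite -(hg U V hU hV); apply: iff_sym; apply: cvg_right0P.
  by move=> h; exact: sqrtr_ge0.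
Qed.
End Glue.

Theorem theorem2p6 (R : realType) (L a b0 c0 d0 b1 b2 c1 c2 d1 d2 : R)
  (T : R -> state R -> state R) :
  let b := local_coef b0 b1 b2 in
  let c := local_coef c0 c1 c2 in
  let d := local_coef d0 d1 d2 in
  0 < L -> 0 < a -> 0 < b0 -> 0 < d0 -> c0 != 0 ->
  [&& 0 < b1, b1 < b2, b2 < c1, c1 < c2, c2 < d1, d1 < d2 & d2 < L] ->
  `|c0| < Num.min (Num.sqrt a / (c2 - c1)) (1 / (c2 - c1)) ->
  contraction_C0_semigroup L a T ->
  is_generator L a T (domA L a b d) (opA L a b c d) ->
  exists2 C : R, 0 < C &
    forall U0 : state R, domA L a b d U0 ->
    forall t : R, 0 < t ->
      energy L a (T t U0) <= C / t ^+ 4 * normDA L a b c d U0 ^+ 2.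
Proof.
move=> b c d L0 a0 b00 d00 _ ord; rewrite lt_min => /andP[hc1 hc2] hT hA.
have c12 : 0 < c2 - c1 by case/and5P: ord => _ _ _ h _; rewrite subr_gt0.
rewrite ltr_pdivlMr// in hc1; rewrite ltr_pdivlMr// in hc2.
have [K K0 RES] := resolvent_estimate L0 a0 b00 d00 ord hc1 hc2.
have SI := energy_semi_inner L0 a0.
have hb : bounded_meas L b by exact: local_coef_bounded_meas.
have hc : bounded_meas L c by exact: local_coef_bounded_meas.
have hd : bounded_meas L d by exact: local_coef_bounded_meas.
have DL := domain_linear_A L0 a0 hb hc hd.
have SG := contraction_semigroup_of_C0 L0 a0 hT hA.
have [C C0 HC] := abstract_decay SI DL SG K0 RES.
exists C => // U0 dU t t0.
have hU := dl_H DL dU; have hAU := dl_A DL dU; have hTU := sg_H SG (ltW t0) hU.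
have nD : normDA L a b c d U0 ^+ 2 = qf (innerH L a) U0 + qf (innerH L a) (opA L a b c d U0).
  rewrite /normDA sqr_sqrtr ?addr_ge0 ?sqr_ge0//.
  by rewrite -(nrm2 SI hU) -(nrm2 SI hAU).
rewrite nD (energyE a hTU); apply: le_trans (HC _ _ dU t0).
by rewrite ler_piMl ?(q_ge0 SI)// invf_le1// ler1n.
Qed.
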